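(* Let $\varphi(x)=e^{-|x|}$. For every initial data $v_0 \in H^1(\mathbb{R})$ satisfying $v_0(0)=0$, there exists a unique global solution $v \in C(\mathbb{R}^+,H^1(\mathbb{R}))$, with $v|_{t=0}=v_0$, to the linearized equation $$v_t + (\varphi - 1) v_x + \varphi' v + \varphi' \ast \left( \varphi v + \tfrac{1}{2} \varphi' v_x \right) = 0, \quad x \neq 0,$$ satisfying $v(t,0)=0$, $$\| v(t,\cdot) \|_{H^1(0,\infty)}^2 = \| v_0 \|_{H^1(0,\infty)}^2 + 2 (e^t - 1) \int_0^{\infty} \varphi(s) \left( [v_0(s)]^2 + \tfrac{1}{2} [v'_0(s)]^2 \right) ds$$ and $$\| v(t,\cdot) \|_{H^1(-\infty,0)}^2 = \| v_0 \|_{H^1(-\infty,0)}^2 + 2 (e^{-t} - 1) \int_{-\infty}^0 \varphi(s) \left( [v_0(s)]^2 + \tfrac{1}{2} [v'_0(s)]^2 \right) ds$$ for every $t>0$.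
   Context: Here $\varphi'(x) = -\mathrm{sign}(x)e^{-|x|}$ for $x\neq 0$, $\ast$ is convolution in $x$ on $\mathbb{R}$, and $\mathbb{R}^+$ denotes the half-line of times $t\ge 0$. For an interval $I$, $\|f\|_{H^1(I)}^2=\int_I (f^2+(f')^2)\,dx$. The variable $x$ is the coordinate in the frame travelling with the peakon $\varphi(x-t)$ of the Camassa--Holm equation $u_t+uu_x+\frac12\varphi'\ast(u^2+\frac12u_x^2)=0$, so the peak is at $x=0$; the equation is the linearization at this peakon. The equation is understood as an evolution equation $\frac{dv}{dt}=Av$ in $L^2(\mathbb{R})$, where $Av := (1-\varphi)v' - \varphi' v - \varphi'\ast(\varphi v+\frac12\varphi' v')$ for $x\ne0$. *)

(* Defs.v *)
From HB Require Import structures.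
From mathcomp Require Import all_boot all_order all_algebra.
From mathcomp Require Import all_classical all_reals all_analysis.

Set Implicit Arguments.
Unset Strict Implicit.
Unset Printing Implicit Defensive.

Import Order.TTheory GRing.Theory Num.Theory.
Import numFieldNormedType.Exports.

Local Open Scope classical_set_scope.
Local Open Scope ring_scope.

Section defs.
Context {R : realType}.
Local Notation mu := (@lebesgue_measure R).

Definition phi (x : R) : R := expR (- `|x|).

(* The value at x = 0, where phi is not differentiable, is irrelevant: dphi
   only matters almost everywhere. *)
Definition dphi (x : R) : R := - Num.sg x * expR (- `|x|).

Definition convolution (f g : R -> R) (x : R) : R :=
  \int[mu]_(y in setT) (f (x - y) * g y).

Definition L2 (f : R -> R) : Prop := f \in Lfun mu 2%:E.

Definition normL2 (f : R -> R) : \bar R := 'N[mu]_2%:E[EFin \o f]%E.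

Definition test_function (psi : R -> R) : Prop :=
  [/\ forall x, derivable psi x 1,
      continuous (derive1 psi) &
      compact (closure [set x | psi x != 0])].

(* Weak derivatives, tested against C^1 functions with compact support. *)
Definition is_weak_derivative (f g : R -> R) : Prop :=
  forall psi : R -> R, test_function psi ->
    \int[mu]_(x in setT) (f x * derive1 psi x) =
    - \int[mu]_(x in setT) (g x * psi x).

(* An element of H^1(R) is represented by its continuous representative, so
   that point values such as v(t,0) make sense. *)
Definition H1 (f : R -> R) : Prop :=
  [/\ continuous f, L2 f & exists2 g, L2 g & is_weak_derivative f g].

(* The weak derivative of f in H^1(R); it is unique up to a null set, and a
   representative is chosen (0 if f has no weak derivative in L^2). *)
Definition wderiv (f : R -> R) : R -> R :=
  xget (fun=> 0) [set g | L2 g /\ is_weak_derivative f g].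

(* For f in H^1(R), the H^1 norm of the restriction of f to I. *)
Definition normH1 (I : set R) (f : R -> R) : \bar R :=
  ((\int[mu]_(x in I) (f x ^+ 2 + wderiv f x ^+ 2)%:E) `^ 2^-1)%E.

(* Right-hand side of the linearized equation v_t = A v. *)
Definition linop (v : R -> R) (x : R) : R :=
  (1 - phi x) * wderiv v x - dphi x * v x
  - convolution dphi (fun y => phi y * v y + 2^-1 * (dphi y * wderiv v y)) x.

(* Times range over t >= 0; the values of v at negative times are ignored. *)
Definition continuous_H1 (v : R -> R -> R) : Prop :=
  (forall t, 0 <= t -> H1 (v t)) /\
  (forall t, 0 <= t ->
     normH1 setT (fun x => v s x - v t x)
       @[s --> within [set s | 0 <= s] (nbhs t)] --> 0%E).

(* v(t) is differentiable in L^2(R), with derivative A v(t), at every t >= 0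
   (from the right at t = 0). *)
Definition evolution_eq (v : R -> R -> R) : Prop :=
  forall t, 0 <= t ->
    normL2 (fun x => (v s x - v t x) / (s - t) - linop (v t) x)
      @[s --> within [set s | 0 <= s] t^'] --> 0%E.

Definition global_solution (v0 : R -> R) (v : R -> R -> R) : Prop :=
  [/\ continuous_H1 v, evolution_eq v & forall x, v 0 x = v0 x].

End defs.

(* Main.v *)
(* For v in H^1 and x <> 0, the right-hand side of the equation is
   A v = (1 - phi) v' + phi P - v(0) phi', where P(x) = int_0^x v: on each of
   the intervals cut out by 0 and x, the convolution integrand is an exact
   derivative plus a multiple of v.

   Existence.  When v(0) = 0 the two half-lines decouple.  For x >= 0 let
   S(t,x) = ln(1 + (e^x - 1) e^t), the flow of x' = 1 - e^(-x).  With
   P_0(x) = int_0^x v_0, the solution is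
     v(t,x) = v_0(S(t,x)) + (1 - e^(-t)) e^(-x) P_0(S(t,x)),
   and the reflection (t,x) -> (-t,-x) gives it for x <= 0.  These maps form a
   group, so continuity in H^1 and differentiability in L^2 need only be
   checked at t = 0, where they follow by density of continuous compactly
   supported functions and dominated convergence.  After the change of
   variables s = S(t,x), the two sides of each norm identity differ by the
   integral of an exact derivative.

   Uniqueness.  Along a characteristic X' = phi(X) - 1 the quotient
   P(t,X) / (1 - phi(X)) has time derivative v(t,0), whatever the
   characteristic.  Hence the difference of two solutions has a primitive of
   the form c (1 - phi), whose derivative is continuous at 0 only if c = 0. *)
Require Import Defs.
From HB Require Import structures.
From mathcomp Require Import all_boot all_order all_algebra.
From mathcomp Require Import all_classical all_reals all_analysis.
From mathcomp Require Import measurable_realfun.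
From mathcomp Require Import ring lra.
Import Order.TTheory GRing.Theory Num.Theory.
Import numFieldNormedType.Exports.
Local Open Scope classical_set_scope.
Local Open Scope ring_scope.
Set Implicit Arguments.
Unset Strict Implicit.
Unset Printing Implicit Defensive.

(** * Absolutely continuous functions *)

(** Every derivative is handled through the integral identity [ac]: the product rule is Fubini on a
    triangle, the chain rule a change of variables. Time derivatives exist only in L^2(R), so v_t
    cannot be evaluated along a characteristic. The primitive P can: by Cauchy-Schwarz it turns L^2
    convergence into uniform convergence on bounded intervals, and it solves the closed equation P_t
    = (1 - phi) P_x + phi' P + v(t,0) (1 - phi). Solving this by characteristics explains the
    formula for the solution: on x >= 0, P(t,x) is P_0 along the flow times the factor [amp], and v
    = P_x. A competing solution is not assumed to vanish at x = 0. Its source term v(t,0) is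
    therefore unknown, and uniqueness removes it by comparing two characteristics. In the density
    argument a continuous function has a C^1 primitive, so limits are classical there; they extend
    to L^2 by bounds uniform in t, since the flow moves every point by at most 2|t| and its density
    lies between e^(-|t|) and e^|t|. *)

Section AC.
Context {R : realType}.
Local Notation mu := (@lebesgue_measure R).
Local Notation integ D f := (mu.-integrable D (EFin \o f)).

(* [f'] is the derivative of [f] only almost everywhere. *)
Definition ac (D : set R) (f f' : R -> R) : Prop :=
  forall a b, D a -> D b -> a <= b ->
    integ `[a, b] f' /\ f b - f a = \int[mu]_(x in `[a, b]) f' x.

Lemma Rintegral_cat (a b c : R) (f : R -> R) : a <= b -> b <= c ->
  integ `[a, c] f ->
  \int[mu]_(x in `[a, c]) f x =
  \int[mu]_(x in `[a, b]) f x + \int[mu]_(x in `[b, c]) f x.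
Proof.
move=> ab bc fi; have := @Rintegral_itvB _ f (BLeft a) (BRight c) b fi.
rewrite !bnd_simp => /(_ ab bc) h.
rewrite -(@Rintegral_itv_obnd_cbnd _ b (BRight c)); last first.
  apply: integrableS fi => //; apply: subset_itvr; rewrite bnd_simp//.
by rewrite -h addrC subrK.
Qed.

Lemma integrable_setU (A B : set R) (f : R -> R) :
  measurable A -> measurable B -> [disjoint A & B] ->
  integ A f -> integ B f -> integ (A `|` B) f.
Proof.
move=> mA mB dAB /integrableP[f1 fA] /integrableP[f2 fB].
have mf : measurable_fun (A `|` B) (EFin \o f) by apply/measurable_funU.
apply/integrableP; split => //.
rewrite ge0_integral_setU//; first exact: lte_add_pinfty.
exact: measurableT_comp.
Qed.

Lemma integrable_cat (a b c : R) (f : R -> R) : a <= b -> b <= c ->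
  integ `[a, b] f -> integ `[b, c] f -> integ `[a, c] f.
Proof.
move=> ab bc f1 f2.
rewrite (@itv_bndbnd_setU _ _ _ (BRight b)) ?bnd_simp//; apply: integrable_setU => //.
  by apply/disj_setPS => x /=; rewrite !in_itv/= => -[/andP[_ h]]; rewrite ltNge h.
by apply: integrableS f2 => //; apply: subset_itvr; rewrite bnd_simp.
Qed.

Lemma le_integrableR (D : set R) (f g : R -> R) : measurable D ->
  measurable_fun D f -> (forall x, D x -> `|f x| <= g x) -> integ D g -> integ D f.
Proof.
move=> mD mf fg; apply: le_integrable => //; first exact/measurable_EFinP.
move=> x Dx /=; rewrite lee_fin (le_trans (fg _ Dx))//; exact: ler_norm.
Qed.

Lemma ae_eq_integrable (D : set R) (f g : R -> R) : measurable D ->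
  measurable_fun D g -> ae_eq mu D f g -> integ D f -> integ D g.
Proof.
move=> mD mg fg /integrableP[mf fi].
have mg' : measurable_fun D (EFin \o g) by exact/measurable_EFinP.
apply/integrableP; split => //.
rewrite (@ae_eq_integral _ _ _ mu D (fun x => `|(EFin \o f) x|%E))//.
- exact: measurableT_comp.
- exact: measurableT_comp.
- by apply: filterS fg => x /= h Dx; rewrite h.
Qed.

Lemma ae_eq_Rintegral (D : set R) (f g : R -> R) : measurable D ->
  measurable_fun D f -> measurable_fun D g -> ae_eq mu D f g ->
  \int[mu]_(x in D) f x = \int[mu]_(x in D) g x.
Proof.
move=> mD mf mg fg; rewrite /Rintegral; congr fine; apply: ae_eq_integral => //.
- exact/measurable_EFinP.
- exact/measurable_EFinP.
- by apply: filterS fg => x /= h Dx; rewrite h.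
Qed.

Lemma ae_eq_pt (p : R) (D : set R) (f g : R -> R) :
  (forall x, D x -> x != p -> f x = g x) -> ae_eq mu D f g.
Proof.
move=> h; exists [set p]; split; [exact: measurable_set1|exact: lebesgue_measure_set1|].
by move=> x /=; apply: contra_notP => /eqP xp Dx; apply: h.
Qed.

Lemma is_interval_sub (D : set R) a b x : is_interval D -> D a -> D b ->
  a <= x -> x <= b -> D x.
Proof. by move=> iD Da Db ax xb; apply: (iD a b) => //; rewrite ax. Qed.

Lemma integD (D : set R) (f g : R -> R) : measurable D -> integ D f -> integ D g ->
  integ D (fun x => f x + g x).
Proof.
move=> mD fi gi.
by rewrite (_ : _ \o _ = (EFin \o f) \+ (EFin \o g))%E//; exact: integrableD.
Qed.

Lemma integN (D : set R) (f : R -> R) : measurable D -> integ D f ->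
  integ D (fun x => - f x).
Proof.
move=> mD fi; rewrite (_ : _ \o _ = -%E \o (EFin \o f))//.
exact: integrableN.
Qed.

Lemma integB (D : set R) (f g : R -> R) : measurable D -> integ D f -> integ D g ->
  integ D (fun x => f x - g x).
Proof. by move=> mD fi /(integN mD); exact: integD. Qed.

Lemma integZl (D : set R) (k : R) (f : R -> R) : measurable D -> integ D f ->
  integ D (fun x => k * f x).
Proof.
move=> mD fi; rewrite (_ : _ \o _ = fun x => k%:E * (EFin \o f) x)%E//.
exact: integrableZl.
Qed.

Lemma integZr (D : set R) (k : R) (f : R -> R) : measurable D -> integ D f ->
  integ D (fun x => f x * k).
Proof. by move=> mD /(integZl k mD); under eq_fun do rewrite mulrC. Qed.

Lemma acD D f f' g g' : ac D f f' -> ac D g g' ->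
  ac D (fun x => f x + g x) (fun x => f' x + g' x).
Proof.
move=> af ag a b Da Db ab; have [fi fe] := af _ _ Da Db ab.
have [gi ge] := ag _ _ Da Db ab; split; first exact: integD.
by rewrite RintegralD// -fe -ge; ring.
Qed.

Lemma acZ D k f f' : ac D f f' ->
  ac D (fun x => k * f x) (fun x => k * f' x).
Proof.
move=> af a b Da Db ab; have [fi fe] := af _ _ Da Db ab; split; first exact: integZl.
by rewrite RintegralZl// -fe; ring.
Qed.

Lemma acN D f f' : ac D f f' -> ac D (fun x => - f x) (fun x => - f' x).
Proof.
by move=> /(@acZ _ (-1)); under eq_fun do rewrite mulN1r; under [X in ac _ _ X]eq_fun do rewrite mulN1r.
Qed.

Lemma acB D f f' g g' : ac D f f' -> ac D g g' ->
  ac D (fun x => f x - g x) (fun x => f' x - g' x).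
Proof. by move=> af /acN; exact: acD. Qed.

Lemma ac_cst D k : ac D (fun=> k) (fun=> 0).
Proof.
move=> a b _ _ _; split; first exact: integrable0.
by rewrite subrr Rintegral_cst// mul0r.
Qed.

Lemma ac_measurable (D : set R) (f f' : R -> R) (a b : R) : ac D f f' -> D a -> D b -> a <= b ->
  measurable_fun `[a, b] f'.
Proof. by move=> af Da Db ab; have [/integrableP[/measurable_EFinP]] := af _ _ Da Db ab. Qed.

Lemma itv_cc_sub (D : set R) (a b : R) : is_interval D -> D a -> D b ->
  `[a, b] `<=` D.
Proof.
by move=> iD Da Db x; rewrite /= in_itv/= => /andP[? ?]; exact: (is_interval_sub iD Da Db).
Qed.

Lemma ac_ae (D : set R) (f g f' g' : R -> R) : is_interval D -> measurable D ->
  (forall x, D x -> f x = g x) ->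
  measurable_fun D g' -> (ae_eq mu D f' g') -> ac D f f' -> ac D g g'.
Proof.
move=> iD mD fg mg' fg' af a b Da Db ab; have [fi fe] := af _ _ Da Db ab.
have sD := itv_cc_sub iD Da Db.
have mg : measurable_fun `[a, b] g' by exact: measurable_funS mg'.
have e : ae_eq mu `[a, b]%classic f' g' by apply: filterS fg' => x /= h /sD; exact: h.
split; first exact: ae_eq_integrable fi.
rewrite -!fg// fe; apply: ae_eq_Rintegral => //.
exact: ac_measurable af Da Db ab.
Qed.

Lemma ac_sub D E f f' : D `<=` E -> ac E f f' -> ac D f f'.
Proof. by move=> DE af a b /DE Ea /DE Eb; exact: af. Qed.

Lemma ac_glue p f f' : ac [set x | x <= p] f f' -> ac [set x | p <= x] f f' ->
  ac setT f f'.
Proof.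
move=> a1 a2 a b _ _ ab; have [bp|pb] := leP b p.
  by apply: a1 => //=; exact: le_trans bp.
have [pa|ap] := leP p a; first by apply: a2 => //=; exact: ltW.
have [i1 e1] := a1 a p (ltW ap) (lexx _) (ltW ap).
have [i2 e2] := a2 p b (lexx _) (ltW pb) (ltW pb).
have ii := integrable_cat (ltW ap) (ltW pb) i1 i2.
split => //; rewrite (Rintegral_cat (ltW ap) (ltW pb))// -e1 -e2; ring.
Qed.

(** Tonelli bounds the double integral by the product of the two L^1 norms. This licenses Fubini on
    the triangle behind the product rule. *)
Lemma triangle_integrable (f g : R -> R) : integ setT f -> integ setT g ->
  (mu \x mu)%E.-integrable setT
    (fun z : R * R => (if z.2 <= z.1 then f z.1 * g z.2 else 0)%:E).
Proof.
move=> fi gi; have /integrableP[/measurable_EFinP mf fI] := fi.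
have /integrableP[/measurable_EFinP mg gI] := gi.
have mf' : measurable_fun setT (fun x => `|(EFin \o f) x|%E).
  by apply: measurableT_comp => //; exact/measurable_EFinP.
have mg' : measurable_fun setT (fun x => `|(EFin \o g) x|%E).
  by apply: measurableT_comp => //; exact/measurable_EFinP.
have mF : measurable_fun setT (fun z : R * R => (if z.2 <= z.1 then f z.1 * g z.2 else 0)%:E).
  apply/measurable_EFinP; apply: measurable_fun_ifT => //.
    apply: measurable_fun_ler; [exact: measurable_snd|exact: measurable_fst].
  apply: measurable_funM; apply: measurableT_comp => //.
apply/integrable12ltyP => //.
set C := (\int[mu]_y `|(EFin \o g) y|)%E in gI.
apply: (@le_lt_trans _ _ (\int[mu]_x (`|(EFin \o f) x| * C))%E); last first.
  rewrite ge0_integralZr//; last exact: integral_ge0.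
  rewrite lte_mul_pinfty//; [exact: integral_ge0|].
  by rewrite ge0_fin_numE//; exact: integral_ge0.
apply: ge0_le_integral => //.
- by move=> x _; apply: integral_ge0.
- have mF' : measurable_fun setT (fun z : R * R => `|(if z.2 <= z.1 then f z.1 * g z.2 else 0)%:E|%E).
    exact: measurableT_comp.
  by have := @measurable_fun_fubini_tonelli_F _ _ _ _ _ mu _ mF' (fun=> abse_ge0 _); exact.
- exact: emeasurable_funM.
move=> x _; rewrite /C -ge0_integralZl//.
apply: ge0_le_integral => //.
- apply: measurableT_comp => //; apply/measurable_EFinP; apply: measurable_fun_ifT => //.
    by apply: measurable_fun_ler => //=; exact: measurable_id.
  by rewrite /=; apply: measurable_funM.
- exact: measurable_funeM.
- move=> y _ /=; case: ifPn => _; first by rewrite normrM EFinM.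
  by rewrite normr0 mule_ge0.
Qed.

Lemma integrable_patch (D : set R) (f : R -> R) : measurable D ->
  integ setT (f \_ D) <-> integ D f.
Proof.
move=> mD; have := @integrable_mkcond _ _ _ mu D (EFin \o f) mD.
by rewrite -restrict_EFin => -[? ?]; split.
Qed.

(** Both integrals equal that of f'(x) g'(y) over the triangle a <= y <= x <= b, computed in the two
    orders. *)
Lemma ac_fubini D f f' g g' a b : is_interval D -> ac D f f' -> ac D g g' ->
  D a -> D b -> a <= b ->
  integ `[a, b] (fun x => f' x * (g x - g a)) /\
  \int[mu]_(x in `[a, b]) (f' x * (g x - g a)) =
  \int[mu]_(x in `[a, b]) (g' x * (f b - f x)).
Proof.
move=> iD af ag Da Db ab; have [fi fe] := af _ _ Da Db ab.
have [gi ge] := ag _ _ Da Db ab.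
have sD := itv_cc_sub iD Da Db.
have mI : measurable (`[a, b] : set R) by exact: measurable_itv.
pose F := f' \_ `[a, b]; pose G := g' \_ `[a, b].
have Fi : integ setT F by apply/integrable_patch.
have Gi : integ setT G by apply/integrable_patch.
have TI := triangle_integrable Fi Gi.
have Hx : (fun x => \int[mu]_y (if y <= x then F x * G y else 0)%:E)%E =
          EFin \o ((fun x => f' x * (g x - g a)) \_ `[a, b]).
  apply/funext => x /=; rewrite patchE; case: ifPn => [|xab].
    rewrite inE /= in_itv/= => /andP[ax xb].
    have Dx : D x by apply: sD; rewrite /= in_itv/= ax xb.
    have [gxi gxe] := ag _ _ Da Dx ax.
    transitivity (\int[mu]_y ((f' x)%:E * (EFin \o (g' \_ `[a, x])) y))%E.
      apply: eq_integral => y _; rewrite /F /G /= !patchE !mem_setE !in_itv/= ax xb/=.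
      have [yx|yx] := leP y x; rewrite ?andbF ?andbT ?mule0//.
      by rewrite (le_trans yx xb) andbT.
    rewrite integralZl//; last by apply/integrable_patch.
    rewrite -restrict_EFin -integral_mkcond EFinM; congr (_ * _)%E.
    rewrite gxe; rewrite fineK//; exact: integrable_fin_num.
  apply: integral0_eq => y _; rewrite /F patchE (negbTE xab) mul0r; by case: ifP.
have Hy : (fun y => \int[mu]_x (if y <= x then F x * G y else 0)%:E)%E =
          EFin \o ((fun y => g' y * (f b - f y)) \_ `[a, b]).
  apply/funext => y /=; rewrite patchE; case: ifPn => [|xab].
    rewrite inE /= in_itv/= => /andP[ay yb].
    have Dy : D y by apply: sD; rewrite /= in_itv/= ay yb.
    have [fyi fye] := af _ _ Dy Db yb.
    transitivity (\int[mu]_x ((g' y)%:E * (EFin \o (f' \_ `[y, b])) x))%E.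
      apply: eq_integral => x _; rewrite /F /G /= !patchE !mem_setE !in_itv/= ay yb/=.
      have [yx|yx] := leP y x; rewrite ?andbF ?andbT ?mule0//=.
      by rewrite (le_trans ay yx) /= -EFinM mulrC.
    rewrite integralZl//; last by apply/integrable_patch.
    rewrite -restrict_EFin -integral_mkcond EFinM; congr (_ * _)%E.
    rewrite fye; rewrite fineK//; exact: integrable_fin_num.
  apply: integral0_eq => x _; rewrite /G patchE (negbTE xab) mulr0; by case: ifP.
split.
  by apply/integrable_patch => //; rewrite -Hx; exact: integrable_fubini_F TI.
rewrite [LHS]Rintegral_mkcond [RHS]Rintegral_mkcond /Rintegral; congr fine.
by have := Fubini TI; rewrite Hx Hy.
Qed.

(** Written with increments from a, the two triangles y <= x and x <= y of [ac_fubini] add up to the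
    full square, whose integral is (f b - f a) (g b - g a). *)
Lemma ac_mul D f f' g g' : is_interval D -> ac D f f' -> ac D g g' ->
  ac D (fun x => f x * g x) (fun x => f' x * g x + f x * g' x).
Proof.
move=> iD af ag a b Da Db ab; have [fi fe] := af _ _ Da Db ab.
have [gi ge] := ag _ _ Da Db ab.
have mI : measurable (`[a, b] : set R) by exact: measurable_itv.
have [fgi fge] := ac_fubini iD af ag Da Db ab.
have [gfi gfe] := ac_fubini iD ag af Da Db ab.
have i1 : integ `[a, b] (fun x => f' x * g a) by exact: integZr.
have i2 : integ `[a, b] (fun x => g' x * f a) by exact: integZr.
have i3 : integ `[a, b] (fun x => g' x * (f b - f a)) by exact: integZr.
have e : (fun x => f' x * g x + f x * g' x) = (fun x => (f' x * (g x - g a) + f' x * g a) +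
   (g' x * (f x - f a) + g' x * f a)) by apply/funext => x; ring.
have iA := integD mI fgi i1; have iB := integD mI gfi i2.
split; first by rewrite e; exact: integD.
rewrite e !RintegralD// fge !RintegralZr//.
have -> : (fun x => g' x * (f b - f x)) = fun x => g' x * (f b - f a) - g' x * (f x - f a).
  by apply/funext => x; ring.
rewrite RintegralB// RintegralZr// -fe -ge; ring.
Qed.

Lemma is_derive_continuous (f : R -> R) (x l : R) : is_derive x 1 f l ->
  {for x, continuous f}.
Proof. by move=> [df _]; apply/differentiable_continuous/derivable1_diffP. Qed.

Lemma ac_C1 (D : set R) (f f' : R -> R) : is_interval D -> (forall x, D x -> is_derive x 1 f (f' x)) ->
  (forall x, D x -> {for x, continuous f'}) -> ac D f f'.
Proof.
move=> iD df cf a b Da Db ab; have sD := itv_cc_sub iD Da Db.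
have cw : {within `[a, b], continuous f'}.
  by apply: continuous_in_subspaceT => x /set_mem/sD; exact: cf.
have fi : integ `[a, b] f'.
  by apply: continuous_compact_integrable => //; exact: segment_compact.
split => //; move: ab; rewrite le_eqVlt => /predU1P[<-|ab].
  by rewrite subrr set_itv1 Rintegral_set1.
have dF : derivable_oo_LRcontinuous f a b.
  split.
  - move=> x; rewrite in_itv/= => /andP[ax xb].
    by have [] := df x (is_interval_sub iD Da Db (ltW ax) (ltW xb)).
  - by apply: cvg_at_right_filter; exact: (is_derive_continuous (df a Da)).
  - by apply: cvg_at_left_filter; exact: (is_derive_continuous (df b Db)).
rewrite /Rintegral (continuous_FTC2 ab cw dF)// => x.
rewrite in_itv/= => /andP[ax xb].
have [_ <-] := df x (is_interval_sub iD Da Db (ltW ax) (ltW xb)).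
by rewrite derive1E.
Qed.

Lemma ac_continuous f f' : ac setT f f' -> continuous f.
Proof.
move=> af x.
have xx : x - 1 <= x + 1 by lra.
have [fi _] := af (x - 1) (x + 1) Logic.I Logic.I xx.
have := parameterized_integral_continuous xx fi.
have lt : x - 1 < x + 1 by lra.
move=> /(continuous_within_itvP _ lt)[+ _ _].
move=> /(_ x); rewrite in_itv/= => /(_ ltac:(lra)).
set F := fun _ => _ => cF.
have e y : x - 1 <= y -> f (x - 1) + F y = f y.
  move=> ly; have [_ e] := af (x - 1) y Logic.I Logic.I ly.
  by rewrite /F /parameterized_integral -e; ring.
have cG : (fun y => f (x - 1) + F y) @ x --> f (x - 1) + F x.
  by apply: cvgD => //; exact: cvg_cst.
rewrite /continuous_at -(e x); last lra.
apply: cvg_trans cG; apply: near_eq_cvg; near=> y; rewrite e//.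
by near: y; apply: lt_le_nbhsr; lra.
Unshelve. all: by end_near.
Qed.

(** * Primitives and the fundamental theorem of calculus *)

Lemma set_itvcc_gt (a b : R) : b < a -> `[a, b]%classic = set0.
Proof. by move=> ba; rewrite set_itv_ge// bnd_simp -ltNge. Qed.

(** The oriented integral from 0 to x: for x != 0 one of the two intervals is empty, and for x = 0
    both are a single point. *)
Definition prim (f : R -> R) (x : R) : R :=
  \int[mu]_(y in `[0, x]) f y - \int[mu]_(y in `[x, 0]) f y.

Lemma prim_ge0 f x : 0 <= x -> prim f x = \int[mu]_(y in `[0, x]) f y.
Proof.
rewrite /prim le_eqVlt => /predU1P[<-|x0].
  by rewrite set_itv1 Rintegral_set1 subrr.
by rewrite (set_itvcc_gt x0) Rintegral_set0 subr0.
Qed.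

Lemma prim_le0 f x : x <= 0 -> prim f x = - \int[mu]_(y in `[x, 0]) f y.
Proof.
rewrite /prim le_eqVlt => /predU1P[->|x0].
  by rewrite set_itv1 Rintegral_set1 subrr oppr0.
by rewrite (set_itvcc_gt x0) Rintegral_set0 sub0r.
Qed.

Lemma prim0 f : prim f 0 = 0.
Proof. by rewrite prim_ge0// set_itv1 Rintegral_set1. Qed.

Lemma acP0 f f' x : ac setT f f' -> f x = f 0 + prim f' x.
Proof.
move=> af; have [x0|x0] := leP 0 x.
  by have [_ e] := af 0 x Logic.I Logic.I x0; rewrite prim_ge0// -e; ring.
by have [_ e] := af x 0 Logic.I Logic.I (ltW x0); rewrite prim_le0 ?(ltW x0)// -e; ring.
Qed.

Definition locint (f : R -> R) := forall a b, integ `[a, b] f.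

Lemma ac_locint f f' : ac setT f f' -> locint f'.
Proof.
move=> af a b; have [ab|ba] := leP a b; first by have [] := af a b Logic.I Logic.I ab.
by rewrite set_itvcc_gt//; exact: integrable_set0.
Qed.

Lemma ac_prim f : locint f -> ac setT (prim f) f.
Proof.
move=> fi; apply: (@ac_glue 0) => a b /= a0 b0 ab; split => //.
  by rewrite !prim_le0// (Rintegral_cat ab b0)//; ring.
by rewrite !prim_ge0// (Rintegral_cat a0 ab)//; ring.
Qed.

Lemma prim_derive (f : R -> R) (x : R) : continuous f -> is_derive x 1 (prim f) (f x).
Proof.
move=> cf.
have fi : locint f.
  move=> a b; apply: continuous_compact_integrable; first exact: segment_compact.
  exact: continuous_subspaceT.
have lx : x - 1 < x by lra.
have xl : x < x + 1 by lra.
have := continuous_FTC1_closed xl (fi (x - 1) (x + 1)) lx (cf x).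
set F := fun _ => _ => -[dF eF].
have dF' : is_derive x 1 (fun y => prim f (x - 1) + F y) (f x).
  have h : is_derive x 1 F (f x) by rewrite derive1E in eF; exact: (DeriveDef dF eF).
  have := @is_deriveD _ _ _ (cst (prim f (x - 1))) F x 1 0 (f x) (is_derive_cst _ _ _) h.
  by rewrite add0r.
apply: near_eq_is_derive dF'.
near=> y.
have ly : x - 1 <= y by near: y; apply: lt_le_nbhsr; lra.
by have [_ e] := (ac_prim fi) (x - 1) y Logic.I Logic.I ly; rewrite /F -e; ring.
Unshelve. all: by end_near.
Qed.

Lemma continuous_locint (f : R -> R) : continuous f -> locint f.
Proof.
move=> cf a b; apply: continuous_compact_integrable; first exact: segment_compact.
exact: continuous_subspaceT.
Qed.

Lemma Rintegral_dominated_cvg (D : set R) (fn : nat -> R -> R) (f g : R -> R) : measurable D ->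
  (forall n, measurable_fun D (fn n)) -> measurable_fun D f ->
  (forall x, D x -> fn n x @[n --> \oo] --> f x) -> integ D g ->
  (forall n x, D x -> `|fn n x| <= g x) ->
  \int[mu]_(x in D) fn n x @[n --> \oo] --> \int[mu]_(x in D) f x.
Proof.
move=> mD mfn mf fnf gi fng.
have [|||||fi _ h] := @dominated_convergence _ _ _ mu D mD (fun n => EFin \o fn n) (EFin \o f) (EFin \o g).
- by move=> n; apply/measurable_EFinP; exact: mfn.
- exact/measurable_EFinP.
- by apply/aeW => x Dx; apply: cvg_EFin; [exact: nearW|exact: fnf].
- by [].
- by apply/aeW => x n Dx; rewrite lee_fin fng.
rewrite /Rintegral; apply: (@fine_cvg _ _ _ _ (fun n => \int[mu]_(x in D) (fn n x)%:E)%E).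
by rewrite fineK//; exact: integrable_fin_num.
Qed.

Lemma Rintegral_itv_patch (a b : R) (D : set R) (f : R -> R) : `[a, b] `<=` D ->
  \int[mu]_(x in D) (f \_ `[a, b]) x = \int[mu]_(x in `[a, b]) f x.
Proof. by move=> abD; rewrite -Rintegral_mkcondr setIidr. Qed.

Lemma ac_integral_ge (f f' : R -> R) (a l : R) : ac [set x | a <= x] f f' ->
  integ `[a, +oo[ f' -> f n%:R @[n --> \oo] --> l ->
  \int[mu]_(x in `[a, +oo[) f' x = l - f a.
Proof.
move=> af fi fl.
have : \int[mu]_(x in `[a, +oo[) (f' \_ `[a, n%:R]) x @[n --> \oo] --> \int[mu]_(x in `[a, +oo[) f' x.
  have mf : measurable_fun `[a, +oo[ f' by have /integrableP[/measurable_EFinP] := fi.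
  apply: (@Rintegral_dominated_cvg _ _ _ (fun x => `|f' x|)) => //.
  - move=> n; apply/measurable_restrict => //; apply: measurable_funS mf => //.
  - move=> x ax; apply: cvg_near_cst; near=> n; rewrite patchE ifT// inE/=.
    move: ax; rewrite /= !in_itv/= andbT => ->/=.
    near: n; exact: nbhs_infty_ger.
  - exact: integrable_norm.
  - by move=> n x ax; rewrite patchE; case: ifP => // _; rewrite normr0.
move=> h; rewrite -(cvg_lim (@Rhausdorff R) h); apply/(cvg_lim (@Rhausdorff R)).
have : f n%:R - f a @[n --> \oo] --> l - f a by apply: cvgB => //; exact: cvg_cst.
apply: cvg_trans; apply: near_eq_cvg; near=> n.
have an : a <= n%:R by near: n; exact: nbhs_infty_ger.
rewrite Rintegral_itv_patch; first by have [_ ->] := af a n%:R (lexx a) an an.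
exact: subset_itvl.
Unshelve. all: by end_near.
Qed.

Lemma ac_integral_le (f f' : R -> R) (a l : R) : ac [set x | x <= a] f f' ->
  integ `]-oo, a] f' -> f (- n%:R) @[n --> \oo] --> l ->
  \int[mu]_(x in `]-oo, a]) f' x = f a - l.
Proof.
move=> af fi fl.
have : \int[mu]_(x in `]-oo, a]) (f' \_ `[- n%:R, a]) x @[n --> \oo] --> \int[mu]_(x in `]-oo, a]) f' x.
  have mf : measurable_fun `]-oo, a] f' by have /integrableP[/measurable_EFinP] := fi.
  apply: (@Rintegral_dominated_cvg _ _ _ (fun x => `|f' x|)) => //.
  - move=> n; apply/measurable_restrict => //; apply: measurable_funS mf => //.
  - move=> x ax; apply: cvg_near_cst; near=> n; rewrite patchE ifT// inE/=.
    move: ax; rewrite /= !in_itv/= => ->; rewrite andbT lerNl.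
    near: n; exact: nbhs_infty_ger.
  - exact: integrable_norm.
  - by move=> n x ax; rewrite patchE; case: ifP => // _; rewrite normr0.
move=> h; rewrite -(cvg_lim (@Rhausdorff R) h); apply/(cvg_lim (@Rhausdorff R)).
have : f a - f (- n%:R) @[n --> \oo] --> f a - l by apply: cvgB => //; exact: cvg_cst.
apply: cvg_trans; apply: near_eq_cvg; near=> n.
have an : - n%:R <= a by rewrite lerNl; near: n; exact: nbhs_infty_ger.
rewrite Rintegral_itv_patch; first by have [_ ->] := af (- n%:R) a an (lexx a) an.
exact: subset_itvr.
Unshelve. all: by end_near.
Qed.

(** * Square integrable functions and weak derivatives *)

Definition sqi (f : R -> R) : Prop :=
  measurable_fun setT f /\ integ setT (fun x => f x ^+ 2).

Lemma L2P (f : R -> R) : L2 f <-> sqi f.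
Proof.
split=> [f2|[mf fi]].
  split; last exact: Lfun2_integrable_sqr.
  by move: f2; rewrite /L2 inE/= => /andP[]; rewrite inE.
rewrite /L2 inE/=; apply/andP; split; rewrite inE//= /finite_norm unlock /=.
apply: poweR_lty; have /integrableP[_] := fi.
under eq_integral do rewrite /= normrX -powR_mulrn//.
by [].
Qed.

Lemma normL2E (f : R -> R) : sqi f ->
  normL2 f = (Num.sqrt (\int[mu]_x (f x ^+ 2)))%:E.
Proof.
move=> [mf fi]; rewrite /normL2 unlock/=.
rewrite (_ : (\int[mu]_x _)%E = (\int[mu]_x (f x ^+ 2))%:E).
  rewrite poweR_EFin powR12_sqrt//; by apply: Rintegral_ge0 => x _; exact: sqr_ge0.
rewrite /Rintegral fineK; last exact: integrable_fin_num.
by apply: eq_integral => x _; rewrite /= powR_mulrn// -normrX ger0_norm ?sqr_ge0.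
Qed.

Lemma contD (f g : R -> R) : continuous f -> continuous g ->
  continuous (fun x => f x + g x).
Proof. by move=> cf cg x; apply: cvgD; [exact: cf|exact: cg]. Qed.

Lemma contN (f : R -> R) : continuous f -> continuous (fun x => - f x).
Proof. by move=> cf x; apply: cvgN; exact: cf. Qed.

Lemma contB (f g : R -> R) : continuous f -> continuous g ->
  continuous (fun x => f x - g x).
Proof. by move=> cf /contN; exact: contD. Qed.

Lemma contM (f g : R -> R) : continuous f -> continuous g ->
  continuous (fun x => f x * g x).
Proof. by move=> cf cg x; apply: cvgM; [exact: cf|exact: cg]. Qed.

Lemma contC (k : R) : continuous (fun _ : R => k).
Proof. by move=> x; exact: cvg_cst. Qed.

Lemma contI : continuous (fun x : R => x).
Proof. by move=> x; exact: cvg_id. Qed.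

Lemma continuous_mfun (f : R -> R) : continuous f -> measurable_fun setT f.
Proof. by move=> cf; exact: continuous_measurable_fun. Qed.

Lemma patch_supp (a b : R) (f : R -> R) : (forall x, x < a \/ b < x -> f x = 0) ->
  f \_ `[a, b] = f.
Proof.
move=> f0; apply/funext => x; rewrite patchE; case: ifPn => //.
rewrite notin_setE /= in_itv/= => /negP; rewrite negb_and -!ltNge => /orP h.
by rewrite f0.
Qed.

Lemma Rintegral_supp (a b : R) (f : R -> R) : (forall x, x < a \/ b < x -> f x = 0) ->
  \int[mu]_x f x = \int[mu]_(x in `[a, b]) f x.
Proof. by move=> f0; rewrite [RHS]Rintegral_mkcond patch_supp. Qed.

Lemma integ_supp (a b : R) (f : R -> R) : (forall x, x < a \/ b < x -> f x = 0) ->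
  integ `[a, b] f -> integ setT f.
Proof.
by move=> f0 fi; rewrite -(patch_supp f0); apply/integrable_patch.
Qed.

(** Beyond the support [psi] vanishes on a whole neighbourhood, so its derivative vanishes there
    too. *)
Lemma test_support (psi : R -> R) : test_function psi ->
  exists2 N : R, 0 < N & forall x, x < - N \/ N < x -> psi x = 0 /\ derive1 psi x = 0.
Proof.
move=> [dpsi _ /compact_bounded[M [_ hM]]].
have lM : M < Num.max M 0 + 1 by rewrite ltr_pwDr// le_max lexx.
have psi0 x : Num.max M 0 + 1 < `|x| -> psi x = 0.
  move=> Mx; apply/eqP; apply: contraLR Mx => px; rewrite -leNgt.
  by apply: (hM _ lM); exact: subset_closure.
exists (Num.max M 0 + 1); first by rewrite ltr_wpDl// le_max lexx orbT.
move=> x hx.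
have xM : Num.max M 0 + 1 < `|x| by move: hx; rewrite lter_normr => -[] ?; lra.
split; first exact: psi0.
rewrite derive1E.
have h : is_derive (x : R) 1 psi 0.
  apply: (@near_eq_is_derive _ _ _ (cst 0)).
  have cn : (fun y : R => `|y|) @ x --> `|x| by exact: norm_continuous.
  have nM := cvgr_gt _ cn _ xM.
  by near=> y; rewrite /cst psi0//; near: y; exact: nM.
exact: derive_val.
Unshelve. all: by end_near.
Qed.

Lemma test_ac (psi : R -> R) : test_function psi -> ac setT psi (derive1 psi).
Proof.
move=> [dpsi cpsi _]; apply: ac_C1 => // x _; last exact: cpsi.
by rewrite derive1E; exact: derivableP.
Qed.

Lemma ac_by_parts (F g psi : R -> R) : ac setT F g -> test_function psi ->
  \int[mu]_x (F x * derive1 psi x) = - \int[mu]_x (g x * psi x).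
Proof.
move=> aF tpsi; have [N N0 hN] := test_support tpsi.
have ap := test_ac tpsi.
(* [psi] is known to vanish only strictly beyond N; at N + 1 the boundary terms are zero. *)
rewrite (@Rintegral_supp (- (N + 1)) (N + 1)); last first.
  by move=> x xN; rewrite (hN x _).2 ?mulr0//; lra.
rewrite (@Rintegral_supp (- (N + 1)) (N + 1)); last first.
  by move=> x xN; rewrite (hN x _).1 ?mulr0//; lra.
have NN : - (N + 1) <= N + 1 by lra.
have iT : is_interval (@setT R) by [].
have [i1 e1] := ac_mul iT aF ap Logic.I Logic.I NN.
have i2 : integ `[- (N + 1), N + 1] (fun x => F x * derive1 psi x).
  apply: continuous_locint; have [_ cpsi _] := tpsi.
  by apply: contM => //; exact: (ac_continuous aF).
have i3 : integ `[- (N + 1), N + 1] (fun x => g x * psi x).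
  have := integB (measurable_itv _) i1 i2.
  by apply: eq_integrable => // x _ /=; congr EFin; ring.
rewrite RintegralD// in e1.
have p1 : psi (N + 1) = 0 by apply: (hN _ _).1; lra.
have p2 : psi (- (N + 1)) = 0 by apply: (hN _ _).1; lra.
by rewrite p1 p2 !mulr0 subrr in e1; lra.
Qed.

(** The primitive is monotone, hence constant between a and b, and its derivative there is p. *)
Lemma prim_eq0 (p : R -> R) (a b : R) : continuous p -> (forall x, 0 <= p x) ->
  prim p a = prim p b -> forall x, a < x < b -> p x = 0.
Proof.
move=> cp p0 pab x /andP[ax xb].
have ap := ac_prim (continuous_locint cp).
have mono y z : y <= z -> prim p y <= prim p z.
  move=> yz; rewrite -subr_ge0; have [_ ->] := ap y z Logic.I Logic.I yz.
  by apply: Rintegral_ge0 => t _.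
have d0 : is_derive x 1 (prim p) 0.
  apply: (@near_eq_is_derive _ _ _ (cst (prim p a))).
  near=> y; rewrite /cst.
  have ya : prim p a <= prim p y by apply: mono; near: y; exact: lt_le_nbhsr.
  have yb : prim p y <= prim p a by rewrite pab; apply: mono; near: y; exact: lt_le_nbhsl.
  by apply/eqP; rewrite eq_le ya yb.
have d1 := prim_derive x cp.
by rewrite -(@derive_val _ _ _ _ _ _ _ d1) (@derive_val _ _ _ _ _ _ _ d0).
Unshelve. all: by end_near.
Qed.

(** The primitive from a vanishes to the left of a, and the zero integral makes it vanish to the
    right of b as well. *)
Lemma compact_supp_test (xi : R -> R) (a b : R) : a < b -> continuous xi ->
  (forall x, x <= a \/ b <= x -> xi x = 0) -> \int[mu]_(x in `[a, b]) xi x = 0 ->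
  test_function (fun x => prim xi x - prim xi a) /\
  derive1 (fun x => prim xi x - prim xi a) = xi.
Proof.
move=> ab cx xi0 xiab.
have ax := ac_prim (continuous_locint cx).
have dx (x : R) : is_derive x 1 (fun x : R => prim xi x - prim xi a) (xi x).
  have := @is_deriveD _ _ _ (prim xi) (cst (- prim xi a)) x 1 (xi x) 0 (prim_derive x cx) (is_derive_cst _ _ _).
  by rewrite addr0.
have e : derive1 (fun x => prim xi x - prim xi a) = xi.
  by apply/funext => x; rewrite derive1E; exact: derive_val.
split => //; split; first by move=> x; have [] := dx x.
  by rewrite e.
apply: (@subclosed_compact _ _ `[a, b]%classic); [exact: closed_closure|exact: segment_compact|].
rewrite [X in _ `<=` X](closure_id _).1; last exact: itv_closed.
apply: closure_subset => x /= px; rewrite in_itv/=.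
have [xa|xa] := leP x a.
  have [_ e'] := ax x a Logic.I Logic.I xa.
  move: px; rewrite -opprB e' (@eq_Rintegral _ _ _ _ _ (fun=>0)); last first.
    by move=> y; rewrite inE/= in_itv/= => /andP[_ ya]; apply: xi0; left.
  by rewrite Rintegral_cst ?mul0r ?oppr0 ?eqxx//.
rewrite (ltW xa)/= leNgt; apply/negP => bx; move: px.
have [_ e1] := ax a x Logic.I Logic.I (ltW xa).
rewrite e1 (Rintegral_cat (ltW ab) (ltW bx)); last exact: continuous_locint.
rewrite xiab add0r (@eq_Rintegral _ _ _ _ _ (fun=>0)); last first.
  by move=> y; rewrite inE/= in_itv/= => /andP[yb _]; apply: xi0; right.
by rewrite Rintegral_cst ?mul0r ?eqxx//.
Qed.

(* On [a, b], test against the primitive of xi = (h - m) k, where k is a bump on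
   ]a, b[ and m is the k-weighted mean of h, which makes xi have integral 0. *)
Lemma duBoisReymond (h : R -> R) : continuous h ->
  (forall psi, test_function psi -> \int[mu]_x (h x * derive1 psi x) = 0) ->
  forall x y, h x = h y.
Proof.
move=> ch h0.
(* Local constancy suffices: any two points lie in a common bounded interval. *)
suff H (a b : R) : a < b -> exists m, forall x, a < x < b -> h x = m.
  move=> x y; have x0 := normr_ge0 x; have y0 := normr_ge0 y.
  have /andP[x1 x2] : - `|x| <= x <= `|x| by rewrite -ler_norml.
  have /andP[y1 y2] : - `|y| <= y <= `|y| by rewrite -ler_norml.
  have [|m hm] := H (- (`|x| + `|y| + 1)) (`|x| + `|y| + 1); first lra.
  by rewrite !hm//; lra.
move=> ab.
pose k := fun x : R => Num.max 0 ((x - a) * (b - x)).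
have ck : continuous k.
  have cl : continuous (fun x : R => (x - a) * (b - x)).
    by apply: contM; apply: contB; [exact: contI|exact: contC|exact: contC|exact: contI].
  by have := max_fun_continuous (@cst_continuous R R 0) cl; exact.
have k0 x : 0 <= k x by rewrite /k le_max lexx.
have kout x : x <= a \/ b <= x -> k x = 0.
  by move=> hx; apply/max_idPl; case: hx => ?; nra.
have kin x : a < x < b -> 0 < k x.
  by move=> /andP[? ?]; rewrite /k lt_max; apply/orP; right; nra.
have ik := continuous_locint ck a b.
set K := \int[mu]_(x in `[a, b]) k x.
have [_ aK] := (ac_prim (continuous_locint ck)) a b Logic.I Logic.I (ltW ab).
have K0 : K != 0.
  apply/eqP => e; have mid : a < (a + b) / 2 < b by lra.
  have := @prim_eq0 k a b ck k0 _ _ mid.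
  rewrite /K -aK in e; move=> /(_ ltac:(lra)).
  by apply/eqP; rewrite gt_eqF// kin.
pose m := (\int[mu]_(x in `[a, b]) (h x * k x)) / K.
pose xi := fun x => (h x - m) * k x.
have cxi : continuous xi.
  by apply: contM => //; apply: contB => //; exact: contC.
have chk : continuous (fun x => h x * k x) by exact: contM.
have ihk := continuous_locint chk a b.
have xiab : \int[mu]_(x in `[a, b]) xi x = 0.
  transitivity (\int[mu]_(x in `[a, b]) (h x * k x - m * k x)).
    by apply: eq_Rintegral => x _; rewrite /xi; ring.
  rewrite RintegralB//; last exact: integZl.
  by rewrite RintegralZl// /m divfK// subrr.
have xiout x : x <= a \/ b <= x -> xi x = 0 by move=> /kout; rewrite /xi => ->; rewrite mulr0.
have [tpsi dpsi] := compact_supp_test ab cxi xiout xiab.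
have := h0 _ tpsi; rewrite dpsi (@Rintegral_supp a b); last first.
  by move=> x hx; rewrite xiout ?mulr0//; case: hx => /ltW; [left|right].
move=> hxi.
(* This is (h - m)^2 k, with integral zero because both [h * xi] and [xi] integrate to zero; hence h
   = m wherever the bump k is positive. *)
pose p := fun x => (h x - m) * xi x.
have cp : continuous p.
  by apply: contM => //; apply: contB => //; exact: contC.
have p0 x : 0 <= p x by rewrite /p /xi mulrA -expr2 mulr_ge0// sqr_ge0.
have chxi : continuous (fun x => h x * xi x) by exact: contM.
have pab : \int[mu]_(x in `[a, b]) p x = 0.
  transitivity (\int[mu]_(x in `[a, b]) (h x * xi x - m * xi x)).
    by apply: eq_Rintegral => x _; rewrite /p; ring.
  have ixi := continuous_locint cxi a b.
  rewrite RintegralB//; [|exact: continuous_locint|exact: integZl].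
  by rewrite RintegralZl// hxi xiab mulr0 subrr.
have [_ ap] := (ac_prim (continuous_locint cp)) a b Logic.I Logic.I (ltW ab).
exists m => x xab.
have /eqP := @prim_eq0 p a b cp p0 ltac:(lra) x xab.
by rewrite /p /xi !mulf_eq0 (gt_eqF (kin _ xab)) orbF orbb subr_eq0 => /eqP.
Qed.

Lemma integ_cont_supp (N : R) (f : R -> R) : continuous f ->
  (forall x, x < - N \/ N < x -> f x = 0) -> integ setT f.
Proof. by move=> cf f0; apply: integ_supp f0 _; exact: continuous_locint. Qed.

Lemma sqi_locint (f : R -> R) : sqi f -> locint f.
Proof.
move=> [mf fi] a b.
apply: (@le_integrableR _ _ (fun x => 1 + f x ^+ 2)) => //.
- exact: measurable_funS mf.
- move=> x _; rewrite ler_norml; have := sqr_ge0 (f x - 2^-1).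
  by have := sqr_ge0 (f x + 2^-1); rewrite !expr2 => ? ?; apply/andP; split; nra.
- apply: integD => //; last exact: integrableS fi.
  by apply: continuous_locint; exact: contC.
Qed.

(** The difference of f and [prim g] is continuous with zero weak derivative, hence constant by
    [duBoisReymond]. *)
Lemma weak_ac (f g : R -> R) : continuous f -> sqi g -> is_weak_derivative f g ->
  ac setT f g.
Proof.
move=> cf sg wfg; have aG := ac_prim (sqi_locint sg).
pose h := fun x => f x - prim g x.
have cG := ac_continuous aG.
have ch : continuous h by exact: contB.
have hc : forall x y, h x = h y.
  apply: duBoisReymond => // psi tpsi.
  have [N N0 hN] := test_support tpsi; have [_ cpsi _] := tpsi.
  transitivity (\int[mu]_x (f x * derive1 psi x - prim g x * derive1 psi x)).
    by apply: eq_Rintegral => x _; rewrite /h; ring.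
  rewrite RintegralB//.
  - by rewrite wfg// (ac_by_parts aG tpsi) subrr.
  - apply: (@integ_cont_supp N); first exact: contM.
    by move=> x /hN[_ ->]; rewrite mulr0.
  - apply: (@integ_cont_supp N); first exact: contM.
    by move=> x /hN[_ ->]; rewrite mulr0.
move=> a b _ _ ab; have [ig eg] := aG a b Logic.I Logic.I ab; split => //.
by rewrite -eg; have := hc a b; rewrite /h; lra.
Qed.

Lemma ac_weak (f g : R -> R) : ac setT f g -> is_weak_derivative f g.
Proof. by move=> afg psi; exact: ac_by_parts. Qed.

(** The difference g1 - g2 integrates to zero over every interval, and at each of its Lebesgue
    points it is the derivative of that zero integral. *)
Lemma ac_ae_unique (f g1 g2 : R -> R) : measurable_fun setT g1 ->
  measurable_fun setT g2 -> ac setT f g1 -> ac setT f g2 -> ae_eq mu setT g1 g2.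
Proof.
move=> m1 m2 a1 a2; pose d := fun x => g1 x - g2 x.
have ad : ac setT (fun x => f x - f x) d by exact: acB.
have ld : locally_integrable setT d.
  split => //; [exact: measurable_funB|exact: openT|].
  move=> K _ cK; have [M [_ hM]] := compact_bounded cK.
  have mK : measurable K by apply: compact_measurable.
  have KM : K `<=` `[- (M + 1), M + 1]%classic.
    move=> x Kx; rewrite /= in_itv/= -ler_norml; apply: hM => //; lra.
  have /integrableP[md di] := ac_locint ad (- (M + 1)) (M + 1).
  apply: le_lt_trans di; apply: ge0_subset_integral => //.
  by have : measurable_fun `[- (M + 1), M + 1] (fun x => `|(EFin \o d) x|%E) by exact: measurableT_comp.
suff H (x : R) : lebesgue_pt d x -> g1 x = g2 x.
  by apply: (@filterS _ (nbhs (almost_everywhere mu)) _ _ _ _ (lebesgue_differentiation ld)) => x /H.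
move=> lx.
have x1 : x - 1 < x by lra.
have x2 : x < x + 1 by lra.
have /= H a := @FTC1_lebesgue_pt _ d (BLeft (x - 1)) x (x + 1) x2 (ac_locint ad _ _) a lx.
have [|_] := H; first by rewrite lte_fin.
set F := fun _ => _.
have dF : is_derive x 1 F 0.
  apply: (@near_eq_is_derive _ _ _ (cst 0)).
  near=> y; have ly : x - 1 <= y by near: y; exact: lt_le_nbhsr.
  by have [_ e] := ad (x - 1) y Logic.I Logic.I ly; rewrite /F /cst -e; ring.
by rewrite derive1E (@derive_val _ _ _ _ _ _ _ dF) /d => /esym/eqP; rewrite subr_eq0 => /eqP.
Unshelve. all: by end_near.
Qed.

Lemma H1P (f : R -> R) : H1 f <-> sqi f /\ exists2 g, sqi g & ac setT f g.
Proof.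
split=> [[cf /L2P sf [g /L2P sg wg]]|[sf [g sg ag]]].
  by split => //; exists g => //; exact: weak_ac.
split; [exact: ac_continuous ag|exact/L2P|].
by exists g; [exact/L2P|exact: ac_weak].
Qed.

Lemma wderivP (f : R -> R) : H1 f -> sqi (wderiv f) /\ ac setT f (wderiv f).
Proof.
move=> [cf _ [g g2 wg]].
have [/L2P h1 h2] : L2 (wderiv f) /\ is_weak_derivative f (wderiv f).
  rewrite /wderiv; have := @xgetPex _ (fun=> 0) [set g | L2 g /\ is_weak_derivative f g].
  by apply; exists g.
by split => //; exact: weak_ac.
Qed.

Lemma wderiv_ae (f g : R -> R) : sqi f -> sqi g -> ac setT f g ->
  ae_eq mu setT (wderiv f) g.
Proof.
move=> sf sg ag; have /wderivP[[mw _] aw] : H1 f by apply/H1P; split => //; exists g.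
by apply: (@ac_ae_unique f) => //; case: sg.
Qed.

Lemma sqr_sum_integ (D : set R) (f g : R -> R) : measurable D -> sqi f -> sqi g ->
  integ D (fun x => f x ^+ 2 + g x ^+ 2).
Proof.
by move=> mD [_ fi] [_ gi]; apply: integD => //; [exact: integrableS fi|exact: integrableS gi].
Qed.

(** Frees the H^1 norm from the representative chosen by [wderiv]: any square integrable [ac]
    derivative computes it. *)
Lemma normH1E (D : set R) (f g : R -> R) : measurable D -> sqi f -> sqi g ->
  ac setT f g ->
  normH1 D f = (Num.sqrt (\int[mu]_(x in D) (f x ^+ 2 + g x ^+ 2)))%:E.
Proof.
move=> mD sf sg ag; rewrite /normH1.
have [mf _] := sf; have [mg _] := sg.
have /wderivP[[mw _] _] : H1 f by apply/H1P; split => //; exists g.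
have mfD : measurable_fun D f by exact: measurable_funS mf.
have mgD : measurable_fun D g by exact: measurable_funS mg.
have mwD : measurable_fun D (wderiv f) by exact: measurable_funS mw.
have -> : (\int[mu]_(x in D) (f x ^+ 2 + wderiv f x ^+ 2)%:E =
          \int[mu]_(x in D) (f x ^+ 2 + g x ^+ 2)%:E)%E.
  apply: ae_eq_integral => //.
  - by apply/measurable_EFinP; apply: measurable_funD; exact: measurable_funX.
  - by apply/measurable_EFinP; apply: measurable_funD; exact: measurable_funX.
  - by have := wderiv_ae sf sg ag; apply: filterS => x h Dx; rewrite h.
rewrite (_ : (\int[mu]_(x in D) _)%E = (\int[mu]_(x in D) (f x ^+ 2 + g x ^+ 2))%:E).
  rewrite poweR_EFin powR12_sqrt//; apply: Rintegral_ge0 => x _.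
  by rewrite addr_ge0// sqr_ge0.
by rewrite /Rintegral fineK//; apply: integrable_fin_num => //; exact: sqr_sum_integ.
Qed.

(** Lebesgue measure is its own image under reflection. *)
Lemma Rintegral_opp (D : set R) (f : R -> R) : measurable D -> measurable_fun setT f ->
  integ (-%R @^-1` D) (fun x => f (- x)) ->
  integ D f /\ \int[mu]_(x in -%R @^-1` D) f (- x) = \int[mu]_(x in D) f x.
Proof.
move=> mD mf fi.
have mo : measurable_fun setT (-%R : measurableTypeR R -> measurableTypeR R) by exact: oppr_measurable.
have mE : measurable_fun setT (EFin \o f) by exact/measurable_EFinP.
have e := @integral_pushforward _ _ _ _ _ _ mo mu D (EFin \o f) mE fi mD.
have ip := @integrable_pushforward _ _ _ _ _ _ mo mu D (EFin \o f) mE fi mD.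
have eI (g : R -> \bar R) : (\int[pushforward mu (-%R : measurableTypeR R -> measurableTypeR R)]_(y in D) g y = \int[mu]_(y in D) g y)%E.
  by apply: eq_measure_integral => A mA _; exact: lebesgue_measureN.
split; last by rewrite /Rintegral -eI e.
apply/integrableP; split; first exact: measurable_funS mE.
by have /integrableP[_] := ip; rewrite eI.
Qed.

(** * The flow on the half-line *)

(* For x >= 0, [flow t x] = ln(1 + (e^x - 1) e^t), and [amp t x] is the inverse
   of its derivative in x. *)
Definition amp (t x : R) : R := 1 - (1 - expR (- t)) * expR (- x).
Definition flow (t x : R) : R := x + t + ln (amp t x).

(** For x >= 0 this is a convex combination of 1 and e^(-t), which gives positivity and the bounds
    e^(-|t|) and e^|t|. *)
Lemma amp_conv t x : amp t x = (1 - expR (- x)) + expR (- t) * expR (- x).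
Proof. by rewrite /amp; ring. Qed.

Lemma expNle1 (x : R) : 0 <= x -> expR (- x) <= 1.
Proof. by move=> x0; rewrite -expR0 ler_expR oppr_le0. Qed.

Lemma amp_gt0 t x : 0 <= x -> 0 < amp t x.
Proof.
move=> x0; rewrite amp_conv ltr_wpDl//; first by rewrite subr_ge0 expNle1.
by apply: mulr_gt0; exact: expR_gt0.
Qed.

Lemma expR_flow t x : 0 <= x -> expR (flow t x) = expR (x + t) * amp t x.
Proof. by move=> x0; rewrite expRD lnK// posrE amp_gt0. Qed.

(** In the coordinate e^x - 1 the flow is multiplication by e^t; the fixed point 0, the group law
    and monotonicity are read off from this. *)
Lemma expR_flow1 t x : 0 <= x -> expR (flow t x) - 1 = (expR x - 1) * expR t.
Proof.
move=> x0; rewrite expR_flow// /amp !expRD !expRN.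
have := expR_gt0 x; have := expR_gt0 t; move: (expR x) (expR t) => a b b0 a0.
by field; rewrite !gt_eqF.
Qed.

Lemma flow0 t : flow t 0 = 0.
Proof. by apply: expR_inj; rewrite -[LHS](subrK 1) expR_flow1// expR0; ring. Qed.

Lemma flow_ge0 t x : 0 <= x -> 0 <= flow t x.
Proof.
move=> x0; rewrite -ler_expR expR0 -subr_ge0 expR_flow1// mulr_ge0 ?expR_ge0//.
by rewrite subr_ge0 -expR0 ler_expR.
Qed.

Lemma flow_gt0 t x : 0 < x -> 0 < flow t x.
Proof.
move=> x0; rewrite -ltr_expR expR0 -subr_gt0 expR_flow1 ?(ltW x0)// mulr_gt0 ?expR_gt0//.
by rewrite subr_gt0 -expR0 ltr_expR.
Qed.

Lemma flow_flow t s x : 0 <= x -> flow t (flow s x) = flow (t + s) x.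
Proof.
move=> x0; apply: expR_inj; apply/eqP; rewrite -(inj_eq (addIr (-1))).
rewrite (expR_flow1 t (flow_ge0 s x0)) (expR_flow1 s x0) (expR_flow1 (t + s) x0).
by rewrite expRD; apply/eqP; ring.
Qed.

Lemma flow_0 x : 0 <= x -> flow 0 x = x.
Proof. by move=> x0; rewrite /flow /amp oppr0 expR0 subrr mul0r subr0 ln1; ring. Qed.

Lemma flowK t x : 0 <= x -> flow (- t) (flow t x) = x.
Proof. by move=> x0; rewrite flow_flow// addNr flow_0. Qed.

(** The chain rule for the group law, obtained without differentiating: [amp] is the exponential of
    [flow u y - y - u], and these exponents add up. *)
Lemma amp_flow t s x : 0 <= x -> amp (t + s) x = amp t (flow s x) * amp s x.
Proof.
move=> x0; have fs := flow_ge0 s x0.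
have H u y : 0 <= y -> amp u y = expR (flow u y - y - u).
  by move=> y0; rewrite /flow [X in expR X](_ : _ = ln (amp u y)) ?lnK ?posrE ?amp_gt0//; ring.
by rewrite !H// -expRD -flow_flow//; congr expR; ring.
Qed.

Lemma flow_homo t x y : 0 <= x -> x < y -> flow t x < flow t y.
Proof.
move=> x0 xy; have y0 : 0 <= y by lra.
rewrite -ltr_expR -(ltrD2r (-1)) (expR_flow1 t x0) (expR_flow1 t y0).
have := expR_gt0 t; have : expR x < expR y by rewrite ltr_expR.
by move: (expR x) (expR y) (expR t) => a b c; nra.
Qed.

Lemma amp_bounds t x : 0 <= x -> expR (- `|t|) <= amp t x <= expR `|t|.
Proof.
move=> x0; have e1 := expNle1 x0; have e0 := expR_gt0 (- x).
have t1 : expR (- `|t|) <= expR (- t) by rewrite ler_expR lerN2 ler_norm.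
have t2 : expR (- t) <= expR `|t| by rewrite ler_expR -normrN ler_norm.
have t3 : expR (- `|t|) <= 1 by exact: expNle1.
have t4 : 1 <= expR `|t| by rewrite -expR0 ler_expR.
by rewrite amp_conv; apply/andP; split; nra.
Qed.

Lemma flow_dist t x : 0 <= x -> `|flow t x - x| <= 2 * `|t|.
Proof.
move=> x0; have /andP[a1 a2] := amp_bounds t x0.
have l1 : - `|t| <= ln (amp t x) by rewrite -ler_expR lnK ?posrE ?amp_gt0.
have l2 : ln (amp t x) <= `|t| by rewrite -ler_expR lnK ?posrE ?amp_gt0.
have := ler_norm t; have := ler_norm (- t); rewrite normrN => t1 t2.
by rewrite /flow ler_norml; apply/andP; split; lra.
Qed.

Lemma dexpN (x : R) : is_derive x 1 (fun y : R => expR (- y)) (- expR (- x)).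
Proof.
have := @is_derive1_comp _ expR (fun y : R => - y) x (expR (- x)) (-1) _ _.
by rewrite mulrN1; apply.
Qed.

Lemma amp_derive (t x : R) : is_derive x 1 (amp t) (1 - amp t x).
Proof.
have d := dexpN x.
apply: (@is_derive_eq _ _ _ (fun x => 1 - (1 - expR (- t)) * expR (- x))).
rewrite /amp /GRing.scale/=; ring.
Qed.

(** * Change of variables for absolutely continuous increasing bijections *)

Section change_of_variables.
Context (S w : R -> R) (mS : measurable_fun setT S) (mw : measurable_fun setT w)
  (w0 : forall x, 0 <= w x).

(** The image under S of the measure with density w. *)
Definition push_density (A : set (measurableTypeR R)) : \bar R :=
  (\int[mu]_(x in S @^-1` A) (w x)%:E)%E.

Let mES : measurable_fun setT (S : measurableTypeR R -> measurableTypeR R).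
Proof. exact: mS. Qed.

Let mSpre (A : set (measurableTypeR R)) : measurable A ->
  measurable ((S : measurableTypeR R -> measurableTypeR R) @^-1` A).
Proof. by move=> mA; have := mES measurableT mA; rewrite setTI. Qed.

Let mEw (D : set R) : measurable_fun D (EFin \o w).
Proof. by apply/measurable_EFinP; exact: measurable_funS mw. Qed.

Let push_density0 : push_density set0 = 0%E.
Proof. by rewrite /push_density preimage_set0 integral_set0. Qed.

Let push_density_ge0 A : (0 <= push_density A)%E.
Proof. by apply: integral_ge0 => x _; rewrite lee_fin. Qed.

Let push_density_sigma : semi_sigma_additive push_density.
Proof.
move=> F mF tF mUF; rewrite /push_density preimage_bigcup ge0_integral_bigcup//=.
- apply: is_cvg_nneseries => n _ _; exact: push_density_ge0.
- by move=> k; have h := mSpre (mF k); exact: h.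
- exact: mEw.
- by move=> x _; rewrite lee_fin.
- apply/trivIsetP => i j _ _ ij; rewrite -preimage_setI.
  by move/trivIsetP: tF => -> //; rewrite preimage_set0.
Qed.

HB.instance Definition _ := isMeasure.Build _ (measurableTypeR R) R push_density
  push_density0 push_density_ge0 push_density_sigma.

Context (H : forall a b, a <= b -> (push_density `]a, b] = (b - a)%:E)%E).

(** [H] says that the image measure agrees with Lebesgue measure on half-open intervals, and
    uniqueness of Lebesgue measure extends this to all measurable sets. *)
Let mu_push (A : set R) : measurable A -> mu A = push_density A.
Proof.
move=> mA; have U := @lebesgue_measure_unique R push_density.
apply: U => // X [[a b] _ <-] /=.
rewrite -/(push_density _) lebesgue_measure_itv/=.
rewrite lte_fin; have [ab|ba] := ltP a b; first by rewrite H ?(ltW ab).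
by rewrite set_itv_ge ?bnd_simp -?leNgt// push_density0.
Qed.

Import HBNNSimple.

Let integral_nnsfun (g : {nnsfun (measurableTypeR R) >-> R}) :
  (\int[mu]_x (g x)%:E = \int[mu]_x (g (S x) * w x)%:E)%E.
Proof.
rewrite integralT_nnsfun sintegralE.
under [RHS]eq_integral => x _.
  rewrite fimfunE EFinM -fsumEFin// ge0_mule_fsuml; last first.
    by move=> r; rewrite EFinM nnfun_muleindic_ge0.
  over.
rewrite [RHS]ge0_integral_fsum//; last 2 first.
  - move=> r; apply: emeasurable_funM; last exact: mEw.
    apply/measurable_EFinP; apply: measurable_funM => //.
    apply: (@measurableT_comp _ _ _ _ _ _ (\1_(g @^-1` [set r]) : R -> R)) => //.
    by apply: measurable_indic; exact: (measurable_sfunP g).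
  - move=> n x _; apply: mule_ge0; last by rewrite lee_fin.
    by rewrite EFinM nnfun_muleindic_ge0.
apply: eq_fsbigr => r /set_mem [y _ <-].
transitivity ((g y)%:E * push_density (g @^-1` [set g y]))%E.
  by congr (_ * _)%E; apply: mu_push; exact: (measurable_sfunP g).
rewrite /push_density -ge0_integralZl; last 4 first.
  - by apply: mSpre; exact: (measurable_sfunP g).
  - exact: mEw.
  - by move=> x _; rewrite lee_fin.
  - by rewrite lee_fin.
rewrite [LHS]integral_mkcond.
apply: eq_integral => x _; rewrite patchE indicE.
rewrite (_ : (x \in S @^-1` (g @^-1` [set g y])) = (S x \in g @^-1` [set g y])); last first.
  by apply/idP/idP; rewrite !inE.
case: ifP => _; rewrite ?mulr1 ?mulr0 ?mul0e//.
Qed.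

Lemma ge0_change_of_variables (f : R -> R) : measurable_fun setT f ->
  (forall x, 0 <= f x) ->
  (\int[mu]_x (f x)%:E = \int[mu]_x (f (S x) * w x)%:E)%E.
Proof.
move=> mf f0; have mE : measurable_fun (setT : set (measurableTypeR R)) (EFin \o f) by exact/measurable_EFinP.
pose f_ := nnsfun_approx measurableT mE.
have f_f x : (f_ n x)%:E @[n --> \oo] --> (f x)%:E.
  by apply: (@cvg_nnsfun_approx _ _ _ _ measurableT _ mE) => // y _; rewrite lee_fin.
have nd x : {homo (fun n => f_ n x) : n m / (n <= m)%N >-> n <= m}.
  by move=> n m nm; exact/lefP/nd_nnsfun_approx.
transitivity (limn (fun n => \int[mu]_x (f_ n x)%:E))%E.
  rewrite -monotone_convergence//=.
  - by apply: eq_integral => x _; apply/esym/cvg_lim.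
  - by move=> n; exact/measurable_EFinP/measurable_funTS.
  - by move=> n x _; rewrite lee_fin.
  - by move=> x _ n m nm; rewrite lee_fin; exact: nd.
transitivity (limn (fun n => \int[mu]_x (f_ n (S x) * w x)%:E))%E.
  by congr (limn _); apply/funext => n; exact: integral_nnsfun.
rewrite -monotone_convergence//=.
- apply: eq_integral => x _; apply/cvg_lim => //.
  apply: cvg_EFin; first exact: nearW.
  by apply: cvgM; [exact: (fine_cvg (f_f (S x)))|exact: cvg_cst].
- move=> n; apply/measurable_EFinP; apply: measurable_funM => //.
  by apply: (measurableT_comp _ mES); exact: measurable_funP.
- by move=> n x _; rewrite lee_fin mulr_ge0.
- by move=> x _ n m nm; rewrite lee_fin ler_wpM2r//; exact: nd.
Qed.

End change_of_variables.

(** The preimage of a half-open interval is again one, with end points given by the inverse X, and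
    on it the integral of w is the increment of S. *)
Lemma ge0_ac_change_of_variables (S X w f : R -> R) : ac setT S w ->
  (forall x, 0 <= w x) -> measurable_fun setT w ->
  {homo S : x y / x < y} -> cancel X S -> measurable_fun setT f ->
  (forall x, 0 <= f x) ->
  (\int[mu]_x (f x)%:E = \int[mu]_x (f (S x) * w x)%:E)%E.
Proof.
move=> aS w0 mw hS XS mf f0.
have mS : measurable_fun setT S by apply: continuous_mfun; exact: ac_continuous aS.
have ltS x y : (S x < S y) = (x < y) by apply: leW_mono; exact: le_mono.
apply: ge0_change_of_variables => // a b ab.
have leS x y : (S x <= S y) = (x <= y) by apply: le_mono.
have Xab : X a <= X b by rewrite -leS !XS.
have -> : push_density S w `]a, b] = (\int[mu]_(x in `]X a, X b]) (w x)%:E)%E.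
  have E x : (X a < x <= X b) = (a < S x <= b) by rewrite -(ltS (X a)) -(leS x) !XS.
  rewrite /push_density; congr (integral _ _ _).
  by apply/seteqP; split => x /=; rewrite !in_itv/= E.
have [wi we] := aS (X a) (X b) Logic.I Logic.I Xab.
rewrite integral_itv_obnd_cbnd; last first.
  by apply/measurable_EFinP; exact: measurable_funS mw.
have -> : b - a = S (X b) - S (X a) by rewrite !XS.
by rewrite we /Rintegral fineK//; exact: integrable_fin_num.
Qed.

(** The nonnegative case is applied to |f| for integrability and to the positive and negative parts
    [p] and [n] for the value. *)
Lemma ac_change_of_variables (S X w f : R -> R) : ac setT S w ->
  (forall x, 0 <= w x) -> measurable_fun setT w ->
  {homo S : x y / x < y} -> cancel X S -> measurable_fun setT f ->
  (integ setT (fun x => f (S x) * w x) <-> integ setT f) /\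
  (integ setT f -> \int[mu]_x (f (S x) * w x) = \int[mu]_x f x).
Proof.
move=> aS w0 mw hS XS mf.
have mS : measurable_fun setT S by apply: continuous_mfun; exact: ac_continuous aS.
have e (h : R -> R) := @ge0_ac_change_of_variables S X w h aS w0 mw hS XS.
have I (h : R -> R) : measurable_fun setT h ->
    integ setT (fun x => h (S x) * w x) <-> integ setT h.
  move=> mh; have mhS : measurable_fun setT (fun x => h (S x) * w x).
    by apply: measurable_funM => //; exact: (measurableT_comp mh mS).
  have iE : (\int[mu]_x `|(h (S x) * w x)%:E| = \int[mu]_x `|(h x)%:E|)%E.
    rewrite [RHS](e (fun x => `|h x|)) //; last exact: measurableT_comp.
    by apply: eq_integral => x _; rewrite /= normrM (ger0_norm (w0 _)).
  have mE : measurable_fun setT (EFin \o h) by exact/measurable_EFinP.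
  have mES : measurable_fun setT (EFin \o (fun x => h (S x) * w x)) by exact/measurable_EFinP.
  split=> /integrableP[_ hI]; apply/integrableP; split => //; last by rewrite /= iE.
  by rewrite -iE.
split; first exact: I.
move=> fi; pose p x := (`|f x| + f x) / 2; pose n x := (`|f x| - f x) / 2.
have mp : measurable_fun setT p.
  by apply: measurable_funM => //; apply: measurable_funD => //; exact: measurableT_comp.
have mn : measurable_fun setT n.
  by apply: measurable_funM => //; apply: measurable_funB => //; exact: measurableT_comp.
have p0 x : 0 <= p x by have := ler_norm (- f x); rewrite normrN /p; lra.
have n0 x : 0 <= n x by have := ler_norm (f x); rewrite /n; lra.
have ip : integ setT p by apply: integZr => //; apply: integD => //; exact: integrable_norm.
have in_ : integ setT n by apply: integZr => //; apply: integB => //; exact: integrable_norm.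
have -> : f = fun x => p x - n x by apply/funext => x; rewrite /p /n; field.
under eq_Rintegral do rewrite mulrBl.
rewrite RintegralB//; [|exact/(I p mp)|exact/(I n mn)].
rewrite RintegralB//; congr (_ - _).
  by rewrite /Rintegral -(e p).
by rewrite /Rintegral -(e n).
Qed.

Lemma ac_change_of_variables_set (S X w f : R -> R) (D : set R) : measurable D ->
  ac setT S w -> (forall x, 0 <= w x) -> measurable_fun setT w ->
  {homo S : x y / x < y} -> cancel X S -> measurable_fun setT f ->
  (integ (S @^-1` D) (fun x => f (S x) * w x) <-> integ D f) /\
  (integ D f -> \int[mu]_(x in S @^-1` D) (f (S x) * w x) = \int[mu]_(x in D) f x).
Proof.
move=> mD aS w0 mw hS XS mf.
have mS : measurable_fun setT S by apply: continuous_mfun; exact: ac_continuous aS.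
have mSD : measurable (S @^-1` D) by have := mS measurableT D mD; rewrite setTI.
have mfD : measurable_fun setT (f \_ D).
  by apply: (@measurable_restrictT _ _ _ _ D f mD).1; exact: measurable_funTS.
have [h1 h2] := ac_change_of_variables aS w0 mw hS XS mfD.
have e : (fun x => (f \_ D) (S x) * w x) = (fun x => f (S x) * w x) \_ (S @^-1` D).
  apply/funext => x; rewrite !patchE.
  rewrite (_ : (x \in S @^-1` D) = (S x \in D)); last by apply/idP/idP; rewrite !inE.
  by case: ifP => // _; rewrite mul0r.
rewrite e in h1 h2; split.
  have [p1 p2] := integrable_patch (fun x => f (S x) * w x) mSD.
  have [q1 q2] := integrable_patch f mD.
  by split=> h; [exact/q1/h1.1/p2|exact/p1/h1.2/q2].
by move=> fi; rewrite Rintegral_mkcond [RHS]Rintegral_mkcond h2//; apply/integrable_patch.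
Qed.

Lemma flow_derive (t x : R) : 0 <= x -> is_derive x 1 (flow t) (amp t x)^-1.
Proof.
move=> x0; have a0 := amp_gt0 t x0; have da := amp_derive t x.
have dl : is_derive x 1 (fun y => ln (amp t y)) ((amp t x)^-1 * (1 - amp t x)).
  have h := is_derive1_ln a0.
  have := @is_derive1_comp _ (@ln R) (amp t) x _ _ h da.
  by apply.
have := @is_deriveD _ _ _ (fun y : R => y + t) (fun y => ln (amp t y)) x 1 1 _ _ dl.
rewrite (_ : 1 + _ = (amp t x)^-1); last by field; rewrite gt_eqF.
apply.
have := @is_deriveD _ _ _ (fun y : R => y) (cst t) x 1 1 0 _ _.
by rewrite addr0; apply.
Qed.

Lemma flow_derive_t (x : R) : 0 <= x ->
  is_derive (0 : R) 1 (fun h : R => flow h x) (1 - expR (- x)).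
Proof.
move=> x0.
have da : is_derive (0 : R) 1 (fun h : R => amp h x) (- expR (- x)).
  have d := dexpN 0.
  apply: (@is_derive_eq _ _ _ (fun h : R => 1 - (1 - expR (- h)) * expR (- x))).
  by rewrite /GRing.scale/= oppr0 expR0; ring.
have a0 : 0 < amp 0 x by exact: amp_gt0.
have dl := @is_derive1_comp _ (@ln R) (fun h : R => amp h x) 0 _ _ (is_derive1_ln a0) da.
have := @is_deriveD _ _ _ (fun y : R => x + y) (fun y => ln (amp y x)) 0 1 1 _ _ dl.
rewrite (_ : 1 + _ = 1 - expR (- x)); last first.
  by rewrite /amp oppr0 expR0 subrr mul0r subr0 invr1 mul1r.
apply.
have := @is_deriveD _ _ _ (cst x) (fun y : R => y) 0 1 0 1 _ _.
by rewrite add0r; apply.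
Qed.

(* [flow] extended by the identity to x < 0, so that it is a bijection of the
   line; [xdens] is its derivative. *)
Definition xflow (t x : R) : R := if 0 <= x then flow t x else x.
Definition xdens (t x : R) : R := if 0 <= x then (amp t x)^-1 else 1.

Lemma amp_continuous t : continuous (amp t).
Proof. by move=> x; exact: (is_derive_continuous (amp_derive t x)). Qed.

Lemma measurable_ge0_if (f g : R -> R) : measurable_fun setT f -> measurable_fun setT g ->
  measurable_fun setT (fun x : R => if 0 <= x then f x else g x).
Proof.
move=> mf mg; apply: measurable_fun_ifT => //.
by apply: measurable_fun_ler => //; exact: measurable_id.
Qed.

Lemma ampVE t x : 0 <= x -> (amp t x)^-1 = expR (- ln (amp t x)).
Proof. by move=> x0; rewrite expRN lnK// posrE amp_gt0. Qed.

Lemma measurable_xdens t : measurable_fun setT (xdens t).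
Proof.
(* On x < 0 [amp] may vanish; written with [expR] and [ln], the branch is a composition of functions
   measurable on the whole line. *)
rewrite (_ : xdens t = fun x => if 0 <= x then expR (- ln (amp t x)) else 1); last first.
  by apply/funext => x; rewrite /xdens; case: ifP => // x0; rewrite ampVE.
apply: measurable_ge0_if => //; apply: measurableT_comp; first exact: measurable_expR.
apply: measurableT_comp; first exact: oppr_measurable.
apply: measurableT_comp; first exact: measurable_ln.
by apply: continuous_mfun; exact: amp_continuous.
Qed.

Lemma ge0_interval : is_interval [set x : R | 0 <= x].
Proof. by move=> x y /= x0 _ z /andP[xz _]; exact: le_trans xz. Qed.

Lemma le0_interval : is_interval [set x : R | x <= 0].
Proof. by move=> x y /= _ y0 z /andP[_ zy]; exact: le_trans y0. Qed.

Lemma measurable_ge0 : measurable [set x : R | 0 <= x].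
Proof. by rewrite -set_itvcy; exact: measurable_itv. Qed.

Lemma measurable_le0 : measurable [set x : R | x <= 0].
Proof. by rewrite -set_itvNyc; exact: measurable_itv. Qed.

Lemma ac_flow t : ac [set x | 0 <= x] (flow t) (fun x => (amp t x)^-1).
Proof.
apply: ac_C1 => [|x x0|x x0]; [exact: ge0_interval|exact: flow_derive|].
apply: cvgV; first by rewrite gt_eqF// amp_gt0.
exact: amp_continuous.
Qed.

Lemma ac_xflow t : ac setT (xflow t) (xdens t).
Proof.
apply: (@ac_glue 0).
  apply: (@ac_ae _ id _ (fun=> 1)); [exact: le0_interval|exact: measurable_le0|..].
  - move=> x /=; rewrite le_eqVlt /xflow => /predU1P[->|x0]; first by rewrite lexx flow0.
    by rewrite leNgt x0.
  - exact: measurable_funTS (measurable_xdens t).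
  - apply: (@ae_eq_pt 0) => x /= x0 xn; rewrite /xdens leNgt.
    by rewrite lt_neqAle xn x0.
  - by apply: ac_C1 => [|x _]; [exact: le0_interval|exact: contC].
apply: (@ac_ae _ (flow t) _ (fun x => (amp t x)^-1)); [exact: ge0_interval|exact: measurable_ge0|..].
- by move=> x /= x0; rewrite /xflow x0.
- exact: measurable_funTS (measurable_xdens t).
- by apply: (@ae_eq_pt 0) => x /= x0 _; rewrite /xdens x0.
- exact: ac_flow.
Qed.

Lemma xdens_ge0 t x : 0 <= xdens t x.
Proof. by rewrite /xdens; case: ifP => // x0; rewrite invr_ge0 ltW ?amp_gt0. Qed.

Lemma xflow_homo t : {homo xflow t : x y / x < y}.
Proof.
move=> x y xy; rewrite /xflow; case: ifPn => x0; case: ifPn => y0 //.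
- exact: flow_homo.
- by move: y0; rewrite (le_trans x0 (ltW xy)).
- by rewrite (@lt_le_trans _ _ 0) ?flow_ge0// ltNge.
Qed.

Lemma xflowK t : cancel (xflow (- t)) (xflow t).
Proof.
move=> x; rewrite /xflow; have [x0|x0] := leP 0 x.
  by rewrite flow_ge0// -{1}(opprK t) flowK.
by rewrite leNgt x0.
Qed.

Lemma xflow_cov t (f : R -> R) : measurable_fun setT f ->
  (integ setT (fun x => f (xflow t x) * xdens t x) <-> integ setT f) /\
  (integ setT f -> \int[mu]_x (f (xflow t x) * xdens t x) = \int[mu]_x f x).
Proof.
apply: ac_change_of_variables; [exact: ac_xflow|exact: xdens_ge0|
  exact: measurable_xdens|exact: xflow_homo|exact: xflowK].
Qed.

(** Chain rule without pointwise derivatives: the increment of u between the images of a and b is an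
    integral of g, pulled back by the change of variables. *)
Lemma ac_comp_xflow t (u g : R -> R) : measurable_fun setT g -> ac setT u g ->
  ac setT (fun x => u (xflow t x)) (fun x => g (xflow t x) * xdens t x).
Proof.
move=> mg au a b _ _ ab.
have lex x y : (xflow t x <= xflow t y) = (x <= y) by apply: le_mono; exact: xflow_homo.
have fab : xflow t a <= xflow t b by rewrite lex.
have [gi ge] := au (xflow t a) (xflow t b) Logic.I Logic.I fab.
have mD : measurable (`[xflow t a, xflow t b] : set R) by exact: measurable_itv.
have [h1 h2] := ac_change_of_variables_set mD (ac_xflow t) (xdens_ge0 t)
  (measurable_xdens t) (@xflow_homo t) (@xflowK t) mg.
have eD : xflow t @^-1` `[xflow t a, xflow t b] = `[a, b]%classic.
  by apply/seteqP; split => x; rewrite /= !in_itv/= !lex.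
by rewrite eD in h1 h2; split; [exact/h1|rewrite ge -h2].
Qed.

Lemma xflow_le0 t x : x <= 0 -> xflow t x = x.
Proof.
rewrite le_eqVlt /xflow => /predU1P[->|x0]; first by rewrite lexx flow0.
by rewrite leNgt x0.
Qed.

Lemma measurable_xflow t : measurable_fun setT (xflow t).
Proof. by apply: continuous_mfun; exact: ac_continuous (ac_xflow t). Qed.

(* Data on the half-line x >= 0, extended by zero. *)
Definition halfline (u g : R -> R) : Prop :=
  [/\ ac setT u g, sqi u, sqi g, (forall x, x <= 0 -> u x = 0) &
      (forall x, x < 0 -> g x = 0)].

Lemma halfline_prim0 u g x : halfline u g -> x <= 0 -> prim u x = 0.
Proof.
move=> [_ _ _ u0 _] x0; rewrite prim_le0// (@eq_Rintegral _ _ _ _ _ (fun=> 0)).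
  by rewrite Rintegral_cst ?mul0r ?oppr0.
by move=> y; rewrite inE/= in_itv/= => /andP[_ y0]; exact: u0.
Qed.

(** * The solution on the half-line *)

Definition hsol (u : R -> R) (t x : R) : R :=
  u (xflow t x) + (1 - expR (- t)) * expR (- x) * prim u (xflow t x).

Definition hdsol (u g : R -> R) (t x : R) : R :=
  g (xflow t x) * xdens t x + (1 - expR (- t)) * expR (- x) *
    (u (xflow t x) * xdens t x - prim u (xflow t x)).

Lemma ac_expN : ac setT (fun x => expR (- x)) (fun x => - expR (- x)).
Proof.
apply: ac_C1 => // x _; first exact: dexpN.
by apply: cvgN; exact: (is_derive_continuous (dexpN x)).
Qed.

Section halfline_flow.
Context (u g : R -> R) (ug : halfline u g).

Let aug : ac setT u g. Proof. by case: ug. Qed.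
Let cu : continuous u. Proof. exact: ac_continuous aug. Qed.
Let meas_u : measurable_fun setT u. Proof. by case: ug => _ []. Qed.
Let mg : measurable_fun setT g. Proof. by case: ug => _ _ []. Qed.
Let aw : ac setT (prim u) u. Proof. exact/ac_prim/continuous_locint. Qed.
Let iT : is_interval (@setT R). Proof. by []. Qed.

Lemma hsol_ac t : ac setT (hsol u t) (hdsol u g t).
Proof.
have a1 := ac_comp_xflow t mg aug.
have a2 := ac_mul iT ac_expN (ac_comp_xflow t meas_u aw).
have := acD a1 (acZ (1 - expR (- t)) a2).
congr (ac _ _ _); apply/funext => x; rewrite /hsol /hdsol; ring.
Qed.

Lemma xflow_pos t x : 0 <= x -> xflow t x = flow t x.
Proof. by move=> x0; rewrite /xflow x0. Qed.

(** The origin of the formula for [hsol]: differentiating [amp] times [prim u] along the flow, the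
    Jacobian cancels against [amp], and the derivative 1 - [amp] of the factor produces the
    correction term. *)
Lemma hsol_prim t x : 0 <= x -> prim (hsol u t) x = amp t x * prim u (flow t x).
Proof.
move=> x0.
have aA : ac [set x | 0 <= x] (amp t) (fun x => 1 - amp t x).
  apply: ac_C1 => [|y _|y _]; [exact: ge0_interval|exact: amp_derive|].
  by apply: cvgB; [exact: cvg_cst|exact: amp_continuous].
have aF : ac [set x | 0 <= x] (fun x => prim u (xflow t x)) (fun x => u (xflow t x) * xdens t x).
  by apply: (ac_sub _ (ac_comp_xflow t meas_u aw)).
have [_ +] := ac_mul ge0_interval aA aF (lexx 0) x0 x0.
rewrite (@xflow_le0 t 0)// prim0 mulr0 subr0 xflow_pos// => ->.
rewrite prim_ge0//; apply: eq_Rintegral => y; rewrite inE/= in_itv/= => /andP[y0 _].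
rewrite /hsol xflow_pos// /xdens y0; have := amp_gt0 t y0.
have -> : (1 - expR (- t)) * expR (- y) = 1 - amp t y by rewrite /amp; ring.
by move: (amp t y) => a a0; field; rewrite gt_eqF.
Qed.

Lemma hsol_le0 t x : x <= 0 -> hsol u t x = 0.
Proof.
move=> x0; rewrite /hsol xflow_le0// (halfline_prim0 ug x0) mulr0 addr0.
by case: ug => _ _ _ + _; apply.
Qed.

Lemma hdsol_lt0 t x : x < 0 -> hdsol u g t x = 0.
Proof.
move=> x0; rewrite /hdsol xflow_le0 ?ltW// (halfline_prim0 ug (ltW x0)).
by case: ug => _ _ _ u0 g0; rewrite u0 ?g0 ?ltW//; ring.
Qed.

Lemma hsolE t x : 0 <= x ->
  hsol u t x = u (flow t x) + (1 - amp t x) * prim u (flow t x).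
Proof. by move=> x0; rewrite /hsol xflow_pos// /amp; ring. Qed.

Lemma hdsolE t x : 0 <= x -> hdsol u g t x = g (flow t x) / amp t x +
  (1 - amp t x) * (u (flow t x) / amp t x - prim u (flow t x)).
Proof. by move=> x0; rewrite /hdsol xflow_pos// /xdens x0 /amp; ring. Qed.

(** By [hsol_prim] and [amp_flow] the coefficients of the primitive telescope: (1 - a) + (1 - b) a =
    1 - a b, where a and b are the amplitudes for t and s. *)
Lemma hsol_group t s x : hsol (hsol u t) s x = hsol u (t + s) x.
Proof.
have [x0|x0] := leP 0 x.
  have S0 := flow_ge0 s x0.
  rewrite /hsol (xflow_pos s x0) -/(hsol u t _) (hsolE t S0) (hsol_prim t S0).
  rewrite -/(hsol u (t + s) x) hsolE// amp_flow// flow_flow//.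
  have -> : (1 - expR (- s)) * expR (- x) = 1 - amp s x by rewrite /amp; ring.
  ring.
have H t' : hsol u t' x = 0 by apply: hsol_le0; exact: ltW.
have P : prim (hsol u t) x = 0.
  rewrite prim_le0 ?ltW// (@eq_Rintegral _ _ _ _ _ (fun=> 0)).
    by rewrite Rintegral_cst ?mul0r ?oppr0.
  by move=> y; rewrite inE/= in_itv/= => /andP[_ y0]; exact: hsol_le0.
rewrite H [LHS](_ : _ = hsol u t (xflow s x) + (1 - expR (- s)) * expR (- x) *
  prim (hsol u t) (xflow s x))// (xflow_le0 s (ltW x0)) H P; ring.
Qed.

Lemma hsol_0 x : hsol u 0 x = u x.
Proof.
rewrite /hsol oppr0 expR0 subrr !mul0r addr0; congr u.
by have [x0|x0] := leP 0 x; [rewrite xflow_pos// flow_0|rewrite xflow_le0 ?ltW].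
Qed.

Definition hbound : R := Num.sqrt (\int[mu]_x (u x ^+ 2 + g x ^+ 2)).

Lemma hbound_ge0 : 0 <= hbound. Proof. exact: sqrtr_ge0. Qed.

(** Since u(0) = 0, u(x)^2 is the integral of 2 u g over [0, x], at most that of u^2 + g^2. *)
Lemma halfline_bounded x : `|u x| <= hbound.
Proof.
have [x0|x0] := leP x 0.
  by case: ug => _ _ _ + _ => ->//; rewrite normr0 hbound_ge0.
have ig : integ setT (fun x => u x ^+ 2 + g x ^+ 2).
  by case: ug => _ su sg _ _; exact: sqr_sum_integ.
rewrite -sqrtr_sqr ler_sqrt//; last first.
  by apply: Rintegral_ge0 => y _; rewrite addr_ge0// sqr_ge0.
have u0 : u 0 = 0 by case: ug => _ _ _ + _; apply.
have [i e] := (ac_mul iT aug aug) 0 x Logic.I Logic.I (ltW x0).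
rewrite expr2; rewrite u0 mulr0 subr0 in e; rewrite e.
apply: (@le_trans _ _ (\int[mu]_(y in `[0, x]) (u y ^+ 2 + g y ^+ 2))).
  apply: le_Rintegral => //; first by apply: integrableS ig.
  by move=> y _; have := sqr_ge0 (u y - g y); rewrite !expr2; lra.
rewrite Rintegral_mkcond; apply: le_Rintegral => //.
  by apply/integrable_patch => //; apply: integrableS ig.
by move=> y _; rewrite patchE; case: ifP => // _; rewrite addr_ge0// sqr_ge0.
Qed.

Lemma halfline_prim_bounded x : 0 <= x -> `|prim u x| <= hbound * x.
Proof.
move=> x0; rewrite prim_ge0//.
have ui := continuous_locint cu 0 x.
apply: le_trans; first exact: le_normr_Rintegral.
apply: (@le_trans _ _ (\int[mu]_(y in `[0, x]) hbound)).
  apply: le_Rintegral => //; first exact: integrable_norm.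
    by apply: continuous_locint; exact: contC.
  by move=> y _; exact: halfline_bounded.
rewrite Rintegral_cst//= lebesgue_measure_itv/= lte_fin.
by case: ltP => //= x00; rewrite ?subr0// mulr0 mulr_ge0// hbound_ge0.
Qed.

End halfline_flow.

(* The restriction of phi to the half-line. *)
Definition expw (x : R) : R := if 0 <= x then expR (- x) else 0.

Lemma expw_integ : integ setT expw.
Proof.
have -> : expw = (fun x => expR (- x)) \_ `[0, +oo[.
  apply/funext => x; rewrite patchE /expw.
  rewrite (_ : (x \in `[0, +oo[%classic) = (0 <= x)); first by case: ifP.
  by apply/idP/idP; rewrite inE/= in_itv/= andbT.
apply/integrable_patch => //; apply/integrableP; split.
  apply/measurable_EFinP; apply: measurable_funTS; apply: continuous_mfun.
  by move=> x; exact: (is_derive_continuous (dexpN x)).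
under eq_integral do rewrite /= ger0_norm ?expR_ge0//.
rewrite (@ge0_continuous_FTC2y _ _ (fun x => - expR (- x)) 0 0) ?ltry//.
- by apply: continuous_subspaceT => x; exact: (is_derive_continuous (dexpN x)).
- by rewrite -oppr0; apply: cvgN; exact: cvgr_expR.
- apply: cvg_at_right_filter; apply: cvgN; exact: (is_derive_continuous (dexpN 0)).
- move=> x _; rewrite derive1E; have d := dexpN x.
  by rewrite (@derive_val _ _ _ _ _ _ _ (is_deriveN _)) opprK.
Qed.

(** Squares of x + 1 <= 2 (1 + x/2) <= 2 e^(x/2). It absorbs the linear growth of primitives into
    half of the decay of e^(-2x). *)
Lemma sqr_le_exp (x : R) : 0 <= x -> (x + 1) ^+ 2 <= 4 * expR x.
Proof.
move=> x0; have h : 1 + x / 2 <= expR (x / 2) by exact: expR_ge1Dx.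
have -> : expR x = expR (x / 2) * expR (x / 2) by rewrite -expRD; congr expR; field.
by rewrite expr2; have := expR_gt0 (x / 2); nra.
Qed.

Lemma sqiD (f g : R -> R) : sqi f -> sqi g -> sqi (fun x => f x + g x).
Proof.
move=> [mf fi] [mg gi]; split; first exact: measurable_funD.
apply: (@le_integrableR _ _ (fun x => 2 * (f x ^+ 2 + g x ^+ 2))) => //.
- by apply: measurable_funX; exact: measurable_funD.
- move=> x _; rewrite ger0_norm ?sqr_ge0//; have := sqr_ge0 (f x - g x).
  by rewrite !expr2; lra.
- by apply: integZl => //; exact: integD.
Qed.

Lemma sqiZ (k : R) (f : R -> R) : sqi f -> sqi (fun x => k * f x).
Proof.
move=> [mf fi]; split; first exact: measurable_funM.
under eq_fun do rewrite exprMn; exact: integZl.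
Qed.

Lemma sqiN (f : R -> R) : sqi f -> sqi (fun x => - f x).
Proof. by move=> /(sqiZ (-1)); under eq_fun do rewrite mulN1r. Qed.

Lemma sqiB (f g : R -> R) : sqi f -> sqi g -> sqi (fun x => f x - g x).
Proof. by move=> sf /sqiN; exact: sqiD. Qed.

Lemma xdens_bounds t x : expR (- `|t|) <= xdens t x <= expR `|t|.
Proof.
rewrite /xdens; case: ifPn => [x0|_]; last first.
  by rewrite expNle1//= -expR0 ler_expR.
have /andP[a1 a2] := amp_bounds t x0; have a0 := amp_gt0 t x0.
have e0 := expR_gt0 `|t|.
apply/andP; split.
  by rewrite expRN lef_pV2.
by rewrite -[leRHS]invrK -expRN lef_pV2// posrE expR_gt0.
Qed.

(** Inserting the Jacobian [xdens] costs a factor e^|t|, after which the change of variables gives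
    the integral of f^2 exactly. *)
Lemma sqi_comp_xflow t (f : R -> R) : sqi f -> sqi (fun x => f (xflow t x)) /\
  \int[mu]_x f (xflow t x) ^+ 2 <= expR `|t| * \int[mu]_x f x ^+ 2.
Proof.
move=> [mf fi]; have mfS : measurable_fun setT (fun x => f (xflow t x)).
  by apply: (measurableT_comp mf); exact: measurable_xflow.
have [h1 h2] := xflow_cov t (measurable_funX 2 mf).
have ci := h1.2 fi; rewrite -(h2 fi) -RintegralZl//.
have le x : f (xflow t x) ^+ 2 <= expR `|t| * (f (xflow t x) ^+ 2 * xdens t x).
  rewrite mulrCA ler_peMr ?sqr_ge0//; have /andP[+ _] := xdens_bounds t x => h.
  apply: (@le_trans _ _ (expR `|t| * expR (- `|t|))); first by rewrite -expRD subrr expR0.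
  by rewrite ler_wpM2l ?expR_ge0.
have i1 : integ setT (fun x => f (xflow t x) ^+ 2).
  apply: (@le_integrableR _ _ (fun x => expR `|t| * (f (xflow t x) ^+ 2 * xdens t x))) => //.
  - exact: measurable_funX.
  - by move=> x _; rewrite ger0_norm ?sqr_ge0.
  - exact: integZl.
split; first by split.
by apply: le_Rintegral => //; exact: integZl.
Qed.

Lemma sqi_comp_xflow_dens t (f : R -> R) : sqi f ->
  sqi (fun x => f (xflow t x) * xdens t x) /\
  \int[mu]_x (f (xflow t x) * xdens t x) ^+ 2 <= expR `|t| * \int[mu]_x f x ^+ 2.
Proof.
move=> [mf fi]; have mfS : measurable_fun setT (fun x => f (xflow t x) * xdens t x).
  apply: measurable_funM; last exact: measurable_xdens.
  by apply: (measurableT_comp mf); exact: measurable_xflow.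
have [h1 h2] := xflow_cov t (measurable_funX 2 mf).
have ci := h1.2 fi; rewrite -(h2 fi) -RintegralZl//.
have le x : (f (xflow t x) * xdens t x) ^+ 2 <= expR `|t| * (f (xflow t x) ^+ 2 * xdens t x).
  rewrite exprMn [X in _ * X]expr2 mulrA mulrC ler_wpM2r//.
    by rewrite mulr_ge0 ?sqr_ge0 ?xdens_ge0.
  by have /andP[_ +] := xdens_bounds t x.
have i1 : integ setT (fun x => (f (xflow t x) * xdens t x) ^+ 2).
  apply: (@le_integrableR _ _ (fun x => expR `|t| * (f (xflow t x) ^+ 2 * xdens t x))) => //.
  - exact: measurable_funX.
  - by move=> x _; rewrite ger0_norm ?sqr_ge0.
  - exact: integZl.
split; first by split.
by apply: le_Rintegral => //; exact: integZl.
Qed.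

(** By [sqr_le_exp], e^(-2x) (x + 1)^2 <= 4 e^(-x). *)
Lemma weight_bound (q B x : R) : 0 <= x -> `|q| <= B * (expR (- x) * (x + 1)) ->
  q ^+ 2 <= 4 * B ^+ 2 * expw x.
Proof.
move=> x0 h; rewrite /expw x0.
have B0 : `|q| ^+ 2 <= (B * (expR (- x) * (x + 1))) ^+ 2 by rewrite lerXn2r// nnegrE (le_trans _ h).
rewrite -normrX ger0_norm ?sqr_ge0// in B0; apply: (le_trans B0).
have := sqr_le_exp x0; rewrite !exprMn => h2.
have e : expR (- x) ^+ 2 * expR x = expR (- x) by rewrite expr2 -mulrA -expRD addNr expR0 mulr1.
have h3 : expR (- x) ^+ 2 * (x + 1) ^+ 2 <= 4 * expR (- x).
  apply: (@le_trans _ _ (expR (- x) ^+ 2 * (4 * expR x))); first by rewrite ler_wpM2l ?sqr_ge0.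
  by rewrite mulrCA e.
by have := sqr_ge0 B; nra.
Qed.

Lemma weight_sqi (q : R -> R) (B : R) : measurable_fun setT q ->
  (forall x, x < 0 -> q x = 0) ->
  (forall x, 0 <= x -> `|q x| <= B * (expR (- x) * (x + 1))) ->
  sqi q /\ forall x, q x ^+ 2 <= 4 * B ^+ 2 * expw x.
Proof.
move=> mq q0 qB.
have h x : q x ^+ 2 <= 4 * B ^+ 2 * expw x.
  have [x0|x0] := leP 0 x; first exact: weight_bound (qB _ x0).
  have -> : expw x = 0 by rewrite /expw leNgt x0.
  by rewrite q0// mulr0 expr0n.
split => //; split => //.
apply: (@le_integrableR _ _ (fun x => 4 * B ^+ 2 * expw x)) => //.
- exact: measurable_funX.
- by move=> x _; rewrite ger0_norm ?sqr_ge0.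
- by apply: integZl => //; exact: expw_integ.
Qed.

(** * The norm identity on the half-line *)

Section halfline_norm.
Context (u g : R -> R) (ug : halfline u g).
Let aug : ac setT u g. Proof. by case: ug. Qed.
Let meas_u : measurable_fun setT u. Proof. by case: ug => _ []. Qed.
Let mg : measurable_fun setT g. Proof. by case: ug => _ _ []. Qed.
Let aw : ac setT (prim u) u.
Proof. exact/ac_prim/continuous_locint/(ac_continuous aug). Qed.
Let mW : measurable_fun setT (prim u). Proof. by apply: continuous_mfun; exact: (ac_continuous aw). Qed.
Local Notation M := (hbound u g).

Lemma prim_flow_bound t x : 0 <= x ->
  `|prim u (xflow t x)| <= M * (1 + 2 * `|t|) * (x + 1).
Proof.
move=> x0; rewrite xflow_pos//; have f0 := flow_ge0 t x0.
apply: (le_trans (halfline_prim_bounded ug f0)); rewrite -mulrA ler_wpM2l ?hbound_ge0//.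
have := flow_dist t x0; rewrite ler_norml => /andP[_ h].
by have := normr_ge0 t; nra.
Qed.

Lemma mexpN : measurable_fun setT (fun x : R => expR (- x)).
Proof. by apply: continuous_mfun => x; exact: (is_derive_continuous (dexpN x)). Qed.

(** What [hsol] and [hdsol] add to pure transport. The factor e^(-x) beats the linear growth of
    [prim u], which may fail to be square integrable by itself. *)
Definition hcorr t x := (1 - expR (- t)) * expR (- x) * prim u (xflow t x).
Definition hdcorr t x := (1 - expR (- t)) * expR (- x) *
    (u (xflow t x) * xdens t x - prim u (xflow t x)).

Lemma hcorr_sqi t : sqi (hcorr t) /\ forall x,
  hcorr t x ^+ 2 <= 4 * (`|1 - expR (- t)| * (M * (1 + 2 * `|t|))) ^+ 2 * expw x.
Proof.
apply: weight_sqi.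
- apply: measurable_funM; first by apply: measurable_funM => //; exact: mexpN.
  by apply: (measurableT_comp mW); exact: measurable_xflow.
- by move=> x x0; rewrite /hcorr xflow_le0 ?ltW// (halfline_prim0 ug (ltW x0)) mulr0.
- move=> x x0; rewrite /hcorr 2!normrM (ger0_norm (expR_ge0 _)) -!mulrA ler_wpM2l//.
  rewrite [leRHS](_ : _ = expR (- x) * (M * (1 + 2 * `|t|) * (x + 1))); last ring.
  by rewrite ler_wpM2l ?expR_ge0//; exact: prim_flow_bound.
Qed.

Lemma hdcorr_sqi t : sqi (hdcorr t) /\ forall x,
  hdcorr t x ^+ 2 <= 4 * (`|1 - expR (- t)| * (M * (expR `|t| + (1 + 2 * `|t|)))) ^+ 2 * expw x.
Proof.
apply: weight_sqi.
- apply: measurable_funM; first by apply: measurable_funM => //; exact: mexpN.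
  apply: measurable_funB.
    apply: measurable_funM; last exact: measurable_xdens.
    by apply: (measurableT_comp meas_u); exact: measurable_xflow.
  by apply: (measurableT_comp mW); exact: measurable_xflow.
- move=> x x0; rewrite /hdcorr xflow_le0 ?ltW// (halfline_prim0 ug (ltW x0)).
  have -> : u x = 0 by case: ug => _ _ _ h _; apply: h; exact: ltW.
  ring.
- move=> x x0; rewrite /hdcorr 2!normrM (ger0_norm (expR_ge0 _)) -!mulrA ler_wpM2l//.
  rewrite [leRHS](_ : _ = expR (- x) * (M * (expR `|t| + (1 + 2 * `|t|)) * (x + 1))); last ring.
  rewrite ler_wpM2l ?expR_ge0//; apply: (le_trans (ler_normB _ _)).
  have h1 := prim_flow_bound t x0.
  have h2 : `|u (xflow t x) * xdens t x| <= M * expR `|t|.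
    have /andP[_ d] := xdens_bounds t x.
    by rewrite normrM (ger0_norm (xdens_ge0 _ _)) ler_pM// ?xdens_ge0//; exact: halfline_bounded.
  have : 0 <= M * expR `|t| by rewrite mulr_ge0 ?hbound_ge0 ?expR_ge0.
  by nra.
Qed.

Lemma halfline_hsol t : halfline (hsol u t) (hdsol u g t).
Proof.
case: (ug) => _ su sg _ _; split.
- exact: (hsol_ac ug).
- by apply: sqiD; [exact: (sqi_comp_xflow t su).1|exact: (hcorr_sqi t).1].
- by apply: sqiD; [exact: (sqi_comp_xflow_dens t sg).1|exact: (hdcorr_sqi t).1].
- by move=> x; exact: (hsol_le0 ug).
- by move=> x; exact: (hdsol_lt0 ug).
Qed.

(** The cocycle identity for the inverse flow: the right-hand side is the inverse of [amp (- t)] at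
    the image point. It lets integrands be rewritten in the variable s = [flow t x]. *)
Lemma amp_ampVflow t x : 0 <= x ->
  amp t x = (1 + (expR t - 1) * expR (- flow t x))^-1.
Proof.
move=> x0; have a0 := amp_gt0 t x0.
rewrite expRN expR_flow// expRD; have e0 := expR_gt0 x; have t0 := expR_gt0 t.
have e : amp t x = 1 - (1 - (expR t)^-1) * (expR x)^-1 by rewrite /amp !expRN.
move: a0; rewrite e; move: (expR x) (expR t) e0 t0 => y z y0 z0.
have -> : 1 - (1 - z^-1) * y^-1 = (z * y - z + 1) / (z * y) by field; rewrite !gt_eqF.
move=> a0; have n0 : 0 < z * y - z + 1.
  by move: a0; rewrite pmulr_lgt0// invr_gt0 mulr_gt0.
have -> : y * z * ((z * y - z + 1) / (z * y)) = z * y - z + 1 by field; rewrite !gt_eqF.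
have -> : 1 + (z - 1) / (z * y - z + 1) = z * y / (z * y - z + 1) by field; rewrite gt_eqF.
by rewrite invf_div.
Qed.

Lemma exp_linear_cvg0 : expR (- n%:R) * (n%:R + 1) @[n --> \oo] --> (0 : R).
Proof.
have h (n : nat) : (0 : R) <= expR (- (n%:R : R)) * ((n%:R : R) + 1) <= 4 * (n.+1%:R : R)^-1.
  have n0 : 0 <= (n%:R : R) by [].
  rewrite mulr_ge0 ?expR_ge0//=.
  have := sqr_le_exp n0; rewrite expr2 expRN; have E0 := expR_gt0 (n%:R : R).
  have m0 : 0 < (n%:R : R) + 1 by lra.
  by move=> h; rewrite -(natr1 n) ler_pdivlMr// -mulrA ler_pdivrMl// [leRHS]mulrC.
apply: (@squeeze_cvgr _ _ _ _ (fun=> 0) (fun n => 4 * n.+1%:R^-1)); first exact: nearW.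
  exact: cvg_cst.
by rewrite -(mulr0 4); apply: cvgMr; exact: cvg_harmonic.
Qed.

Lemma hsol_norm t :
  \int[mu]_x (hsol u t x ^+ 2 + hdsol u g t x ^+ 2) =
  \int[mu]_x (u x ^+ 2 + g x ^+ 2) +
  2 * (expR t - 1) * \int[mu]_x (expw x * (u x ^+ 2 + 2^-1 * g x ^+ 2)).
Proof.
pose D := expR t - 1.
(* The reciprocal of [amp t x] as a function of the image point s, by [amp_ampVflow]. *)
pose d s := 1 + D * expR (- s).
(* Equal to 1 / d for s >= 0; this form is measurable on the whole line. *)
pose A s := expR (- ln (d s)).
pose Ai s := expR (ln (d s)).
have d_ge s : 0 <= s -> expR (- `|t|) <= d s.
  move=> s0; have := expNle1 s0; have := expR_gt0 (- s).
  have t1 : expR (- `|t|) <= expR t by rewrite ler_expR -lerNl -normrN ler_norm.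
  have : expR (- `|t|) <= 1 by exact: expNle1.
  by rewrite /d /D; nra.
have d_gt0 s : 0 <= s -> 0 < d s.
  by move=> s0; apply: lt_le_trans (d_ge s s0); exact: expR_gt0.
have AE s : 0 <= s -> A s = (d s)^-1 by move=> s0; rewrite /A expRN lnK// posrE d_gt0.
have AiE s : 0 <= s -> Ai s = d s by move=> s0; rewrite /Ai lnK// posrE d_gt0.
have mE : measurable_fun setT (fun s : R => expR (- s)) by exact: mexpN.
have md : measurable_fun setT d by apply: measurable_funD => //; exact: measurable_funM.
have mln : measurable_fun setT (fun s => ln (d s)).
  by apply: (measurableT_comp _ md); exact: measurable_ln.
have mA : measurable_fun setT A.
  by apply: (measurableT_comp (@measurable_expR R)); exact: measurable_funN.
have mAi : measurable_fun setT Ai by exact: (measurableT_comp (@measurable_expR R)).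
(* Chosen so that f along the flow times [xdens] is the integrand on the left; the factor A cancels
   the Jacobian. *)
pose f s := A s * ((u s + (1 - A s) * prim u s) ^+ 2 +
  (g s * Ai s + (1 - A s) * (u s * Ai s - prim u s)) ^+ 2).
have mf : measurable_fun setT f.
  have m1A : measurable_fun setT (fun s => 1 - A s) by exact: measurable_funB.
  apply: measurable_funM => //; apply: measurable_funD; apply: measurable_funX.
    by apply: measurable_funD => //; exact: measurable_funM.
  apply: measurable_funD; first exact: measurable_funM.
  by apply: measurable_funM => //; apply: measurable_funB => //; exact: measurable_funM.
have fE x : f (xflow t x) * xdens t x = hsol u t x ^+ 2 + hdsol u g t x ^+ 2.
  have [x0|x0] := leP 0 x.
    rewrite hsolE// hdsolE// /f xflow_pos// /xdens x0.
    have f0 := flow_ge0 t x0; have a0 := amp_gt0 t x0.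
    have aE := amp_ampVflow t x0; rewrite -/D -/(d _) in aE.
    rewrite AE// AiE// -aE -[d (flow t x)]invrK -aE.
    by field; rewrite gt_eqF.
  have u0 : u x = 0 by case: ug => _ _ _ h _; apply: h; exact: ltW.
  have g0 : g x = 0 by case: ug => _ _ _ _ h; exact: h.
  rewrite (hsol_le0 ug) ?ltW// (hdsol_lt0 ug)// xflow_le0 ?ltW// /f u0 g0.
  by rewrite (halfline_prim0 ug (ltW x0)); ring.
have [_ sV sVx _ _] := halfline_hsol t; have [_ su sg _ _] := ug.
have iV : integ setT (fun x => hsol u t x ^+ 2 + hdsol u g t x ^+ 2) by exact: sqr_sum_integ.
have [h1 h2] := xflow_cov t mf.
have fi : integ setT f.
  by apply/h1; move: iV; congr (integrable _ _ (EFin \o _)); apply/funext => x; rewrite fE.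
have -> : \int[mu]_x (hsol u t x ^+ 2 + hdsol u g t x ^+ 2) = \int[mu]_x f x.
  by rewrite -(h2 fi); apply: eq_Rintegral => x _; rewrite fE.
have iu : integ setT (fun x => u x ^+ 2 + g x ^+ 2) by exact: sqr_sum_integ.
have mexpw : measurable_fun setT expw.
  by have /integrableP[/measurable_EFinP] := expw_integ.
have iw : integ setT (fun x => expw x * (u x ^+ 2 + 2^-1 * g x ^+ 2)).
  apply: (@le_integrableR _ _ (fun x => u x ^+ 2 + g x ^+ 2)) => //.
    apply: measurable_funM => //; apply: measurable_funD; first exact: measurable_funX.
    by apply: measurable_funM => //; exact: measurable_funX.
  move=> x _; have := sqr_ge0 (u x); have := sqr_ge0 (g x).
  have w1 : 0 <= expw x <= 1.
    by rewrite /expw; case: ifP => x0; rewrite ?lexx ?ler01// expR_ge0 expNle1.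
  move: w1 => /andP[w0 w1] gg uu; rewrite ger0_norm; last by apply: mulr_ge0 => //; lra.
  by nra.
pose h s := f s - (u s ^+ 2 + g s ^+ 2) - 2 * D * (expw s * (u s ^+ 2 + 2^-1 * g s ^+ 2)).
have ih : integ setT h by apply: integB => //; [exact: integB|exact: integZl].
suff : \int[mu]_x h x = 0.
  rewrite /h RintegralB//; [|exact: integB|exact: integZl].
  by rewrite RintegralB// RintegralZl// /D; lra.
have h0 s : s < 0 -> h s = 0.
  move=> s0; have u0 : u s = 0 by case: ug => _ _ _ k _; apply: k; exact: ltW.
  have g0 : g s = 0 by case: ug => _ _ _ _ k; exact: k.
  by rewrite /h /f u0 g0 (halfline_prim0 ug (ltW s0)); ring.
have -> : \int[mu]_x h x = \int[mu]_(x in `[0, +oo[) h x.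
  rewrite [RHS]Rintegral_mkcond; apply: eq_Rintegral => x _; rewrite patchE.
  by case: ifPn => //; rewrite notin_setE /= in_itv/= andbT => /negP; rewrite -ltNge => /h0.
have sT : [set x : R | 0 <= x] `<=` setT by [].
have aE : ac [set x | 0 <= x] (fun s => D * expR (- s)) (fun s => D * - expR (- s)).
  by apply: acZ; exact: (ac_sub sT ac_expN).
have dA (s : R) : 0 <= s -> is_derive s 1 A (A s * (1 - A s)).
  move=> s0; have d0 := d_gt0 s s0.
  have dd : is_derive s 1 d (- (D * expR (- s))).
    have de := dexpN s; apply: (@is_derive_eq _ _ _ (fun s : R => 1 + D * expR (- s))).
    by rewrite /GRing.scale/=; ring.
  have dl := @is_derive1_comp _ (@ln R) d s _ _ (is_derive1_ln d0) dd.
  have dn := is_deriveN dl.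
  have := @is_derive1_comp _ (@expR R) (fun s => - ln (d s)) s _ _ (is_derive_expR _) dn.
  congr (is_derive _ _ _ _); rewrite -/(A s) AE//.
  have -> : D * expR (- s) = d s - 1 by rewrite /d; ring.
  by field; rewrite gt_eqF.
have aA : ac [set x | 0 <= x] A (fun s => A s * (1 - A s)).
  apply: (@ac_C1 [set x | 0 <= x] A _ ge0_interval dA) => s s0.
  have cA := is_derive_continuous (dA s s0).
  by apply: cvgM => //; apply: cvgB => //; exact: cvg_cst.
have a1 : ac [set x : R | 0 <= x] (fun=> 1) (fun=> 0) by exact: ac_cst.
have a1A := acB a1 aA.
have au0 := ac_sub sT aug; have aw0 := ac_sub sT aw.
have gI := ge0_interval.
have aB := acB (acB (ac_mul gI aE (ac_mul gI au0 au0))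
  (acZ 2 (ac_mul gI (ac_mul gI a1A aw0) au0)))
  (ac_mul gI (ac_mul gI a1A a1A) (ac_mul gI aw0 aw0)).
set B := (X in ac _ X _) in aB.
set B' := (X in ac _ _ X) in aB.
(* The excess h of the integrand is the derivative of
   B = D e^(-s) u^2 - 2 (1 - A) P u - (1 - A)^2 P^2, with P = prim u. *)
have B'E : {in `[0, +oo[%classic, B' =1 h}.
  move=> s; rewrite inE/= in_itv/= andbT => s0; rewrite /B' /h /f /=.
  have d0 := d_gt0 s s0; have e0 := expR_gt0 (- s).
  have DE : D = (d s - 1) / expR (- s) by rewrite /d; field; rewrite gt_eqF.
  rewrite /expw s0 AE// AiE// [D]DE; move: (d s) (expR (- s)) d0 e0 => a e a0 e0.
  by field; rewrite !gt_eqF.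
have B0 : B 0 = 0.
  have u0 : u 0 = 0 by case: ug => _ _ _ k _; exact: k.
  by rewrite /B u0 prim0; ring.
have iB : integ `[0, +oo[ B'.
  have : integ `[0, +oo[ h by exact: integrableS ih.
  by apply: eq_integrable => //= x xD; rewrite /= B'E.
(* All three terms of B carry e^(-s), the first explicitly and the others through 1 - A = A D
   e^(-s), while u is bounded and [prim u] grows at most linearly. *)
have cB : B n%:R @[n --> \oo] --> 0.
  pose p (n : nat) : R := expR (- n%:R) * (n%:R + 1).
  pose K := expR `|t|.
  pose C1 := `|D| * M ^+ 2 + 2 * K * `|D| * M ^+ 2.
  pose C2 := (K * `|D| * M) ^+ 2.
  have cp : C1 * p n + C2 * (p n * p n) @[n --> \oo] --> (0 : R).
    rewrite -(addr0 0) -{1}(mulr0 C1) -{2}(mulr0 C2) -{2}(mulr0 0).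
    have := exp_linear_cvg0 => cp.
    by apply: cvgD; apply: cvgMr => //; exact: cvgM.
  apply/norm_cvg0P; apply: squeeze_cvgr (cvg_cst 0) cp; apply: nearW => n.
  rewrite normr_ge0/=; have s0 : 0 <= (n%:R : R) by [].
  rewrite /B /p; move: (n%:R : R) s0 => s s0.
  have e0 := expR_gt0 (- s); have e1 := expNle1 s0; have d0 := d_gt0 s s0.
  have M0 : 0 <= M by exact: hbound_ge0.
  have D0 := normr_ge0 D; have K0 : 0 < K by exact: expR_gt0.
  have uM := halfline_bounded ug s; have WM := halfline_prim_bounded ug s0.
  have AK : A s <= K.
    by rewrite AE// -[K]invrK lef_pV2 ?posrE ?invr_gt0// /K -expRN; exact: d_ge.
  have aM : `|1 - A s| <= K * `|D| * expR (- s).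
    have -> : 1 - A s = A s * D * expR (- s).
      rewrite AE//; have -> : D = (d s - 1) / expR (- s) by rewrite /d; field; rewrite gt_eqF.
      by field; rewrite !gt_eqF.
    rewrite !normrM (ger0_norm (expR_ge0 (- s))) ler_wpM2r ?expR_ge0//.
    by rewrite ler_wpM2r// ger0_norm// expR_ge0.
  have ep : expR (- s) <= expR (- s) * (s + 1) by nra.
  have esp : expR (- s) * s <= expR (- s) * (s + 1) by nra.
  move: (expR (- s) * (s + 1)) ep esp => q ep esp.
  have b1 : `|D * expR (- s) * (u s * u s)| <= `|D| * M ^+ 2 * q.
    have uu : `|u s| * `|u s| <= M ^+ 2 by rewrite expr2 ler_pM.
    rewrite !normrM (ger0_norm (expR_ge0 (- s))) -[leRHS]mulrA -[leLHS]mulrA ler_wpM2l//.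
    by rewrite [leRHS]mulrC ler_pM ?mulr_ge0 ?expR_ge0.
  have b2 : `|(1 - A s) * prim u s * u s| <= K * `|D| * M ^+ 2 * q.
    rewrite !normrM; apply: (@le_trans _ _ (K * `|D| * expR (- s) * (M * s) * M)).
      by rewrite ler_pM ?mulr_ge0// ler_pM.
    rewrite [leLHS](_ : _ = K * `|D| * M ^+ 2 * (expR (- s) * s)); last ring.
    by rewrite ler_wpM2l// !mulr_ge0 ?sqr_ge0// ltW.
  have b3 : `|(1 - A s) * (1 - A s) * (prim u s * prim u s)| <= (K * `|D| * M) ^+ 2 * (q * q).
    rewrite -!expr2 -exprMn normrX -exprMn lerXn2r ?nnegrE ?mulr_ge0//; first exact: ltW.
      by rewrite (le_trans _ ep)// expR_ge0.
    rewrite normrM; apply: (@le_trans _ _ (K * `|D| * expR (- s) * (M * s))).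
      by rewrite ler_pM.
    rewrite [leLHS](_ : _ = K * `|D| * M * (expR (- s) * s)); last ring.
    by rewrite ler_wpM2l// !mulr_ge0// ltW.
  apply: (le_trans (ler_normB _ _)); apply: (le_trans (lerD (ler_normB _ _) (lexx _))).
  rewrite [X in _ + X + _]normrM (ger0_norm (ler0n _ 2)).
  rewrite [leRHS](_ : _ = `|D| * M ^+ 2 * q + 2 * (K * `|D| * M ^+ 2 * q) + C2 * (q * q)).
    by apply: lerD => //; apply: lerD => //; rewrite ler_pM2l.
  by rewrite /C1; ring.
rewrite -(@eq_Rintegral _ _ _ mu _ h B')//.
by rewrite (ac_integral_ge aB iB cB) B0 subr0.
Qed.
End halfline_norm.

(** * Differentiability at time zero *)

Lemma contMax (f g : R -> R) : continuous f -> continuous g ->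
  continuous (fun x => Num.max (f x) (g x)).
Proof. by move=> cf cg x; apply: (@continuous_max _ _ f g x); [exact: cf|exact: cg]. Qed.

Lemma contMin (f g : R -> R) : continuous f -> continuous g ->
  continuous (fun x => Num.min (f x) (g x)).
Proof. by move=> cf cg x; apply: (@continuous_min _ _ f g x); [exact: cf|exact: cg]. Qed.

Lemma Rintegral_sqrD (f g : R -> R) : sqi f -> sqi g ->
  \int[mu]_x (f x + g x) ^+ 2 <= 2 * (\int[mu]_x f x ^+ 2 + \int[mu]_x g x ^+ 2).
Proof.
move=> sf sg; have [_ fi] := sf; have [_ gi] := sg; have [_ si] := sqiD sf sg.
rewrite -RintegralD// -RintegralZl//; last exact: integD.
apply: le_Rintegral => //; first by apply: integZl => //; exact: integD.
by move=> x _; have := sqr_ge0 (f x - g x); rewrite !expr2; lra.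
Qed.

Lemma sqr_int_ge0 (f : R -> R) : 0 <= \int[mu]_x f x ^+ 2.
Proof. by apply: Rintegral_ge0 => x _; exact: sqr_ge0. Qed.

Lemma integ_bounded_supp (N K : R) (f : R -> R) : measurable_fun setT f ->
  (forall x, N < `|x| -> f x = 0) -> (forall x, `|f x| <= K) -> integ setT f.
Proof.
move=> mf f0 fK; apply: (@le_integrableR _ _ ((fun=> K) \_ `[- N, N])) => //.
  move=> x _; rewrite patchE; case: ifPn => [_|]; first by rewrite fK.
  rewrite notin_setE/= in_itv/= -ler_norml => /negP; rewrite -ltNge => /f0 ->.
  by rewrite normr0.
apply/integrable_patch => //; apply: continuous_locint; exact: contC.
Qed.

Lemma sqi_bounded_supp (N K : R) (f : R -> R) : measurable_fun setT f ->
  (forall x, N < `|x| -> f x = 0) -> (forall x, `|f x| <= K) -> sqi f.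
Proof.
move=> mf f0 fK; split => //.
apply: (@integ_bounded_supp N (K ^+ 2)) => [|x /f0 ->|x]; first exact: measurable_funX.
  by rewrite expr0n.
by rewrite normrX lerXn2r ?nnegrE// (le_trans _ (fK x)).
Qed.

(** * Density of compactly supported continuous functions in L^2 *)

Lemma sqi_truncate (f : R -> R) (e : R) : sqi f -> 0 < e ->
  exists n : nat, exists2 h : R -> R, measurable_fun setT h &
   [/\ forall x, n%:R < `|x| -> h x = 0, forall x, `|h x| <= n%:R &
     \int[mu]_x (f x - h x) ^+ 2 < e].
Proof.
move=> [mf fi] e0.
(* Truncation in both domain and range makes h bounded with bounded support; the squared error is
   dominated by f^2. *)
pose h (n : nat) (x : R) := if (`|x| <= n%:R) && (`|f x| <= n%:R) then f x else 0.
have mh n : measurable_fun setT (h n).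
  apply: measurable_fun_ifT => //; apply: measurable_and.
    by apply: measurable_fun_ler => //; exact: measurableT_comp.
  by apply: measurable_fun_ler => //; exact: measurableT_comp.
have := @Rintegral_dominated_cvg setT (fun n x => (f x - h n x) ^+ 2) (fun=> 0) (fun x => f x ^+ 2) measurableT.
rewrite Rintegral_cst// mul0r => H.
have /cvgrPdist_lt/(_ e e0) [n _ /(_ n (leqnn n))] : \int[mu]_x (f x - h n x) ^+ 2 @[n --> \oo] --> (0 : R).
  apply: H => //.
  - by move=> n; apply: measurable_funX; exact: measurable_funB.
  - move=> x _; apply: (@cvg_near_cst _ _ (0 : R)).
    near=> n; rewrite /h.
    have -> : `|x| <= n%:R by near: n; exact: nbhs_infty_ger.
    have -> /= : `|f x| <= n%:R by near: n; exact: nbhs_infty_ger.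
    by rewrite subrr expr0n.
  - move=> n x _; rewrite ger0_norm ?sqr_ge0// /h; case: ifP => _; last by rewrite subr0.
    by rewrite subrr expr0n sqr_ge0.
rewrite sub0r normrN ger0_norm ?sqr_int_ge0// => he.
exists n, (h n) => //; split => //.
- by move=> x; rewrite /h ltNge; case: (_ <= _).
- by move=> x; rewrite /h; case: ifP => [/andP[]//|_]; rewrite normr0.
Unshelve. all: by end_near.
Qed.

(** Clamping b to the interval [-k, k], which contains a, brings it no farther from a. *)
Lemma clamp_dist (k a b : R) : `|a| <= k ->
  `|a - Num.max (- k) (Num.min k b)| <= `|a - b|.
Proof.
rewrite ler_norml => /andP[a1 a2].
have b1 := ler_norm (a - b); have b2 := ler_norm (- (a - b)); rewrite normrN in b2.
have [g1|g1] := leP k b; first by rewrite max_r ?ler_norml; [apply/andP; split; lra|lra].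
have [g2|g2] := leP (- k) b; first by [].
by rewrite ler_norml; apply/andP; split; lra.
Qed.

(** Continuous functions approximate the truncation h in L^1. Once they are clamped to the range of
    h, the squared error is at most 2 k times the L^1 error. *)
Lemma sqi_dense (f : R -> R) (e : R) : sqi f -> 0 < e ->
  exists c : R -> R, exists N K : R, [/\ continuous c,
    forall x, N < `|x| -> c x = 0, forall x, `|c x| <= K &
    \int[mu]_x (f x - c x) ^+ 2 < e].
Proof.
move=> sf e0; have e4 : 0 < e / 4 by lra.
have [n [h mh [h0 hn he]]] := sqi_truncate sf e4.
pose k : R := n%:R; have k0 : 0 <= k by exact: ler0n.
pose E : set R := `[- (k + 1), k + 1]%classic.
have hi : integ setT h by exact: (@integ_bounded_supp k k).
have mE : measurable E by exact: measurable_itv.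
have hE : integ E h by apply: integrableS hi.
have Efin : (mu E < +oo)%E.
  by rewrite lebesgue_measure_itv/=; case: ifP => // _; rewrite -EFinB ltry.
have [g_ [gc gi gl]] := approximation_continuous_integrable mE Efin hE.
(* Makes 2 k d <= e / 4; with the truncation error below e / 4, doubling the sum stays below e. The
   1 avoids dividing by zero when k = 0. *)
pose d := e / (8 * (k + 1)).
have d0 : 0 < d by rewrite divr_gt0//; lra.
have ghi m : integ E (fun x => `|h x - g_ m x|).
  by apply: integrable_norm => //; exact: integB.
have /cvgrPdist_lt/(_ d d0) [m _ /(_ m (leqnn m))] : \int[mu]_(x in E) `|h x - g_ m x| @[m --> \oo] --> (0 : R).
  by rewrite /Rintegral; apply: (@fine_cvg _ _ _ _ (fun m => \int[mu]_(x in E) `|(h x - g_ m x)%:E|)%E).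
rewrite sub0r normrN ger0_norm; last by apply: Rintegral_ge0.
move: (gc m) (gi m) (ghi m); move: (g_ m) => g cg ig ihg ge {g_ gc gi gl ghi}.
(* A cutoff equal to 1 where h may be nonzero. Beyond k, where h = 0, multiplying by it only brings
   the approximant closer to h. *)
pose chi (x : R) : R := Num.max 0 (Num.min 1 (k + 1 - `|x|)).
pose cl (x : R) : R := Num.max (- k) (Num.min k (g x)).
have cchi : continuous chi.
  apply: contMax; first exact: contC.
  apply: contMin; first exact: contC.
  by apply: contB; [exact: contC|exact: norm_continuous].
have ccl : continuous cl.
  apply: contMax; first exact: contC.
  by apply: contMin; [exact: contC|exact: cg].
have chi01 x : 0 <= chi x <= 1 by rewrite /chi le_max lexx/= ge_max ler01 ge_min lexx.
have chi1 x : `|x| <= k -> chi x = 1.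
  by move=> xk; rewrite /chi min_l ?max_r//; lra.
have chi0 x : k + 1 < `|x| -> chi x = 0.
  by move=> xk; rewrite /chi min_r ?max_l//; lra.
have clk x : `|cl x| <= k.
  by rewrite ler_norml /cl le_max lexx/= ge_max ge_min lexx/= andbT; lra.
have clh x (a : R) : `|a| <= k -> `|a - cl x| <= `|a - g x|.
  by move=> ak; exact: clamp_dist.
pose c x := cl x * chi x.
have c0 x : k + 1 < `|x| -> c x = 0 by move=> /chi0; rewrite /c => ->; rewrite mulr0.
have cc : continuous c by exact: contM.
have ck x : `|c x| <= k.
  rewrite /c normrM -[leRHS]mulr1; have /andP[? ?] := chi01 x.
  by rewrite ler_pM// ger0_norm.
exists c, (k + 1), k; split => //.
have mc : measurable_fun setT c by exact: continuous_mfun.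
have sc : sqi c by exact: (@sqi_bounded_supp (k + 1) k).
have sh : sqi h by exact: (@sqi_bounded_supp k k).
have -> : \int[mu]_x (f x - c x) ^+ 2 = \int[mu]_x ((f x - h x) + (h x - c x)) ^+ 2.
  by apply: eq_Rintegral => x _; congr (_ ^+ 2); ring.
apply: le_lt_trans (Rintegral_sqrD (sqiB sf sh) (sqiB sh sc)) _.
suff : \int[mu]_x (h x - c x) ^+ 2 <= 2 * k * \int[mu]_(x in E) `|h x - g x|.
  have : 2 * k * \int[mu]_(x in E) `|h x - g x| <= 2 * k * d by rewrite ler_wpM2l ?mulr_ge0// ltW.
  have : 2 * k * d <= e / 4.
    rewrite /d [leLHS](_ : _ = e / 4 * (k / (k + 1))); last by field; lra.
    rewrite -[leRHS]mulr1 ler_wpM2l//; first exact: ltW.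
    by rewrite ler_pdivrMr; lra.
  by lra.
have [_ shc] := sqiB sh sc.
rewrite [in leRHS]Rintegral_mkcond -RintegralZl//; last exact/integrable_patch.
apply: le_Rintegral => //; first by apply: integZl => //; exact/integrable_patch.
move=> x _; rewrite patchE; have [xk|xk] := lerP `|x| (k + 1); last first.
  by rewrite h0 ?c0//; [case: ifP => _; rewrite subrr expr0n/= mulr_ge0//; lra|rewrite -/k; lra].
rewrite ifT; last by rewrite inE /E /= in_itv/= -ler_norml.
have h1 : `|h x - c x| <= 2 * k.
  by apply: (le_trans (ler_normB _ _)); have := hn x; have := ck x; rewrite -/k; lra.
have h2 : `|h x - c x| <= `|h x - g x|.
  have [xk'|xk'] := lerP `|x| k; first by rewrite /c chi1// mulr1 clh// hn.
  rewrite h0// sub0r normrN /c normrM.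
  have /andP[? ?] := chi01 x.
  apply: (@le_trans _ _ (`|cl x| * 1)); first by apply: ler_pM => //; rewrite ger0_norm.
  by rewrite mulr1 -normrN -[X in `|X|]sub0r clh// normr0.
by rewrite -[leLHS]ger0_norm ?sqr_ge0// normrX expr2 ler_pM.
Qed.

(** The D n are additive and bounded on L^2 uniformly in n, so convergence to zero on a dense class
    spreads to all of L^2. *)
Lemma density_cvg (D : nat -> (R -> R) -> R -> R) (K : R) :
  (forall n f, sqi f -> sqi (D n f) /\
     \int[mu]_x D n f x ^+ 2 <= K * \int[mu]_x f x ^+ 2) ->
  (forall n f c x, sqi f -> sqi c -> D n (fun y => f y - c y) x = D n f x - D n c x) ->
  (forall (c : R -> R) (N B : R), continuous c -> (forall x, N < `|x| -> c x = 0) ->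
     (forall x, `|c x| <= B) -> \int[mu]_x D n c x ^+ 2 @[n --> \oo] --> (0 : R)) ->
  forall f, sqi f -> \int[mu]_x D n f x ^+ 2 @[n --> \oo] --> (0 : R).
Proof.
move=> DK DB Dc f sf; apply/cvgrPdist_lt => e e0.
have K1 : 0 < `|K| + 1 by have := normr_ge0 K; lra.
have d0 : 0 < e / (4 * (`|K| + 1)) by rewrite divr_gt0//; lra.
have [c [N [B [cc c0 cB ce]]]] := sqi_dense sf d0.
have sc : sqi c by apply: (@sqi_bounded_supp N B) => //; exact: continuous_mfun.
have e4 : 0 < e / 4 by lra.
have /cvgrPdist_lt/(_ _ e4) := Dc c N B cc c0 cB; apply: filterS => n.
rewrite !sub0r !normrN !ger0_norm ?sqr_int_ge0// => cn.
have [s1 b1] := DK n _ (sqiB sf sc); have [s2 _] := DK n _ sc.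
have -> : \int[mu]_x D n f x ^+ 2 = \int[mu]_x (D n (fun y => f y - c y) x + D n c x) ^+ 2.
  by apply: eq_Rintegral => x _; rewrite DB// subrK.
apply: le_lt_trans (Rintegral_sqrD s1 s2) _.
suff : K * \int[mu]_x (f x - c x) ^+ 2 <= e / 4 by lra.
have i0 := sqr_int_ge0 (fun x => f x - c x).
apply: (@le_trans _ _ ((`|K| + 1) * (e / (4 * (`|K| + 1))))).
  apply: (@le_trans _ _ ((`|K| + 1) * \int[mu]_x (f x - c x) ^+ 2)).
    by rewrite ler_wpM2r//; have := ler_norm K; lra.
  by rewrite ler_wpM2l// ltW.
by rewrite [leLHS](_ : _ = e / 4)//; field; rewrite gt_eqF.
Qed.

(** * Uniform L^2 bounds on difference quotients *)

Lemma xflow_dist t x : `|xflow t x - x| <= 2 * `|t|.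
Proof.
have [x0|x0] := leP 0 x; first by rewrite xflow_pos// flow_dist.
by rewrite (xflow_le0 t (ltW x0)) subrr normr0 mulr_ge0.
Qed.

Lemma cvg0_bound (a b : nat -> R) (l : R) : (forall n, `|a n - l| <= b n) ->
  b n @[n --> \oo] --> (0 : R) -> a n @[n --> \oo] --> l.
Proof.
move=> h b0; apply/subr_cvg0/norm_cvg0P; apply: squeeze_cvgr (cvg_cst 0) b0.
by apply: nearW => n; rewrite normr_ge0 h.
Qed.

Lemma cvg_sqr (a : nat -> R) (l : R) : a n @[n --> \oo] --> l ->
  a n ^+ 2 @[n --> \oo] --> l ^+ 2.
Proof. by move=> a_l; exact: (cvgM a_l a_l). Qed.

(** Cauchy-Schwarz: with L the length and I, J the integrals of f and f^2, integrating (L f - I)^2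
    >= 0 gives L (L J - I^2) >= 0. *)
Lemma sqr_Rintegral_le (a b : R) (f : R -> R) : a <= b -> sqi f ->
  (\int[mu]_(x in `[a, b]) f x) ^+ 2 <= (b - a) * \int[mu]_(x in `[a, b]) f x ^+ 2.
Proof.
rewrite le_eqVlt => /predU1P[->|ab] sf.
  by rewrite subrr mul0r set_itv1 Rintegral_set1 expr0n.
have [mf fi] := sf; have li := sqi_locint sf a b.
have L0 : 0 < b - a by rewrite subr_gt0.
have ci k : integ `[a, b] (fun=> k : R) by apply: continuous_locint; exact: contC.
have f2 : integ `[a, b] (fun x => f x ^+ 2) by apply: integrableS fi.
set L := b - a in L0 *; set I := \int[mu]_(x in _) f x; set J := \int[mu]_(x in _) _.
have muab : fine (mu `[a, b]) = L.
  by rewrite lebesgue_measure_itv/= lte_fin ab.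
have : 0 <= \int[mu]_(x in `[a, b]) (L ^+ 2 * f x ^+ 2 - 2 * L * I * f x + I ^+ 2).
  apply: Rintegral_ge0 => x _.
  by rewrite [X in 0 <= X](_ : _ = (L * f x - I) ^+ 2) ?sqr_ge0//; ring.
rewrite RintegralD//; last 1 first.
  by apply: integB => //; apply: integZl.
rewrite RintegralB//; [|exact: integZl..].
rewrite !RintegralZl// Rintegral_cst// muab -/I -/J => H.
have : 0 <= L * (L * J - I ^+ 2).
  by move: H; congr (_ <= _); ring.
by rewrite pmulr_rge0// subr_ge0.
Qed.

Lemma prim_diff (f : R -> R) (a b : R) : locint f -> a <= b ->
  prim f b - prim f a = \int[mu]_(x in `[a, b]) f x.
Proof. by move=> fl ab; have [] := ac_prim fl Logic.I Logic.I ab. Qed.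

Lemma Rintegral_subset (a b c d : R) (f : R -> R) : (forall x, 0 <= f x) ->
  integ setT f -> c <= a -> b <= d ->
  \int[mu]_(x in `[a, b]) f x <= \int[mu]_(x in `[c, d]) f x.
Proof.
move=> f0 fi ca bd; have i1 : integ `[a, b] f by exact: integrableS fi.
have i2 : integ `[c, d] f by exact: integrableS fi.
rewrite Rintegral_mkcond [leRHS]Rintegral_mkcond; apply: le_Rintegral => //.
- exact/integrable_patch.
- exact/integrable_patch.
move=> x _; rewrite !patchE; case: ifPn => xab; last by case: ifP.
rewrite ifT//; move: xab; rewrite !inE/= !in_itv/= => /andP[? ?]; lra.
Qed.

(** The window on the right depends on a and k but not on b, so the estimate can be integrated over
    a by Tonelli when b is the displaced point. *)
Lemma prim_diff_sqr (f : R -> R) (a b k : R) : sqi f -> `|b - a| <= k ->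
  (prim f b - prim f a) ^+ 2 <= k * \int[mu]_(x in `[a - k, a + k]) f x ^+ 2.
Proof.
move=> sf; have [_ fi] := sf; have fl := sqi_locint sf.
rewrite ler_norml => /andP[h1 h2].
have k0 : 0 <= k by lra.
have i0 (c d : R) : 0 <= \int[mu]_(x in `[c, d]) f x ^+ 2.
  by apply: Rintegral_ge0 => x _; exact: sqr_ge0.
have [ab|ba] := leP a b.
  rewrite (prim_diff fl ab); apply: (le_trans (sqr_Rintegral_le ab sf)).
  apply: ler_pM => //; first lra.
  by apply: Rintegral_subset => // [x||]; [exact: sqr_ge0|lra|lra].
rewrite -sqrrN opprB (prim_diff fl (ltW ba)); apply: (le_trans (sqr_Rintegral_le (ltW ba) sf)).
apply: ler_pM => //; [lra|lra|].
by apply: Rintegral_subset => // [x||]; [exact: sqr_ge0|lra|lra].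
Qed.

(** Tonelli: for fixed y, the points x with |y - x| <= k form an interval of length 2 k. *)
Lemma window_integral (r : R -> R) (k : R) : 0 <= k -> (forall x, 0 <= r x) ->
  integ setT r ->
  measurable_fun setT (fun x : R => \int[mu]_y (if `|y - x| <= k then r y else 0)%:E)%E /\
  (\int[mu]_x \int[mu]_y ((if `|y - x| <= k then r y else 0)%:E) =
    (2 * k * \int[mu]_y r y)%:E)%E.
Proof.
move=> k0 r0 ri; have /integrableP[/measurable_EFinP mr _] := ri.
pose G (z : R * R) : \bar R := (if `|z.2 - z.1| <= k then r z.2 else 0)%:E.
have mG : measurable_fun setT G.
  apply/measurable_EFinP; apply: measurable_fun_ifT => //.
    apply: measurable_fun_ler => //; apply: measurableT_comp => //.
    by apply: measurable_funB; [exact: measurable_snd|exact: measurable_fst].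
  by apply: measurableT_comp => //.
have G0 z : (0 <= G z)%E by rewrite /G lee_fin; case: ifP.
split; first exact: (@measurable_fun_fubini_tonelli_F _ _ _ _ _ mu G mG G0).
have := @fubini_tonelli _ _ _ _ _ mu mu G mG G0; rewrite /G/= => ->.
have -> : ((2 * k * \int[mu]_y r y)%:E = \int[mu]_y (2 * k * r y)%:E)%E.
  rewrite -RintegralZl// /Rintegral fineK//; apply: integrable_fin_num => //; exact: integZl.
apply: eq_integral => y _.
have -> : (\int[mu]_x (if `|y - x| <= k then r y else 0)%:E =
  \int[mu]_(x in `[(y - k)%R, (y + k)%R]) (r y)%:E)%E.
  rewrite [RHS]integral_mkcond; apply: eq_integral => x _; rewrite patchE.
  have -> : (x \in `[y - k, y + k]%classic) = (`|y - x| <= k); last by case: ifP.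
  by apply/idP/idP; rewrite inE/= in_itv/= ler_norml => /andP[? ?]; apply/andP; split; lra.
have muI : mu `[y - k, y + k] = (2 * k)%:E.
  rewrite lebesgue_measure_itv/= lte_fin.
  have [k1|k1] := ltP; first by rewrite -EFinB; congr EFin; ring.
  by have -> : k = 0; [lra|rewrite mulr0].
rewrite (_ : (2 * k * r y)%:E = ((r y)%:E * (2 * k)%:E)%E); last by rewrite -EFinM mulrC.
by rewrite -muI; exact: integral_cst.
Qed.

(** With displacement at most k = 2|t|, [prim_diff_sqr] and [window_integral] give the constant k (2
    k) / t^2 = 8, independent of t. *)
Lemma difference_quotient_bound (t : R) (f : R -> R) : t != 0 -> sqi f ->
  sqi (fun x => (prim f (xflow t x) - prim f x) / t) /\
  \int[mu]_x ((prim f (xflow t x) - prim f x) / t) ^+ 2 <= 8 * \int[mu]_x f x ^+ 2.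
Proof.
move=> t0 sf; have [mf fi] := sf; set q := fun x => _.
have aw := ac_prim (sqi_locint sf).
have mW : measurable_fun setT (prim f) by apply: continuous_mfun; exact: ac_continuous aw.
have mq : measurable_fun setT q.
  apply: measurable_funM => //; apply: measurable_funB => //.
  by apply: (measurableT_comp mW); exact: measurable_xflow.
pose k := 2 * `|t|; have k0 : 0 <= k by rewrite mulr_ge0.
have r0 x : 0 <= f x ^+ 2 by exact: sqr_ge0.
have [mw we] := window_integral k0 r0 fi.
pose C := k / t ^+ 2; have C0 : 0 <= C by rewrite divr_ge0 ?sqr_ge0.
have qle x : ((q x ^+ 2)%:E <= C%:E * \int[mu]_y (if `|y - x| <= k then f y ^+ 2 else 0)%:E)%E.
  have -> : (\int[mu]_y (if `|y - x| <= k then f y ^+ 2 else 0)%:E =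
    (\int[mu]_(y in `[x - k, x + k]) f y ^+ 2)%:E)%E.
    rewrite /Rintegral fineK; last by apply: integrable_fin_num => //; apply: integrableS fi.
    rewrite [RHS]integral_mkcond; apply: eq_integral => y _; rewrite patchE.
    have -> : (y \in `[x - k, x + k]%classic) = (`|y - x| <= k); last by case: ifP.
    by apply/idP/idP; rewrite inE/= in_itv/= ler_norml => /andP[? ?]; apply/andP; split; lra.
  rewrite -EFinM lee_fin /q exprMn exprVn /C [leRHS]mulrAC ler_wpM2r ?invr_ge0 ?sqr_ge0//.
  by apply: prim_diff_sqr => //; exact: xflow_dist.
have e8 : C * (2 * k * \int[mu]_x f x ^+ 2) = 8 * \int[mu]_x f x ^+ 2.
  rewrite /C /k -[t ^+ 2]ger0_norm ?sqr_ge0// normrX.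
  by field; rewrite normr_eq0.
have qE : (\int[mu]_x (q x ^+ 2)%:E <= (8 * \int[mu]_x f x ^+ 2)%:E)%E.
  rewrite -e8 EFinM -we -ge0_integralZl//; last 1 first.
    by move=> x _; apply: integral_ge0 => y _; rewrite lee_fin; case: ifP.
  apply: ge0_le_integral => //.
  - by move=> x _; rewrite lee_fin sqr_ge0.
  - by apply/measurable_EFinP; exact: measurable_funX.
  - exact: measurable_funeM.
have qi : integ setT (fun x => q x ^+ 2).
  apply/integrableP; split; first by apply/measurable_EFinP; exact: measurable_funX.
  under eq_integral do rewrite /= ger0_norm ?sqr_ge0//.
  by apply: le_lt_trans qE _; rewrite ltry.
split => //; rewrite -lee_fin /Rintegral [X in (X <= _)%E]fineK//.
exact: integrable_fin_num.
Qed.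

(** For either sign of t, (1 - e^(-t)) / t lies between 1 and e^(-t). *)
Lemma expN_bounds (t : R) : `|1 - expR (- t)| <= `|t| * expR `|t| /\
  (t != 0 -> `|(1 - expR (- t)) / t - 1| <= `|1 - expR (- t)|).
Proof.
have h1 : 1 + - t <= expR (- t) by exact: expR_ge1Dx.
have h2 : 1 + t <= expR t by exact: expR_ge1Dx.
have e0 := expR_gt0 (- t).
have h3 : t * expR (- t) <= 1 - expR (- t).
  have : (1 + t) * expR (- t) <= expR t * expR (- t) by rewrite ler_wpM2r// ltW.
  by rewrite -expRD subrr expR0; lra.
split=> [|t0].
  have t1 : 1 <= expR `|t| by rewrite -expR0 ler_expR.
  have t2 : expR (- t) <= expR `|t| by rewrite ler_expR -normrN ler_norm.
  case: (ger0P t) t1 t2 => tt t1 t2; rewrite ler_norml; apply/andP; split; nra.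
set r := (1 - expR (- t)) / t.
have rt : 1 - expR (- t) = r * t by rewrite /r divfK.
have [tt|tt] := ltP 0 t.
  have r1 : r <= 1 by rewrite -(ler_pM2r tt) -rt; lra.
  have r2 : expR (- t) <= r by rewrite -(ler_pM2r tt) -rt; lra.
  by rewrite ler0_norm ?subr_le0// ger0_norm; lra.
have {}tt : t < 0 by rewrite lt_neqAle t0.
have r1 : 1 <= r by rewrite -(ler_nM2r tt) -rt; lra.
have r2 : r <= expR (- t) by rewrite -(ler_nM2r tt) -rt; lra.
by rewrite ger0_norm ?subr_ge0// ler0_norm; lra.
Qed.

(* 1 - phi on the half-line: the speed of the flow. *)
Definition bfac (x : R) : R := if 0 <= x then 1 - expR (- x) else 0.

Lemma bfac01 x : 0 <= bfac x <= 1.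
Proof.
rewrite /bfac; case: ifP => x0; last by rewrite lexx ler01.
by have := expNle1 x0; have := expR_gt0 (- x); move=> *; apply/andP; split; lra.
Qed.

Lemma measurable_bfac : measurable_fun setT bfac.
Proof. by apply: measurable_ge0_if => //; apply: measurable_funB => //; exact: mexpN. Qed.

Lemma sqi_bfac (f : R -> R) : sqi f -> sqi (fun x => bfac x * f x) /\
  \int[mu]_x (bfac x * f x) ^+ 2 <= \int[mu]_x f x ^+ 2.
Proof.
move=> [mf fi].
have le x : (bfac x * f x) ^+ 2 <= f x ^+ 2.
  have /andP[? ?] := bfac01 x.
  by rewrite exprMn -[leRHS]mul1r ler_wpM2r ?sqr_ge0// -(expr1n _ 2) lerXn2r// nnegrE.
have m : measurable_fun setT (fun x => bfac x * f x).
  by apply: measurable_funM => //; exact: measurable_bfac.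
have i : integ setT (fun x => (bfac x * f x) ^+ 2).
  apply: (le_integrableR _ _ _ fi) => //; first exact: measurable_funX.
  by move=> x _; rewrite ger0_norm ?sqr_ge0.
by split => //; apply: le_Rintegral.
Qed.

Lemma is_derive_cvg (F : R -> R) (a l : R) (h : nat -> R) : is_derive a 1 F l ->
  (forall n, h n != 0) -> h n @[n --> \oo] --> (0 : R) ->
  (F (a + h n) - F a) / h n @[n --> \oo] --> l.
Proof.
move=> [/cvg_ex[l' dl]]; rewrite /derive (cvg_lim _ dl)// => <- hn h0.
have /cvgr_dnbhsP/(_ h) := dl => /(_ (conj hn h0)).
by under eq_fun do rewrite /= /GRing.scale/= mulr1 mulrC [X in F X]addrC.
Qed.

Lemma cvg_scale (k : R) (a : nat -> R) (l : R) : a n @[n --> \oo] --> l ->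
  k * a n @[n --> \oo] --> k * l.
Proof. exact: cvgMr. Qed.

(** * Limits along sequences of times tending to 0 *)

Section limits.
Context (h : nat -> R) (h_neq0 : forall n, h n != 0) (h_le1 : forall n, `|h n| <= 1)
  (h0 : h n @[n --> \oo] --> (0 : R)).

Let nh0 : `|h n| @[n --> \oo] --> (0 : R).
Proof. by rewrite -(normr0 R); exact: cvg_norm h0. Qed.

Lemma xflow_cvg x : xflow (h n) x @[n --> \oo] --> x.
Proof.
apply: (cvg0_bound (fun n => xflow_dist (h n) x)).
by rewrite -(mulr0 2); exact: cvgMr nh0.
Qed.

Lemma expNh_cvg : expR (- h n) @[n --> \oo] --> (1 : R).
Proof.
rewrite -expR0 -oppr0; apply: (@cvg_comp _ _ _ (fun n => - h n) (@expR R) _ _ _ (cvgN h0)).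
exact: continuous_expR.
Qed.

Lemma amp_cvg x : amp (h n) x @[n --> \oo] --> (1 : R).
Proof.
have -> : (1 : R) = 1 - (1 - 1) * expR (- x) by rewrite subrr mul0r subr0.
rewrite /amp; apply: cvgB; first exact: cvg_cst.
by apply: cvgMl; apply: cvgB; [exact: cvg_cst|exact: expNh_cvg].
Qed.

Lemma xdens_cvg x : xdens (h n) x @[n --> \oo] --> (1 : R).
Proof.
rewrite /xdens; case: (0 <= x); last exact: cvg_cst.
by rewrite -invr1; apply: cvgV; [rewrite oner_neq0|exact: amp_cvg].
Qed.

Let eh n : expR `|h n| <= expR 1. Proof. by rewrite ler_expR. Qed.

(** Strong continuity of transport with its Jacobian: [xdens] bounds the operators uniformly for |h|
    <= 1, and a compactly supported continuous function admits dominated convergence. *)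
Lemma transported_derivative_cvg (f : R -> R) : sqi f ->
  \int[mu]_x (f (xflow (h n) x) * xdens (h n) x - f x) ^+ 2 @[n --> \oo] --> (0 : R).
Proof.
move: f; apply: (@density_cvg (fun n f x => f (xflow (h n) x) * xdens (h n) x - f x)
  (2 * (expR 1 + 1))).
- move=> n f sf; have [s1 b1] := sqi_comp_xflow_dens (h n) sf.
  split; first exact: sqiB.
  apply: (le_trans (Rintegral_sqrD s1 (sqiN sf))).
  under [X in _ + X]eq_Rintegral do rewrite sqrrN.
  have i0 := sqr_int_ge0 f.
  have : expR `|h n| * \int[mu]_x f x ^+ 2 <= expR 1 * \int[mu]_x f x ^+ 2 by rewrite ler_wpM2r.
  by lra.
- by move=> n f c x _ _; ring.
move=> c N B cc c0 cB.
have mc : measurable_fun setT c by exact: continuous_mfun.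
have mC n : measurable_fun setT (fun x => c (xflow (h n) x) * xdens (h n) x - c x).
  apply: measurable_funB => //; apply: measurable_funM; last exact: measurable_xdens.
  by apply: (measurableT_comp mc); exact: measurable_xflow.
have -> : (0 : R) = \int[mu]_(x in setT) 0 by rewrite Rintegral_cst// mul0r.
(* The flow moves points by at most 2|h| <= 2, so everything vanishes outside [-(N + 2), N + 2]. *)
pose G : R -> R := (fun=> (B * expR 1 + B) ^+ 2) \_ `[- (N + 2), N + 2].
apply: (@Rintegral_dominated_cvg _ _ _ G) => //.
- by move=> n; exact: measurable_funX.
- move=> x _; have -> : (0 : R) = (c x * 1 - c x) ^+ 2 by rewrite mulr1 subrr expr0n.
  apply: cvg_sqr; apply: cvgB; last exact: cvg_cst.
  apply: cvgM; last exact: xdens_cvg.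
  by apply: continuous_cvg; [exact: cc|exact: xflow_cvg].
- by apply/integrable_patch => //; apply: continuous_locint; exact: contC.
move=> n x _; rewrite ger0_norm ?sqr_ge0// /G patchE.
have hd := xflow_dist (h n) x.
have h2 : 2 * `|h n| <= 2 by have := h_le1 n; lra.
case: ifPn => [_|]; last first.
  rewrite notin_setE/= in_itv/= -ler_norml => /negP; rewrite -ltNge => xN.
  rewrite !c0 ?mul0r ?subrr ?expr0n//; first by lra.
  have := ler_distD (xflow (h n) x) 0 x.
  by rewrite !sub0r !normrN; lra.
rewrite -[leLHS]ger0_norm ?sqr_ge0// normrX lerXn2r ?nnegrE//.
  by rewrite addr_ge0 ?mulr_ge0 ?expR_ge0// (le_trans _ (cB 0)).
apply: (le_trans (ler_normB _ _)); apply: lerD => //.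
rewrite normrM ler_pM// ger0_norm ?xdens_ge0//.
by have /andP[_ /le_trans->] := xdens_bounds (h n) x.
Qed.

(** Stated for primitives of L^2 functions, so that it is linear in f and density applies; with f =
    g it concerns u itself, by [prim_halfline]. *)
Lemma difference_quotient_cvg (f : R -> R) : sqi f ->
  \int[mu]_x ((prim f (xflow (h n) x) - prim f x) / h n - bfac x * f x) ^+ 2
     @[n --> \oo] --> (0 : R).
Proof.
(* 18 = 2 (8 + 1): 8 bounds the difference quotient, 1 the multiplication by [bfac], and 2 comes
   from [Rintegral_sqrD]. *)
move: f; apply: (@density_cvg
  (fun n f x => (prim f (xflow (h n) x) - prim f x) / h n - bfac x * f x) 18).
- move=> n f sf; have [s1 b1] := difference_quotient_bound (h_neq0 n) sf.
  have [s2 b2] := sqi_bfac sf.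
  split; first exact: sqiB.
  apply: (le_trans (Rintegral_sqrD s1 (sqiN s2))).
  under [X in _ + X]eq_Rintegral do rewrite sqrrN.
  by lra.
- move=> n f c x /sqi_locint fl /sqi_locint cl.
  have e y : prim (fun y => f y - c y) y = prim f y - prim c y.
    by rewrite /prim !RintegralB//; ring.
  by rewrite !e; ring.
move=> c N B cc c0 cB.
have B0 : 0 <= B by rewrite (le_trans _ (cB 0)).
have mc : measurable_fun setT c by exact: continuous_mfun.
have sc : sqi c by exact: (@sqi_bounded_supp N B).
have cl := sqi_locint sc.
have dq n x : x < 0 -> prim c (xflow (h n) x) - prim c x = 0.
  by move=> x0; rewrite xflow_le0 ?ltW// subrr.
have -> : (0 : R) = \int[mu]_(x in setT) 0 by rewrite Rintegral_cst// mul0r.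
(* [prim c] is B-Lipschitz and the displacement is at most 2|h|, so the quotient is at most 2 B; the
   other term is at most B. *)
pose G : R -> R := (fun=> (2 * B + B) ^+ 2) \_ `[- (N + 2), N + 2].
apply: (@Rintegral_dominated_cvg _ _ _ G) => //.
- move=> n; apply: measurable_funX.
  have [s1 _] := difference_quotient_bound (h_neq0 n) sc; have [s2 _] := sqi_bfac sc.
  by case: (sqiB s1 s2).
- move=> x _; have [x0|x0] := leP 0 x; last first.
    have -> : (fun n => ((prim c (xflow (h n) x) - prim c x) / h n - bfac x * c x) ^+ 2) = fun=> 0.
      apply/funext => n; rewrite dq// /bfac leNgt x0/= !mul0r subrr expr0n//.
    exact: cvg_cst.
  have -> : (0 : R) = ((1 - expR (- x)) * c x - bfac x * c x) ^+ 2.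
    by rewrite /bfac x0 subrr expr0n.
  apply: cvg_sqr; apply: cvgB; last exact: cvg_cst.
  have dp : is_derive (flow 0 x) 1 (prim c) (c x).
    by rewrite flow_0//; exact: prim_derive.
  have := @is_derive1_comp _ (prim c) (fun t => flow t x) 0 _ _ dp (flow_derive_t x0).
  rewrite mulrC => /is_derive_cvg /(_ h_neq0 h0).
  by under eq_fun do rewrite /= add0r flow_0// -(xflow_pos _ x0).
- by apply/integrable_patch => //; apply: continuous_locint; exact: contC.
move=> n x _; rewrite ger0_norm ?sqr_ge0// /G patchE.
have hd := xflow_dist (h n) x.
have h2 : 2 * `|h n| <= 2 by have := h_le1 n; lra.
have PB (a b : R) : a <= b -> `|prim c b - prim c a| <= B * (b - a).
  move=> ab; rewrite (prim_diff cl ab).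
  apply: le_trans; first exact: le_normr_Rintegral.
  have ci : integ `[a, b] (fun=> B) by apply: continuous_locint; exact: contC.
  apply: (@le_trans _ _ (\int[mu]_(y in `[a, b]) B)).
    by apply: le_Rintegral => //; exact: integrable_norm.
  rewrite Rintegral_cst//= lebesgue_measure_itv/= lte_fin.
  by case: ltP => // ba; rewrite /= mulr0 mulr_ge0// subr_ge0.
case: ifPn => [_|]; last first.
  rewrite notin_setE/= in_itv/= -ler_norml => /negP; rewrite -ltNge => xN.
  have [x0|x0] := leP 0 x; last by rewrite dq// /bfac (leNgt 0 x) x0/= !mul0r subrr expr0n.
  have P0 (a b : R) : a <= b -> N < a -> prim c b - prim c a = 0.
    move=> ab Na; rewrite (prim_diff cl ab) (@eq_Rintegral _ _ _ _ _ (fun=> 0)).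
      by rewrite Rintegral_cst// mul0r.
    move=> y; rewrite inE/= in_itv/= => /andP[ay _]; apply: c0.
    by apply: (lt_le_trans _ (ler_norm y)); lra.
  rewrite ger0_norm// in xN; move: hd; rewrite ler_norml => /andP[d1 d2].
  have -> : prim c (xflow (h n) x) - prim c x = 0.
    have [sx|sx] := leP x (xflow (h n) x); first by apply: P0 => //; lra.
    by rewrite -opprB (P0 _ _ (ltW sx)) ?oppr0//; lra.
  by rewrite c0 ?mulr0 ?mul0r ?subrr ?expr0n//= ger0_norm//; lra.
rewrite -[leLHS]ger0_norm ?sqr_ge0// normrX lerXn2r ?nnegrE//.
  by rewrite addr_ge0 ?mulr_ge0.
have hn0 : 0 < `|h n| by rewrite normr_gt0.
apply: (le_trans (ler_normB _ _)); apply: lerD; last first.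
  have /andP[b0 b1] := bfac01 x.
  by rewrite normrM -[leRHS]mul1r ler_pM// ger0_norm.
rewrite normrM normfV ler_pdivrMr//.
have [sx|sx] := leP x (xflow (h n) x).
  apply: (le_trans (PB _ _ sx)); rewrite ger0_norm ?subr_ge0// in hd.
  by rewrite [leRHS](_ : _ = B * (2 * `|h n|)) ?ler_wpM2l//; ring.
rewrite -normrN opprB; apply: (le_trans (PB _ _ (ltW sx))).
rewrite -normrN opprB ger0_norm ?subr_ge0 ?(ltW sx)// in hd.
by rewrite [leRHS](_ : _ = B * (2 * `|h n|)) ?ler_wpM2l//; ring.
Qed.

Context (u g : R -> R) (ug : halfline u g).
Local Notation M := (hbound u g).

Let aug : ac setT u g. Proof. by case: ug. Qed.
Let aw : ac setT (prim u) u.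
Proof. exact/ac_prim/continuous_locint/(ac_continuous aug). Qed.
Let cw : continuous (prim u). Proof. exact: ac_continuous aw. Qed.

Lemma prim_halfline : prim g = u.
Proof.
apply/funext => x; have -> := acP0 x aug.
by case: ug => _ _ _ u0 _; rewrite u0// add0r.
Qed.

Let b_cvg : `|1 - expR (- h n)| @[n --> \oo] --> (0 : R).
Proof.
rewrite -(normr0 R); apply: cvg_norm; rewrite -(subrr 1); apply: cvgB; first exact: cvg_cst.
exact: expNh_cvg.
Qed.

Lemma hdcorr_cvg : \int[mu]_x hdcorr u (h n) x ^+ 2 @[n --> \oo] --> (0 : R).
Proof.
(* From e^|h| + 1 + 2|h| <= e + 3 in [hdcorr_sqi]; the remaining factor 1 - e^(-h) drives the
   convergence. *)
pose K := M * (expR 1 + 3).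
pose J := 4 * K ^+ 2 * \int[mu]_x expw x.
apply: (@cvg0_bound _ (fun n => `|1 - expR (- h n)| ^+ 2 * J)); last first.
  have -> : (0 : R) = 0 ^+ 2 * J by rewrite expr0n mul0r.
  by apply: cvgMl; exact: cvg_sqr.
move=> n; rewrite subr0 ger0_norm ?sqr_int_ge0//.
have [[_ si] sb] := hdcorr_sqi ug (h n).
rewrite /J mulrA -RintegralZl//; last exact: expw_integ.
apply: le_Rintegral => //; first by apply: integZl => //; exact: expw_integ.
move=> x _; apply: (le_trans (sb x)); rewrite exprMn.
have w0 : 0 <= expw x by rewrite /expw; case: ifP => // _; exact: expR_ge0.
rewrite [leRHS](_ : _ = 4 * (`|1 - expR (- h n)| ^+ 2 * K ^+ 2) * expw x); last ring.
rewrite ler_wpM2r// ler_wpM2l// ler_wpM2l ?sqr_ge0// lerXn2r ?nnegrE ?mulr_ge0 ?hbound_ge0//.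
rewrite ler_wpM2l ?hbound_ge0//; have := eh n; have := h_le1 n; lra.
Qed.

Lemma hcorr_quotient_cvg : \int[mu]_x (hcorr u (h n) x / h n - expR (- x) * prim u x) ^+ 2
  @[n --> \oo] --> (0 : R).
Proof.
(* From (a - b)^2 <= 2 (a^2 + b^2) and a weighted bound for each term, using |1 - e^(-h)| <= |h| e
   and 1 + 2|h| <= 3. *)
pose C := 2 * (4 * (expR 1 * (M * 3)) ^+ 2 + 4 * M ^+ 2).
have mW : measurable_fun setT (prim u) by exact: continuous_mfun.
have mEW : measurable_fun setT (fun x : R => expR (- x) * prim u x).
  by apply: measurable_funM => //; exact: mexpN.
have w0 x : 0 <= expw x by rewrite /expw; case: ifP => // _; exact: expR_ge0.
have -> : (0 : R) = \int[mu]_(x in setT) 0 by rewrite Rintegral_cst// mul0r.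
apply: (@Rintegral_dominated_cvg _ _ _ (fun x => C * expw x)) => //.
- move=> n; apply: measurable_funX; apply: measurable_funB => //.
  by apply: measurable_funM => //; case: (hcorr_sqi ug (h n)) => [[]].
- move=> x _.
  have -> : (0 : R) = (1 * expR (- x) * prim u x - expR (- x) * prim u x) ^+ 2.
    by rewrite mul1r subrr expr0n.
  apply: cvg_sqr; apply: cvgB; last exact: cvg_cst.
  rewrite /hcorr; under eq_fun do rewrite mulrAC [_ / h _]mulrAC.
  apply: cvgM; last by apply: continuous_cvg; [exact: cw|exact: xflow_cvg].
  apply: cvgMl; apply: (cvg0_bound _ b_cvg) => n.
  by have [_] := expN_bounds (h n); apply.
- by apply: integZl => //; exact: expw_integ.
move=> n x _; rewrite ger0_norm ?sqr_ge0//.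
have h1 : (hcorr u (h n) x / h n) ^+ 2 <= 4 * (expR 1 * (M * 3)) ^+ 2 * expw x.
  have [_ /(_ x) sb] := hcorr_sqi ug (h n).
  have hn0 : 0 < h n ^+ 2 by rewrite exprn_even_gt0//= h_neq0.
  rewrite exprMn exprVn ler_pdivrMr//; apply: (le_trans sb).
  rewrite [leRHS](_ : _ = 4 * (`|h n| * expR 1 * (M * 3)) ^+ 2 * expw x); last first.
    by rewrite !exprMn -normrX ger0_norm ?sqr_ge0//; ring.
  rewrite ler_wpM2r// ler_wpM2l// lerXn2r ?nnegrE ?mulr_ge0 ?hbound_ge0 ?expR_ge0//.
  apply: ler_pM; rewrite ?mulr_ge0 ?hbound_ge0//.
    have [+ _] := expN_bounds (h n) => /le_trans; apply.
    by rewrite ler_wpM2l.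
  by rewrite ler_wpM2l ?hbound_ge0//; have := h_le1 n; lra.
have h2 : (expR (- x) * prim u x) ^+ 2 <= 4 * M ^+ 2 * expw x.
  have [x0|x0] := leP 0 x.
    apply: weight_bound => //; rewrite normrM ger0_norm ?expR_ge0// mulrCA ler_wpM2l ?expR_ge0//.
    apply: (le_trans (halfline_prim_bounded ug x0)).
    by rewrite ler_wpM2l ?hbound_ge0//; lra.
  by rewrite (halfline_prim0 ug (ltW x0)) mulr0 expr0n mulr_ge0// mulr_ge0 ?sqr_ge0.
have := sqr_ge0 (hcorr u (h n) x / h n + expR (- x) * prim u x).
rewrite /C; move: h1 h2; move: (_ / _) (_ * prim u x) => a b h1 h2.
rewrite !expr2 in h1 h2 *; lra.
Qed.

(** This function is the generator applied to u: on x > 0 it is A u as the overview gives it, since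
    u(0) = 0. *)
Lemma sqi_gen : sqi (fun x => bfac x * g x + expR (- x) * prim u x).
Proof.
have [_ su sg _ _] := ug; apply: sqiD; first exact: (sqi_bfac sg).1.
have [] // := @weight_sqi (fun x => expR (- x) * prim u x) M.
- by apply: measurable_funM; [exact: mexpN|exact: continuous_mfun].
- by move=> x /ltW x0; rewrite (halfline_prim0 ug x0) mulr0.
- move=> x x0; rewrite normrM ger0_norm ?expR_ge0// mulrCA ler_wpM2l ?expR_ge0//.
  apply: (le_trans (halfline_prim_bounded ug x0)).
  by rewrite ler_wpM2l ?hbound_ge0//; lra.
Qed.

Lemma hdsol_cvg : \int[mu]_x (hdsol u g (h n) x - g x) ^+ 2 @[n --> \oo] --> (0 : R).
Proof.
have [_ su sg _ _] := ug.
have s1 n := sqiB (sqi_comp_xflow_dens (h n) sg).1 sg.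
have s2 n := (hdcorr_sqi ug (h n)).1.
have := @cvg_scale 2 _ _ (cvgD (transported_derivative_cvg sg) hdcorr_cvg); rewrite addr0 mulr0.
move=> L; apply: (cvg0_bound _ (L _)) => n.
rewrite subr0 ger0_norm ?sqr_int_ge0//; apply: le_trans (Rintegral_sqrD (s1 n) (s2 n)).
rewrite le_eqVlt; apply/orP; left; apply/eqP; apply: eq_Rintegral => x _.
by congr (_ ^+ 2); rewrite /hdsol /hdcorr; ring.
Qed.

(** As u is the primitive of g, the transported part is [difference_quotient_cvg] for g; the
    correction gives the nonlocal term. *)
Lemma hsol_quotient_cvg :
  \int[mu]_x ((hsol u (h n) x - u x) / h n - (bfac x * g x + expR (- x) * prim u x)) ^+ 2
    @[n --> \oo] --> (0 : R).
Proof.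
have [_ su sg _ _] := ug.
have s1 n := sqiB (difference_quotient_bound (h_neq0 n) sg).1 (sqi_bfac sg).1.
have s2 n : sqi (fun x => hcorr u (h n) x / h n - expR (- x) * prim u x).
  have := sqiB sqi_gen (sqi_bfac sg).1.
  under eq_fun do rewrite addrC addKr.
  apply: sqiB; have := sqiZ (h n)^-1 (hcorr_sqi ug (h n)).1.
  by under eq_fun do rewrite mulrC.
have := @cvg_scale 2 _ _ (cvgD (difference_quotient_cvg sg) hcorr_quotient_cvg); rewrite addr0 mulr0.
move=> L; apply: (cvg0_bound _ (L _)) => n.
rewrite subr0 ger0_norm ?sqr_int_ge0//; apply: le_trans (Rintegral_sqrD (s1 n) (s2 n)).
rewrite le_eqVlt; apply/orP; left; apply/eqP; apply: eq_Rintegral => x _.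
by congr (_ ^+ 2); rewrite /hsol /hcorr prim_halfline; ring.
Qed.

(** Differentiability implies continuity: the difference is h times a quotient bounded in L^2. *)
Lemma hsol_cvg : \int[mu]_x (hsol u (h n) x - u x) ^+ 2 @[n --> \oo] --> (0 : R).
Proof.
have [_ su sg _ _] := ug; set A := fun x => bfac x * g x + expR (- x) * prim u x.
have sA : sqi A by exact: sqi_gen.
have s1 n : sqi (fun x => (hsol u (h n) x - u x) / h n - A x).
  apply: sqiB => //; have [_ sh _ _ _] := halfline_hsol ug (h n).
  have := sqiZ (h n)^-1 (sqiB sh su).
  by under eq_fun do rewrite mulrC.
have := cvgM (cvg_sqr h0) (@cvg_scale 2 _ _ (cvgD hsol_quotient_cvg (cvg_cst (\int[mu]_x A x ^+ 2)))).
rewrite expr0n mul0r => L; apply: (cvg0_bound _ (L _ _ _)) => n.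
rewrite subr0 ger0_norm ?sqr_int_ge0//.
apply: (@le_trans _ _ (h n ^+ 2 * \int[mu]_x ((hsol u (h n) x - u x) / h n - A x + A x) ^+ 2)).
  have [_ si] := sqiD (s1 n) sA.
  rewrite -RintegralZl// le_eqVlt; apply/orP; left; apply/eqP; apply: eq_Rintegral => x _.
  by rewrite -exprMn; congr (_ ^+ 2); field.
by rewrite ler_wpM2l ?sqr_ge0//; exact: Rintegral_sqrD.
Qed.
End limits.

(** * The linearized operator *)

Lemma phi_ge0 (x : R) : 0 <= x -> phi x = expR (- x).
Proof. by move=> x0; rewrite /phi ger0_norm. Qed.

Lemma phi_le0 (x : R) : x <= 0 -> phi x = expR x.
Proof. by move=> x0; rewrite /phi ler0_norm// opprK. Qed.

Lemma dphi_gt0 (x : R) : 0 < x -> dphi x = - expR (- x).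
Proof. by move=> x0; rewrite /dphi gtr0_sg// gtr0_norm// mulN1r. Qed.

Lemma dphi_lt0 (x : R) : x < 0 -> dphi x = expR x.
Proof. by move=> x0; rewrite /dphi ltr0_sg// ltr0_norm// opprK mul1r opprK. Qed.

Lemma dphi_0 : dphi (0 : R) = 0.
Proof. by rewrite /dphi sgr0 oppr0 mul0r. Qed.

Lemma phi_continuous : continuous (phi : R -> R).
Proof.
move=> x; apply: continuous_cvg; first exact: continuous_expR.
by apply: cvgN; exact: norm_continuous.
Qed.

Lemma phi_gt0 (x : R) : 0 < phi x. Proof. exact: expR_gt0. Qed.

Lemma phi_le1 (x : R) : phi x <= 1.
Proof. exact: expNle1. Qed.

Lemma dphi_norm (x : R) : `|dphi x| <= phi x.
Proof.
have [x0|x0|->] := ltgtP x 0; last by rewrite dphi_0 normr0 ltW// phi_gt0.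
  by rewrite dphi_lt0// (phi_le0 (ltW x0)) ger0_norm// expR_ge0.
by rewrite dphi_gt0// (phi_ge0 (ltW x0)) normrN ger0_norm// expR_ge0.
Qed.

Lemma measurable_dphi : measurable_fun setT (dphi : R -> R).
Proof.
have mp : measurable_fun setT (phi : R -> R) by apply: continuous_mfun; exact: phi_continuous.
have -> : dphi = fun x : R => if 0 <= x then (if x <= 0 then 0 else - phi x) else phi x.
  apply/funext => x; have [x0|x0|->] := ltgtP x 0; last by rewrite dphi_0.
    by rewrite dphi_lt0// (phi_le0 (ltW x0)).
  by rewrite dphi_gt0// (phi_ge0 (ltW x0)).
apply: (@measurable_ge0_if (fun x : R => if x <= 0 then 0 else - phi x) phi) => //.
apply: measurable_fun_ifT => //; last exact: measurable_funN.
exact: measurable_fun_ler.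
Qed.

Lemma phi_integ : integ setT (phi : R -> R).
Proof.
have mp : measurable_fun setT (phi : R -> R) by apply: continuous_mfun; exact: phi_continuous.
have mw : measurable_fun setT expw by have /integrableP[/measurable_EFinP] := expw_integ.
have wi : integ setT (fun x => expw (- x)).
  have mo : measurable_fun setT (fun x : R => expw (- x)) by exact: measurableT_comp.
  have [] // := @Rintegral_opp setT (fun x => expw (- x)) measurableT mo.
  rewrite preimage_setT; under eq_fun do rewrite opprK; exact: expw_integ.
apply: (@le_integrableR _ _ (fun x => expw x + expw (- x))) => //.
- move=> x _; rewrite ger0_norm; last exact: ltW (phi_gt0 x).
  have w0 y : 0 <= expw y by rewrite /expw; case: ifP => // _; exact: expR_ge0.
  have [x0|x0] := leP 0 x; first by rewrite phi_ge0// {1}/expw x0 lerDl.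
  rewrite (phi_le0 (ltW x0)) [in X in _ + X]/expw oppr_ge0 (ltW x0) opprK lerDr//.
- by apply: integD => //; exact: expw_integ.
Qed.

Lemma sqi_phi : sqi (phi : R -> R).
Proof.
have mp : measurable_fun setT (phi : R -> R) by apply: continuous_mfun; exact: phi_continuous.
split => //; apply: (@le_integrableR _ _ phi) => //; [exact: measurable_funX| |exact: phi_integ].
move=> x _; rewrite ger0_norm ?sqr_ge0// expr2 -[leRHS]mul1r.
by rewrite ler_wpM2r ?phi_le1// ltW// phi_gt0.
Qed.

(** Increments of v^2 are integrals of 2 v g, bounded by the squared H^1 norm; then |v| <= 1 +
    v^2. *)
Lemma ac_bounded (v g : R -> R) : sqi v -> sqi g -> ac setT v g ->
  exists M, forall x, `|v x| <= M.
Proof.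
move=> sv sg ag; pose S := \int[mu]_x (v x ^+ 2 + g x ^+ 2).
have iS : integ setT (fun x => v x ^+ 2 + g x ^+ 2) by exact: sqr_sum_integ.
have sq0 x : 0 <= v x ^+ 2 + g x ^+ 2 by rewrite addr_ge0 ?sqr_ge0.
have S0 : 0 <= S by apply: Rintegral_ge0.
have B (a b : R) : a <= b -> `|v b ^+ 2 - v a ^+ 2| <= S.
  move=> ab; have [i e] := (ac_mul (fun a b _ _ _ _ => Logic.I) ag ag) a b Logic.I Logic.I ab.
  rewrite !expr2 e; apply: le_trans; first exact: le_normr_Rintegral.
  apply: (@le_trans _ _ (\int[mu]_(y in `[a, b]) (v y ^+ 2 + g y ^+ 2))).
    apply: le_Rintegral => //; [exact: integrable_norm|by apply: integrableS iS|].
    move=> y _; have h1 := sqr_ge0 (v y - g y); have h2 := sqr_ge0 (v y + g y).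
    by rewrite !expr2 in h1 h2 *; rewrite ler_norml; apply/andP; split; lra.
  rewrite Rintegral_mkcond; apply: le_Rintegral => //.
    by apply/integrable_patch => //; apply: integrableS iS.
  by move=> y _; rewrite patchE; case: ifP.
exists (1 + v 0 ^+ 2 + S) => x.
have h : `|v x ^+ 2 - v 0 ^+ 2| <= S.
  by have [x0|x0] := leP 0 x; [exact: B|rewrite -normrN opprB; apply: B; exact: ltW].
move: h; rewrite ler_norml => /andP[_ h].
have hx : `|v x| <= 1 + v x ^+ 2.
  have h1 := sqr_ge0 (v x - 1); have h2 := sqr_ge0 (v x + 1); have h3 := sqr_ge0 (v x).
  by rewrite !expr2 in h1 h2 h3 *; rewrite ler_norml; apply/andP; split; lra.
by have := sqr_ge0 (v 0); lra.
Qed.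

Lemma exp_decay (K : R) (a : nat -> R) : (forall n, `|a n| <= K * expR (- n%:R)) ->
  a n @[n --> \oo] --> (0 : R).
Proof.
move=> aK; have L := cvg_scale exp_linear_cvg0 : K * _ @[n --> \oo] --> K * 0.
rewrite mulr0 in L; apply: (cvg0_bound _ L) => n; rewrite subr0.
apply: (le_trans (aK n)); have K0 : 0 <= K.
  by have := le_trans (normr_ge0 _) (aK n); rewrite pmulr_lge0// expR_gt0.
rewrite ler_wpM2l// -[leLHS]mulr1 ler_wpM2l ?expR_ge0//.
by have := ler0n R n; lra.
Qed.

Lemma Rintegral_split (f : R -> R) (a b : R) : a <= b -> integ setT f ->
  \int[mu]_x f x = \int[mu]_(x in `]-oo, a]) f x + \int[mu]_(x in `[a, b]) f x
    + \int[mu]_(x in `[b, +oo[) f x.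
Proof.
move=> ab fi; have iD (D : set R) : measurable D -> integ D f.
  by move=> mD; apply: integrableS fi.
have e1 := @Rintegral_itvB _ f -oo%O +oo%O a (iD _ (measurable_itv _)) isT isT.
have e2 := @Rintegral_itvB _ f (BLeft a) +oo%O b (iD _ (measurable_itv _)) ab isT.
rewrite Rintegral_itv_obnd_cbnd in e1; last exact: iD.
rewrite Rintegral_itv_obnd_cbnd in e2; last exact: iD.
by rewrite -set_itvNyy -e2 -e1; ring.
Qed.

Lemma ac_exp (c : R) : ac setT (fun y => expR (c * y)) (fun y => c * expR (c * y)).
Proof.
have d (y : R) : is_derive y 1 (fun y => expR (c * y)) (c * expR (c * y)).
  have := @is_derive1_comp _ (@expR R) (fun y : R => c * y) y (expR (c * y)) c _ _.
  rewrite (mulrC (expR _) c); apply.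
  have := @is_deriveZ _ _ _ (fun y : R => y) c y 1 1 _.
  by rewrite /GRing.scale/= mulr1; apply.
apply: ac_C1 => // y _.
by apply: cvgM; [exact: cvg_cst|exact: (is_derive_continuous (d y))].
Qed.

Lemma sqi_phiM (f : R -> R) : sqi f -> integ setT (fun x => phi x * f x).
Proof.
move=> [mf fi]; have [mp pi] := sqi_phi.
apply: (@le_integrableR _ _ (fun x => phi x ^+ 2 + f x ^+ 2)) => //.
- exact: measurable_funM.
- move=> x _; have h1 := sqr_ge0 (phi x - f x); have h2 := sqr_ge0 (phi x + f x).
  by rewrite !expr2 in h1 h2 *; rewrite ler_norml; apply/andP; split; lra.
- exact: integD.
Qed.

Section nonlocal_term.
Context (v g : R -> R) (sv : sqi v) (sg : sqi g) (ag : ac setT v g).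

Let cnv x y := dphi (x - y) * (phi y * v y + 2^-1 * (dphi y * g y)).
Let iT : is_interval (@setT R). Proof. by []. Qed.

Lemma measurable_cnv x : measurable_fun setT (cnv x).
Proof.
have [mv _] := sv; have [mg _] := sg; have [mp _] := sqi_phi; have md := measurable_dphi.
apply: measurable_funM.
  by apply: (measurableT_comp md); exact: measurable_funB.
apply: measurable_funD; first exact: measurable_funM.
by apply: measurable_funM => //; exact: measurable_funM.
Qed.

Lemma cnv_integ x : integ setT (cnv x).
Proof.
apply: (@le_integrableR _ _ (fun y => `|phi y * v y| + `|phi y * g y|)) => //.
- exact: measurable_cnv.
- move=> y _; rewrite /cnv normrM.
  have h1 : `|dphi (x - y)| <= 1 by apply: (le_trans (dphi_norm _)); exact: phi_le1.
  have h2 : `|dphi y * g y| <= `|phi y * g y|.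
    by rewrite (normrM (dphi y)) (normrM (phi y)) ler_wpM2r// (ger0_norm (ltW (phi_gt0 y))); exact: dphi_norm.
  apply: (@le_trans _ _ (1 * `|phi y * v y + 2^-1 * (dphi y * g y)|)).
    by rewrite ler_wpM2r.
  rewrite mul1r; apply: (le_trans (ler_normD _ _)); rewrite lerD2l normrM ger0_norm//.
  by apply: le_trans h2; have := normr_ge0 (dphi y * g y); lra.
- by apply: integD => //; apply: integrable_norm => //; exact: sqi_phiM.
Qed.

Let exp_bounded (K c : R) : exists C, forall y, `|K * (expR (c * y) * v y)| <= C * expR (c * y).
Proof.
have [M hM] := ac_bounded sv sg ag; exists (`|K| * M) => y.
rewrite !normrM (ger0_norm (expR_ge0 _)) -[leRHS]mulrA ler_wpM2l// mulrC.
by rewrite ler_wpM2r ?expR_ge0.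
Qed.

(** [dphi] jumps at 0, so closed forms of the integrand are required only off y = 0 and y = x, a
    null set. *)
Lemma ac_cnv (D : set R) (F F' : R -> R) x : is_interval D -> measurable D ->
  ac setT F F' -> (forall y, D y -> y != 0 -> y != x -> cnv x y = F' y) ->
  ac D F (cnv x).
Proof.
move=> iD mD aF h.
apply: (@ac_ae D F F F') => //; first by apply: measurable_funTS; exact: measurable_cnv.
  have nb (z : R) : mu.-negligible [set z].
    by exists [set z]; split; [exact: measurable_set1|exact: lebesgue_measure_set1|].
  apply: (negligibleS _ (negligibleU (nb 0) (nb x))).
  move=> y /= hy; apply: contra_notP hy => /not_orP[y0 yx] Dy; apply/esym/h => //.
    exact/eqP.
  exact/eqP.
exact: (ac_sub _ aF).
Qed.

(** To the left of both 0 and x the exponentials combine to e^(2y), and the integrand is K times the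
    derivative of e^(2y) v. The term at minus infinity vanishes because v is bounded. *)
Lemma cnv_integral_le (x p K : R) :
  (forall y, y < p -> y != 0 -> y != x ->
     cnv x y = K * (2 * expR (2 * y) * v y + expR (2 * y) * g y)) ->
  p = 0 \/ p = x ->
  \int[mu]_(y in `]-oo, p]) cnv x y = K * (expR (2 * p) * v p).
Proof.
move=> h p0x; have aK := acZ K (ac_mul iT (ac_exp 2) ag).
have aF : ac [set y | y <= p] (fun y => K * (expR (2 * y) * v y)) (cnv x).
  apply: (ac_cnv _ _ aK).
  - by move=> a b /= _ bp z /andP[_ zb]; exact: le_trans bp.
  - by rewrite -set_itvNyc; exact: measurable_itv.
  - move=> y /=; rewrite le_eqVlt => /predU1P[->|yp y0 yx]; last exact: h.
    by case: p0x => ->; rewrite eqxx.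
have [C hC] := exp_bounded K 2.
rewrite (@ac_integral_le _ _ p 0 aF) ?subr0//; first by apply: integrableS (cnv_integ x).
apply: (@exp_decay C) => n; apply: (le_trans (hC _)).
have C0 : 0 <= C by have := le_trans (normr_ge0 _) (hC 0); rewrite pmulr_lge0// expR_gt0.
by rewrite ler_wpM2l// ler_expR; have := ler0n R n; lra.
Qed.

Lemma cnv_integral_ge (x p K : R) :
  (forall y, p < y -> y != 0 -> y != x ->
     cnv x y = K * (- 2 * expR (- 2 * y) * v y + expR (- 2 * y) * g y)) ->
  p = 0 \/ p = x ->
  \int[mu]_(y in `[p, +oo[) cnv x y = - (K * (expR (- 2 * p) * v p)).
Proof.
move=> h p0x; have aK := acZ K (ac_mul iT (ac_exp (- 2)) ag).
have aF : ac [set y | p <= y] (fun y => K * (expR (- 2 * y) * v y)) (cnv x).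
  apply: (ac_cnv _ _ aK).
  - by move=> a b /= pa _ z /andP[az _]; exact: le_trans az.
  - by rewrite -set_itvcy; exact: measurable_itv.
  - move=> y /=; rewrite le_eqVlt => /predU1P[<-|yp y0 yx]; last exact: h.
    by case: p0x => ->; rewrite eqxx.
have [C hC] := exp_bounded K (- 2).
rewrite (@ac_integral_ge _ _ p 0 aF) ?sub0r//; first by apply: integrableS (cnv_integ x).
apply: (@exp_decay C) => n; apply: (le_trans (hC _)).
have C0 : 0 <= C by have := le_trans (normr_ge0 _) (hC 0); rewrite pmulr_lge0// expR_gt0.
by rewrite ler_wpM2l// ler_expR; have := ler0n R n; lra.
Qed.

(** The integrand is exact on the two outer intervals. Between 0 and x the product of the two
    exponentials does not depend on y, so the middle interval contributes multiples of [prim v] and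
    of the increment of v. *)
Lemma convolution_dphi x : x != 0 ->
  \int[mu]_y cnv x y = v 0 * dphi x - phi x * prim v x - dphi x * v x.
Proof.
have av : ac setT (prim v) v by apply: ac_prim; exact: sqi_locint.
have mid (a b K L : R) : a <= b -> (a = 0 /\ b = x) \/ (a = x /\ b = 0) ->
    (forall y, a < y -> y < b -> cnv x y = K * v y + L * g y) ->
    \int[mu]_(y in `[a, b]) cnv x y = K * prim v b + L * v b - (K * prim v a + L * v a).
  move=> ab abx h; have aF := acD (acZ K av) (acZ L ag).
  have aG : ac `[a, b] (fun y => K * prim v y + L * v y) (cnv x).
    apply: (ac_cnv _ _ aF) => //; first exact: interval_is_interval.
    move=> y /=; rewrite in_itv/= => /andP[]; rewrite le_eqVlt => /predU1P[<-|ay].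
      by case: abx => -[-> ->]; rewrite eqxx.
    rewrite le_eqVlt => /predU1P[->|yb]; first by case: abx => -[_ ->]; rewrite eqxx.
    by move=> _ _; exact: h.
  have Da : `[a, b]%classic a by rewrite /= in_itv/= lexx.
  have Db : `[a, b]%classic b by rewrite /= in_itv/= lexx ab.
  by have [_ ->] := aG a b Da Db ab.
have E0 : expR (0 : R) = 1 by exact: expR0.
have E2 (y : R) : expR (2 * y) = expR y * expR y by rewrite -expRD; congr expR; ring.
have EN2 (y : R) : expR (- 2 * y) = expR (- y) * expR (- y) by rewrite -expRD; congr expR; ring.
have EE (y : R) : expR y * expR (- y) = 1 by rewrite -expRD subrr expR0.
have ED (y : R) : expR (x - y) = expR x * expR (- y) by rewrite expRD.
have ED' (y : R) : expR (- (x - y)) = expR y * expR (- x) by rewrite opprB expRD.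
have V := EE x.
rewrite neq_lt => /orP[x0|x0].
  have h1 y : y < x -> y != 0 -> y != x ->
      cnv x y = - (2^-1 * expR (- x)) * (2 * expR (2 * y) * v y + expR (2 * y) * g y).
    move=> yx _ _; rewrite /cnv dphi_gt0 ?subr_gt0// ED' phi_le0; last lra.
    by rewrite dphi_lt0; [rewrite E2; field|lra].
  have h2 y : x < y -> y < 0 -> cnv x y = expR x * v y + 2^-1 * expR x * g y.
    move=> xy y0; rewrite /cnv dphi_lt0 ?subr_lt0// ED phi_le0 ?ltW// dphi_lt0//.
    rewrite [LHS](_ : _ = (expR y * expR (- y)) * (expR x * v y + 2^-1 * expR x * g y)); last by field.
    by rewrite EE mul1r.
  have h3 y : 0 < y -> y != 0 -> y != x ->
      cnv x y = 2^-1 * expR x * (- 2 * expR (- 2 * y) * v y + expR (- 2 * y) * g y) * -1.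
    move=> y0 _ _; rewrite /cnv dphi_lt0; last lra.
    by rewrite ED phi_ge0 ?ltW// dphi_gt0// EN2; field.
  have h3' y : 0 < y -> y != 0 -> y != x ->
      cnv x y = - (2^-1 * expR x) * (- 2 * expR (- 2 * y) * v y + expR (- 2 * y) * g y).
    by move=> y0 y1 y2; rewrite h3//; ring.
  rewrite (Rintegral_split (ltW x0) (cnv_integ x)).
  rewrite (cnv_integral_le h1 (or_intror erefl)) (cnv_integral_ge h3' (or_introl erefl)).
  rewrite (mid _ _ _ _ (ltW x0) (or_intror (conj erefl erefl)) h2).
  rewrite prim0 !mulr0 E0 E2 dphi_lt0// (phi_le0 (ltW x0)).
  move: V; move: (expR x) (expR (- x)) => a b V.
  rewrite [- _ * (a * a * _)](_ : _ = - (2^-1 * (a * b) * a * v x)); last ring.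
  by rewrite V; field.
have h1 y : y < 0 -> y != 0 -> y != x ->
    cnv x y = - (2^-1 * expR (- x)) * (2 * expR (2 * y) * v y + expR (2 * y) * g y).
  move=> y0 _ _; rewrite /cnv dphi_gt0; last lra.
  by rewrite ED' phi_le0 ?ltW// dphi_lt0// E2; field.
have h2 y : 0 < y -> y < x -> cnv x y = - expR (- x) * v y + 2^-1 * expR (- x) * g y.
  move=> y0 yx; rewrite /cnv dphi_gt0 ?subr_gt0// ED' phi_ge0 ?ltW// dphi_gt0//.
  rewrite [LHS](_ : _ = (expR y * expR (- y)) * (- expR (- x) * v y + 2^-1 * expR (- x) * g y)); last by field.
  by rewrite EE mul1r.
have h3 y : x < y -> y != 0 -> y != x ->
    cnv x y = - (2^-1 * expR x) * (- 2 * expR (- 2 * y) * v y + expR (- 2 * y) * g y).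
  move=> xy _ _; rewrite /cnv dphi_lt0; last lra.
  by rewrite ED phi_ge0; [rewrite dphi_gt0; [rewrite EN2; field|lra]|lra].
rewrite (Rintegral_split (ltW x0) (cnv_integ x)).
rewrite (cnv_integral_le h1 (or_introl erefl)) (cnv_integral_ge h3 (or_intror erefl)).
rewrite (mid _ _ _ _ (ltW x0) (or_introl (conj erefl erefl)) h2).
rewrite prim0 !mulr0 E0 EN2 dphi_gt0// (phi_ge0 (ltW x0)).
move: V; move: (expR x) (expR (- x)) => a b V.
rewrite [- _ * (b * b * _)](_ : _ = - (2^-1 * (a * b) * b * v x)); last ring.
by rewrite V; field.
Qed.
End nonlocal_term.

Lemma linopE (v : R -> R) (x : R) : H1 v -> x != 0 ->
  linop v x = (1 - phi x) * wderiv v x + phi x * prim v x - v 0 * dphi x.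
Proof.
move=> Hv x0; have [sv _] := (H1P v).1 Hv; have [sg ag] := wderivP Hv.
by rewrite /linop /convolution (convolution_dphi sv sg ag x0); ring.
Qed.

Lemma sqi_le (f q : R -> R) : measurable_fun setT q -> (forall x, `|q x| <= `|f x|) ->
  sqi f -> sqi q.
Proof.
move=> mq qf [mf fi]; split => //.
apply: (le_integrableR _ _ _ fi) => //; first exact: measurable_funX.
by move=> x _; rewrite normrX -[leRHS]ger0_norm ?sqr_ge0// normrX lerXn2r ?nnegrE.
Qed.

Lemma measurable_eq_off (p : R) (f q : R -> R) : measurable_fun setT q ->
  (forall x, x != p -> f x = q x) -> measurable_fun setT f.
Proof.
move=> mq h; have -> : f = fun x => if x == p then f p else q x.
  by apply/funext => x; case: eqP => [->//|/eqP]; exact: h.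
apply: measurable_fun_ifT => //.
by apply: (measurable_fun_bool true); rewrite (_ : _ @^-1` _ = [set p]);
  [rewrite setTI; exact: measurable_set1|apply/seteqP; split => x /= /eqP].
Qed.

Lemma sqi_eq_off (p : R) (f q : R -> R) : sqi q ->
  (forall x, x != p -> f x = q x) -> sqi f.
Proof.
move=> [mq qi] h; have mf := measurable_eq_off mq h; split => //.
apply: (ae_eq_integrable _ _ _ qi) => //; first exact: measurable_funX.
by apply: (@ae_eq_pt p) => x _ xp; rewrite h.
Qed.

Lemma prim_bounded (v : R -> R) (M x : R) : locint v -> (forall y, `|v y| <= M) ->
  `|prim v x| <= M * `|x|.
Proof.
move=> vl vM; have H (a b : R) : a <= b -> `|\int[mu]_(y in `[a, b]) v y| <= M * (b - a).
  move=> ab; apply: le_trans; first exact: le_normr_Rintegral.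
  have ci : integ `[a, b] (fun=> M) by apply: continuous_locint; exact: contC.
  apply: (@le_trans _ _ (\int[mu]_(y in `[a, b]) M)).
    by apply: le_Rintegral => //; exact: integrable_norm.
  rewrite Rintegral_cst//= lebesgue_measure_itv/= lte_fin.
  case: ltP => // ba; rewrite /= mulr0 mulr_ge0// ?subr_ge0//.
  exact: le_trans (vM 0).
have [x0|x0] := leP 0 x.
  by rewrite prim_ge0//; have := H 0 x x0; rewrite subr0 [`|x|]ger0_norm.
by rewrite (prim_le0 v (ltW x0)) normrN (ltr0_norm x0); have := H x 0 (ltW x0); rewrite sub0r.
Qed.

Lemma sqi_phi_prim (v g : R -> R) : sqi v -> sqi g -> ac setT v g ->
  sqi (fun x => phi x * prim v x).
Proof.
move=> sv sg ag; have [M hM] := ac_bounded sv sg ag.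
have vl := sqi_locint sv; have aw := ac_prim vl; have [mp _] := sqi_phi.
have m : measurable_fun setT (fun x => phi x * prim v x).
  by apply: measurable_funM => //; apply: continuous_mfun; exact: ac_continuous aw.
have M0 : 0 <= M by exact: le_trans (hM 0).
split => //; apply: (@le_integrableR _ _ (fun x => 4 * M ^+ 2 * phi x)) => //.
- exact: measurable_funX.
- move=> x _; rewrite ger0_norm ?sqr_ge0//.
  have -> : phi x = expw `|x| by rewrite /expw normr_ge0.
  apply: weight_bound => //; rewrite normrM ger0_norm.
    rewrite /expw normr_ge0 mulrCA ler_wpM2l ?expR_ge0//.
    apply: (le_trans (prim_bounded _ vl hM)); rewrite ler_wpM2l//; lra.
  by rewrite /expw; case: ifP => // _; exact: expR_ge0.
- by apply: integZl => //; exact: phi_integ.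
Qed.

Lemma sqi_linop (v : R -> R) : H1 v -> sqi (linop v).
Proof.
move=> Hv; have [sv _] := (H1P v).1 Hv; have [sg ag] := wderivP Hv.
have [mp _] := sqi_phi; have [mg _] := sg.
apply: (sqi_eq_off _ (fun x => @linopE v x Hv)).
apply: sqiB; last first.
  by apply: sqiZ; apply: (sqi_le measurable_dphi _ sqi_phi) => x; apply: (le_trans (dphi_norm x)); exact: ler_norm.
apply: sqiD; last exact: sqi_phi_prim sg ag.
apply: (sqi_le _ _ sg); first by apply: measurable_funM => //; exact: measurable_funB.
move=> x; rewrite normrM -[leRHS]mul1r ler_wpM2r//.
by have := phi_gt0 x; have := phi_le1 x; rewrite ler_norml => *; apply/andP; split; lra.
Qed.

(** Off 0 one has phi'' = phi, which makes [linop v] an exact derivative on each half-line. This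
    closes the equation at the level of primitives. *)
Lemma prim_linop (v : R -> R) (x : R) : H1 v -> x != 0 ->
  prim (linop v) x = (1 - phi x) * v x + dphi x * prim v x + v 0 * (1 - phi x).
Proof.
move=> Hv; have [sv _] := (H1P v).1 Hv; have [sg ag] := wderivP Hv.
have [ml _] := sqi_linop Hv.
have aw := ac_prim (sqi_locint sv); have iT : is_interval (@setT R) by [].
have a1 : ac setT (fun=> 1 : R) (fun=> 0) by exact: ac_cst.
rewrite neq_lt => /orP[x0|x0].
  have aE : ac setT (@expR R) expR.
    have := ac_exp 1; under eq_fun do rewrite mul1r; under [X in ac _ _ X]eq_fun do rewrite !mul1r.
    exact.
  have a1E := acB a1 aE.
  have aG := acD (acD (ac_mul iT a1E ag) (ac_mul iT aE aw)) (acZ (v 0) a1E).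
  have aF : ac [set y | y <= 0] (fun y => (1 - expR y) * v y + expR y * prim v y + v 0 * (1 - expR y)) (linop v).
    apply: (ac_ae le0_interval measurable_le0 (fun _ _ => erefl) _ _ (ac_sub _ aG)) => //.
      exact: measurable_funTS.
    apply: (@ae_eq_pt 0) => y /= y0 yn0; rewrite linopE// phi_le0// dphi_lt0 ?lt_neqAle ?yn0//.
    ring.
  have [_] := aF x 0 (ltW x0) (lexx _) (ltW x0).
  rewrite (prim_le0 (linop v) (ltW x0)) => <-; rewrite prim0 expR0 (phi_le0 (ltW x0)) dphi_lt0//; ring.
have aE := ac_expN; have a1E := acB a1 aE.
have aG := acD (acB (ac_mul iT a1E ag) (ac_mul iT aE aw)) (acZ (v 0) a1E).
have aF : ac [set y | 0 <= y] (fun y => (1 - expR (- y)) * v y - expR (- y) * prim v y + v 0 * (1 - expR (- y))) (linop v).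
  apply: (ac_ae ge0_interval measurable_ge0 (fun _ _ => erefl) _ _ (ac_sub _ aG)) => //.
    exact: measurable_funTS.
  apply: (@ae_eq_pt 0) => y /= y0 yn0; rewrite linopE// phi_ge0// dphi_gt0 ?lt_def ?yn0//.
  ring.
have [_] := aF 0 x (lexx _) (ltW x0) (ltW x0).
rewrite (prim_ge0 (linop v) (ltW x0)) => <-; rewrite prim0 oppr0 expR0 (phi_ge0 (ltW x0)) dphi_gt0//; ring.
Qed.

(** * Uniqueness *)

Lemma cvgN_seq (a : nat -> R) (l : R) : a n @[n --> \oo] --> l ->
  - a n @[n --> \oo] --> - l.
Proof. exact: cvgN. Qed.

(** The quotient rule at the level of difference quotients. *)
Lemma quotient_rule (a p f fm k : R) : 1 - f != 0 -> 1 - fm != 0 -> k != 0 ->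
  (a / (1 - fm) - p / (1 - f)) / k =
  ((a - p) / k * (1 - f) + p * ((fm - f) / k)) / ((1 - fm) * (1 - f)).
Proof. by move=> f0 fm0 k0; field; rewrite k0 f0 fm0. Qed.

(** The total derivative along a characteristic: a time increment at the moved point, with its limit
    l split off, plus a spatial increment. *)
Lemma quotient_chain (a p q l k : R) :
  (a - q) / k = (a - p) / k - l + l + (p - q) / k.
Proof. by ring. Qed.

Lemma cvgD_seq (a b : nat -> R) (l m : R) : a n @[n --> \oo] --> l ->
  b n @[n --> \oo] --> m -> a n + b n @[n --> \oo] --> l + m.
Proof. exact: cvgD. Qed.

Lemma quotient_diff (a b c d k : R) :
  (a - b - (c - d)) / k = (a - c) / k - (b - d) / k.
Proof. by ring. Qed.

Lemma quotient_transfer (a b p c d q : R) : a / p - b / q = c / p - d / q -> p != 0 ->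
  a - c = (b - d) / q * p.
Proof.
move=> e p0; have -> : (b - d) / q = (a - c) / p by rewrite !mulrBl; lra.
by rewrite divfK.
Qed.

Lemma cvgB_seq (a b : nat -> R) (l m : R) : a n @[n --> \oo] --> l ->
  b n @[n --> \oo] --> m -> a n - b n @[n --> \oo] --> l - m.
Proof. exact: cvgB. Qed.

Lemma cvg_seq_eq (a b : nat -> R) (l : R) : (forall n, b n = a n) ->
  a n @[n --> \oo] --> l -> b n @[n --> \oo] --> l.
Proof. by move=> /funext ->. Qed.

(* The characteristic X' = phi(X) - 1 issued from s <> 0. *)
Definition chr (s t : R) : R := if 0 <= s then flow (- t) s else - flow t (- s).

Lemma chr_neq0 s t : s != 0 -> chr s t != 0.
Proof.
move=> s0; rewrite /chr; case: ifPn => h.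
  by rewrite gt_eqF// flow_gt0// lt_def s0.
by rewrite oppr_eq0 gt_eqF// flow_gt0// oppr_gt0 ltNge.
Qed.

Lemma chr_surj y t : y != 0 -> exists2 s, s != 0 & chr s t = y.
Proof.
rewrite neq_lt => /orP[y0|y0].
  have ny : 0 < - y by rewrite oppr_gt0.
  have n0 := flow_gt0 (- t) ny.
  exists (- flow (- t) (- y)); first by rewrite oppr_eq0 gt_eqF.
  rewrite /chr oppr_ge0 leNgt n0/= opprK; have := flowK (- t) (ltW ny).
  by rewrite opprK => ->; rewrite opprK.
have n0 := flow_gt0 t y0; exists (flow t y); first by rewrite gt_eqF.
by rewrite /chr (ltW n0) flowK// ltW.
Qed.

(** The group law moves the derivative at time 0 to time t. *)
Lemma flow_derive_time (t x : R) : 0 <= x ->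
  is_derive t 1 (fun t : R => flow t x) (1 - expR (- flow t x)).
Proof.
move=> x0; have y0 := flow_ge0 t x0.
have -> : (fun t : R => flow t x) = (fun h : R => flow h (flow t x)) \o (fun s => s - t).
  by apply/funext => s /=; rewrite flow_flow// subrK.
have d1 : is_derive t 1 (fun s : R => s - t) 1.
  by apply: (@is_derive_eq _ _ _ (fun s : R => s - t)); rewrite subr0.
rewrite -[X in is_derive _ _ _ X]mulr1; apply: is_derive1_comp => //.
by rewrite /= subrr; exact: flow_derive_t.
Qed.

Lemma chr_derive (s t : R) : s != 0 -> is_derive t 1 (chr s) (phi (chr s t) - 1).
Proof.
move=> sn; have [s0|s0] := leP 0 s.
  rewrite /chr s0 phi_ge0 ?flow_ge0//.
  have d := flow_derive_time (- t) s0.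
  have := @is_derive1_comp _ (fun t : R => flow t s) (fun t : R => - t) t _ (-1) d _.
  by rewrite mulrN1 opprB; apply.
rewrite /chr leNgt s0/=; have n0 : 0 <= - s by rewrite oppr_ge0 ltW.
rewrite phi_le0 ?oppr_le0 ?flow_ge0//.
have d := flow_derive_time t n0.
by have := is_deriveN d; rewrite opprB.
Qed.

Lemma phi_derive (x : R) : x != 0 -> is_derive x 1 (phi : R -> R) (dphi x).
Proof.
rewrite neq_lt => /orP[x0|x0].
  rewrite dphi_lt0//; apply: (@near_eq_is_derive _ _ _ (@expR R) _ _ _ _ _ (is_derive_expR x)).
  by near=> y; rewrite phi_le0//; near: y; exact: lt_le_nbhsl.
rewrite dphi_gt0//; apply: (@near_eq_is_derive _ _ _ (fun y : R => expR (- y)) _ _ _ _ _ (dexpN x)).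
by near=> y; rewrite phi_ge0//; near: y; exact: lt_le_nbhsr.
Unshelve. all: by end_near.
Qed.

Lemma phi_lt1 (x : R) : x != 0 -> phi x < 1.
Proof. by move=> x0; rewrite /phi -expR0 ltr_expR oppr_lt0 normr_gt0. Qed.

Lemma is_derive_of_cvg (f : R -> R) (a l : R) :
  h^-1 * (f (h + a) - f a) @[h --> 0^'] --> l -> is_derive a 1 f l.
Proof.
move=> fl.
have L : h^-1 *: ((f \o shift a) (h *: 1) - f a) @[h --> 0^'] --> l.
  by move: fl; under [X in _ -> X @ _ --> _]eq_fun do rewrite /GRing.scale/= mulr1.
by split; [exact: cvgP L|exact: (cvg_lim _ L)].
Qed.

(* [t |-> D `|t|] has derivative 0 at every real number, even though [D] may be
   badly behaved at negative times. *)
Lemma halfline_constant (D : R -> R) :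
  (forall t (h : nat -> R), 0 <= t -> (forall n, h n != 0) -> (forall n, 0 <= t + h n) ->
    h n @[n --> \oo] --> (0 : R) -> (D (t + h n) - D t) / h n @[n --> \oo] --> (0 : R)) ->
  forall t, 0 <= t -> D t = D 0.
Proof.
move=> hD.
(* Epsilon-delta form by contradiction: if every radius 1 / (n + 1) failed, the bad points would
   give a null sequence of increments whose quotients stay above e. *)
have key t e : 0 <= t -> 0 < e -> exists2 d, 0 < d &
    forall s, 0 <= s -> `|s - t| < d -> `|D s - D t| <= e * `|s - t|.
  move=> t0 e0; apply: contrapT => /forall2NP nd.
  have bad (n : nat) : exists s : R, [/\ 0 <= s, `|s - t| < n.+1%:R^-1 & e * `|s - t| < `|D s - D t|].
    have [/=|/existsNP[s]] := nd n.+1%:R^-1; first by rewrite invr_gt0 ltr0n.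
    by move=> /not_implyP[s0 /not_implyP[st /negP]]; rewrite -ltNge => ?; exists s.
  have [s hs] := choice bad.
  pose h n := s n - t.
  have hn0 n : h n != 0.
    have [_ _] := hs n; rewrite /h subr_eq0; apply: contraTneq => ->.
    by rewrite !subrr normr0 mulr0 ltxx.
  have th n : t + h n = s n by rewrite /h addrC subrK.
  have h0 : h n @[n --> \oo] --> (0 : R).
    apply: (cvg0_bound _ (@cvg_harmonic R)) => n; rewrite subr0 ltW//.
    by have [] := hs n.
  have ht n : 0 <= t + h n by rewrite th; have [] := hs n.
  have := hD t h t0 hn0 ht h0.
  move=> /cvgrPdist_lt/(_ e e0)[n _ /(_ n (leqnn n))].
  rewrite /= sub0r normrN th normrM normfV ltr_pdivrMr ?normr_gt0//.
  by have [_ _] := hs n; rewrite /h => /lt_trans h1 /h1; rewrite ltxx.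
move=> t t0; have -> : D t = D `|t| by rewrite ger0_norm.
rewrite -[in RHS](normr0 R); apply: (@is_derive_0_is_cst _ (fun t => D `|t|)) => x.
apply: is_derive_of_cvg; apply/cvgrPdist_le => e e0.
have [d d0 hd] := key `|x| e (normr_ge0 _) e0.
near=> h; rewrite sub0r normrN normrM normfV.
have hh : h != 0 by near: h; exact: nbhs_dnbhs_neq.
rewrite ler_pdivrMl ?normr_gt0// mulrC.
have le : `| `|h + x| - `|x| | <= `|h|.
  by apply: le_trans (ler_dist_dist _ _) _; rewrite addrK.
apply: (@le_trans _ _ (e * `| `|h + x| - `|x| |)); last by rewrite ler_wpM2l// ltW.
apply: hd => //; apply: le_lt_trans le _; near: h.
by apply: dnbhs0_lt.
Unshelve. all: by end_near.
Qed.

Section conservation.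
Context (w : R -> R -> R) (Hw : forall t, 0 <= t -> H1 (w t)) (ev : evolution_eq w).

Lemma sqi_quotient t h : 0 <= t -> 0 <= t + h ->
  sqi (fun x => (w (t + h) x - w t x) / h - linop (w t) x).
Proof.
move=> t0 th; have [s1 _] := (H1P _).1 (Hw t0); have [s2 _] := (H1P _).1 (Hw th).
apply: sqiB; last exact: sqi_linop (Hw t0).
by have := sqiZ h^-1 (sqiB s2 s1); under eq_fun do rewrite mulrC.
Qed.

Lemma evolution_seq t (h : nat -> R) : 0 <= t -> (forall n, h n != 0) ->
  (forall n, 0 <= t + h n) -> h n @[n --> \oo] --> (0 : R) ->
  \int[mu]_x ((w (t + h n) x - w t x) / h n - linop (w t) x) ^+ 2 @[n --> \oo] --> (0 : R).
Proof.
move=> t0 hn th h0; have := ev t0; set F := fun s => normL2 _ => evt.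
have L : F (t + h n) @[n --> \oo] --> 0%E.
  have tl : t + h n @[n --> \oo] --> t by rewrite -[X in _ --> X]addr0; apply: cvgD => //; exact: cvg_cst.
  apply: (@cvg_comp _ _ _ (fun n => t + h n) F _ _ _ _ evt) => A hA.
  have h2 : \forall n \near \oo, t + h n != t -> 0 <= t + h n -> A (t + h n) by exact: tl hA.
  apply: (@filterS _ \oo _ _ _ _ h2) => n h1 /=; apply: h1 => //.
  by rewrite -subr_eq0 addrC addKr.
have E n : F (t + h n) = (Num.sqrt (\int[mu]_x ((w (t + h n) x - w t x) / h n - linop (w t) x) ^+ 2))%:E.
  rewrite /F [t + h n - t]addrC addKr normL2E//; exact: sqi_quotient.
rewrite (eq_cvg _ _ E) in L.
have L' : Num.sqrt (\int[mu]_x ((w (t + h n) x - w t x) / h n - linop (w t) x) ^+ 2)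
    @[n --> \oo] --> (0 : R).
  exact: (@fine_cvg _ _ _ _ (fun n => (Num.sqrt (\int[mu]_x ((w (t + h n) x - w t x) / h n - linop (w t) x) ^+ 2))%:E)).
have := cvg_sqr L'; rewrite expr0n.
by under eq_fun do rewrite sqr_sqrtr ?sqr_int_ge0//.
Qed.

(** Along a characteristic 1 - phi satisfies the homogeneous part y' = phi' y of the equation for
    [prim (w t)], so dividing by it leaves only the source [w t 0]. *)
Definition ratio s t := prim (w t) (chr s t) / (1 - phi (chr s t)).

Lemma ratio_derive s t (h : nat -> R) : s != 0 -> 0 <= t -> (forall n, h n != 0) ->
  (forall n, 0 <= t + h n) -> h n @[n --> \oo] --> (0 : R) ->
  (ratio s (t + h n) - ratio s t) / h n @[n --> \oo] --> w t 0.
Proof.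
move=> s0 t0 hn th h0.
have Ht := Hw t0; have [st _] := (H1P _).1 Ht; have [sg ag] := wderivP Ht.
have x0 := chr_neq0 t s0; have dX := chr_derive t s0.
set x := chr s t in x0 dX *; set P := prim (w t).
pose xn n := chr s (t + h n).
have N0 : 0 < 1 - phi x by rewrite subr_gt0 phi_lt1.
have Nn n : 0 < 1 - phi (xn n) by rewrite subr_gt0 phi_lt1// chr_neq0.
have xnx : xn n @[n --> \oo] --> x.
  have tl : t + h n @[n --> \oo] --> t by rewrite -[X in _ --> X]addr0; apply: cvgD => //; exact: cvg_cst.
  by apply: continuous_cvg => //; exact: (is_derive_continuous dX).
have pd : is_derive x 1 P (w t x) by apply: prim_derive; exact: ac_continuous ag.
have d1 : (P (xn n) - P x) / h n @[n --> \oo] --> w t x * (phi x - 1).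
  exact: (is_derive_cvg (is_derive1_comp pd dX) hn h0).
have d2 : (phi (xn n) - phi x) / h n @[n --> \oo] --> dphi x * (phi x - 1).
  exact: (is_derive_cvg (is_derive1_comp (phi_derive x0) dX) hn h0).
have ll := sqi_locint (sqi_linop Ht).
pose dn n y := (w (t + h n) y - w t y) / h n - linop (w t) y.
(* The equation holds only in L^2, but Cauchy-Schwarz on the interval between 0 and [xn n] makes the
   primitive of the error tend to zero, even at a moving point. *)
have d3 : prim (dn n) (xn n) @[n --> \oo] --> (0 : R).
  have sd n : sqi (dn n) by exact: sqi_quotient.
  have L := cvgM (cvg_norm xnx) (evolution_seq t0 hn th h0).
  have {}L : `|xn n| * \int[mu]_x dn n x ^+ 2 @[n --> \oo] --> (0 : R).
    by rewrite -(mulr0 `|x|); exact: L.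
  apply/norm_cvg0P.
  have -> : (fun n => `|prim (dn n) (xn n)|) = fun n => Num.sqrt (prim (dn n) (xn n) ^+ 2).
    by apply/funext => n; rewrite sqrtr_sqr.
  rewrite -(sqrtr0 R); apply: continuous_cvg; first exact: sqrt_continuous.
  apply: (cvg0_bound _ L) => n; rewrite subr0 ger0_norm ?sqr_ge0//.
  have := @prim_diff_sqr (dn n) 0 (xn n) `|xn n| (sd n).
  rewrite subr0 prim0 subr0 => /(_ (lexx _)) /le_trans; apply.
  rewrite ler_wpM2l// Rintegral_mkcond; apply: le_Rintegral => //.
  - by apply/integrable_patch => //; apply: integrableS (sd n).2.
  - exact: (sd n).2.
  - by move=> y _; rewrite patchE; case: ifP => // _; exact: sqr_ge0.
have d4 : prim (linop (w t)) (xn n) @[n --> \oo] --> prim (linop (w t)) x.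
  by apply: continuous_cvg => //; exact: (ac_continuous (ac_prim ll)).
(* The transport term (1 - phi) w of [prim_linop] cancels against the motion of the
   characteristic. *)
have d5 : (prim (w (t + h n)) (xn n) - P x) / h n @[n --> \oo] -->
    dphi x * P x + w t 0 * (1 - phi x).
  have := cvgD_seq (cvgD_seq d3 d4) d1.
  rewrite (prim_linop Ht x0) => L.
  rewrite [X in _ --> X](_ : _ = 0 + ((1 - phi x) * w t x + dphi x * P x + w t 0 * (1 - phi x)) + w t x * (phi x - 1)); last ring.
  apply: cvg_seq_eq L => n /=.
  have [s1 _] := (H1P _).1 (Hw (th n)).
  have l1 := sqi_locint s1; have l2 := sqi_locint st.
  have -> : prim (dn n) (xn n) = (prim (w (t + h n)) (xn n) - P (xn n)) / h n - prim (linop (w t)) (xn n).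
    rewrite /prim /dn.
    have E (a b : R) : \int[mu]_(y in `[a, b]) ((w (t + h n) y - w t y) / h n - linop (w t) y) =
      (\int[mu]_(y in `[a, b]) w (t + h n) y - \int[mu]_(y in `[a, b]) w t y) / h n -
      \int[mu]_(y in `[a, b]) linop (w t) y.
      rewrite RintegralB//; last by apply: integZr => //; exact: integB.
      congr (_ - _); rewrite RintegralZr//; last exact: integB.
      by rewrite RintegralB.
    by rewrite !E /P /prim; ring.
  exact: quotient_chain.
have d6 : (1 - phi (xn n)) @[n --> \oo] --> 1 - phi x.
  apply: cvgB; first exact: cvg_cst.
  by apply: continuous_cvg => //; exact: phi_continuous.
pose A := dphi x * P x + w t 0 * (1 - phi x).
have d7 : ((prim (w (t + h n)) (xn n) - P x) / h n * (1 - phi x) + P x * ((phi (xn n) - phi x) / h n))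
   / ((1 - phi (xn n)) * (1 - phi x)) @[n --> \oo] -->
   (A * (1 - phi x) + P x * (dphi x * (phi x - 1))) / ((1 - phi x) * (1 - phi x)).
  apply: cvgM.
    by apply: cvgD; [apply: cvgMl|apply: cvgMr].
  apply: cvgV; first by rewrite mulf_neq0// gt_eqF.
  by apply: cvgMl.
rewrite [X in _ --> X](_ : _ = (A * (1 - phi x) + P x * (dphi x * (phi x - 1))) / ((1 - phi x) * (1 - phi x))); last first.
  by rewrite /A; field; rewrite gt_eqF.
apply: cvg_seq_eq d7 => n /=.
rewrite /ratio -/x -/(xn n) -/P.
exact: quotient_rule (lt0r_neq0 N0) (lt0r_neq0 (Nn n)) (hn n).
Qed.

(** Both ratios have the same derivative [w t 0], so its unknown value cancels. *)
Lemma ratio_conserved s0 s1 t : s0 != 0 -> s1 != 0 -> 0 <= t ->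
  ratio s0 t - ratio s1 t = ratio s0 0 - ratio s1 0.
Proof.
move=> n0 n1; apply: (@halfline_constant (fun t => ratio s0 t - ratio s1 t)).
move=> {}t h t0 hn th h0.
have := cvgB_seq (ratio_derive n0 t0 hn th h0) (ratio_derive n1 t0 hn th h0).
rewrite (@subrr _ (w t 0)); apply: cvg_seq_eq => n.
exact: quotient_diff.
Qed.
End conservation.

Lemma solution_unique (v w : R -> R -> R) :
  (forall t, 0 <= t -> H1 (v t)) -> (forall t, 0 <= t -> H1 (w t)) ->
  evolution_eq v -> evolution_eq w -> (forall x, v 0 x = w 0 x) ->
  forall t x, 0 <= t -> v t x = w t x.
Proof.
move=> Hv Hw ev ew e0 t x t0.
have cz (f : R -> R -> R) : (forall t, 0 <= t -> H1 (f t)) -> continuous (f t).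
  by move=> Hf; have [_ [g _ ag]] := (H1P _).1 (Hf _ t0); exact: ac_continuous ag.
pose z y := v t y - w t y.
have cZ : continuous z by apply: contB; exact: cz.
have E0 : v 0 = w 0 by apply/funext.
have zE y : prim z y = prim (v t) y - prim (w t) y.
  have lv := continuous_locint (cz _ Hv); have lw := continuous_locint (cz _ Hw).
  by rewrite /prim !RintegralB//; ring.
(* A reference characteristic, passing through 1 at time t; the others are compared with it. *)
have [s1 n1 h1] := @chr_surj 1 t (oner_neq0 _).
pose c := prim z 1 / (1 - phi 1).
have pc y : prim z y = c * (1 - phi y).
  have [->|y0] := eqVneq y 0; first by rewrite prim0 /phi normr0 oppr0 expR0 subrr mulr0.
  have [s n h] := chr_surj t y0.
  have a := ratio_conserved Hv ev n n1 t0; have b := ratio_conserved Hw ew n n1 t0.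
  have : ratio v s t - ratio v s1 t = ratio w s t - ratio w s1 t.
    have e r : ratio v r 0 = ratio w r 0.
      exact: (f_equal (fun f => prim f (chr r 0) / (1 - phi (chr r 0))) E0).
    apply: (etrans a); apply: (etrans _ (esym b)).
    exact: (f_equal2 (fun p q => p - q) (e s) (e s1)).
  have p0 : 0 < 1 - phi y by rewrite subr_gt0 phi_lt1.
  rewrite /ratio h h1 zE /c zE => e.
  by apply: (quotient_transfer e); rewrite gt_eqF.
have pder (y : R) : is_derive y 1 (prim z) (z y) by exact: prim_derive.
have [r [rn r01 r0]] : exists r : nat -> R,
    [/\ forall n, r n != 0, forall n, 0 <= r n <= 1 & r n @[n --> \oo] --> (0 : R)].
  exists (fun n => n.+1%:R^-1); split => [n|n|].
  - by rewrite invr_eq0 pnatr_eq0.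
  - by rewrite invr_ge0 ler0n/= invf_le1// ler1n.
  - exact: cvg_harmonic.
have L1 := is_derive_cvg (pder 0) rn r0.
have L2 : (prim z (0 + (- r n)) - prim z 0) / (- r n) @[n --> \oo] --> z 0.
  apply: (@is_derive_cvg _ _ _ (fun n => - r n) (pder 0)) => [n|]; first by rewrite oppr_eq0.
  by rewrite -oppr0; exact: cvgN r0.
have even y : phi (- y) = phi y by rewrite /phi normrN.
(* [prim z] is even, so its derivative z 0 at the origin equals its own opposite. *)
have z0 : z 0 = 0.
  have : z 0 = - z 0.
    apply: (@cvg_unique _ (@Rhausdorff R) _ _ _ _ L1).
    apply: cvg_seq_eq (cvgN_seq L2) => n.
    by rewrite !add0r !pc even invrN mulrN opprK.
  by lra.
(* Along r > 0 the quotient c (1 - e^(-r)) / r tends to c, and it must also tend to z 0 = 0. *)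
have c0 : c = 0.
  have L4 : c * ((1 - expR (- r n)) / r n) @[n --> \oo] --> c * 1.
    apply: cvg_scale; apply: (@cvg0_bound _ (fun n => r n * expR 1)) => [n|].
      have [b1 b2] := expN_bounds (r n); have /andP[q0 q1] := r01 n.
      apply: (le_trans (b2 (rn n))); apply: (le_trans b1).
      by rewrite ger0_norm// ler_wpM2l// ler_expR.
    by rewrite -(mul0r (expR 1)); apply: cvgMl.
  rewrite -[c]mulr1 -z0; apply: (@cvg_unique _ (@Rhausdorff R) _ _ _ _ L4).
  apply: cvg_seq_eq L1 => n; have /andP[q0 _] := r01 n.
  by rewrite prim0 subr0 add0r pc phi_ge0// mulrA.
have p0 : prim z = fun=> 0 by apply/funext => y; rewrite pc c0 mul0r.
have := pder x; rewrite p0 => d; apply/eqP; rewrite -subr_eq0; apply/eqP.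
rewrite -/(z x) -(@derive_val _ _ _ _ _ _ _ d).
exact: derive_cst.
Qed.

(** * Reflection and restriction to half-lines *)

Lemma sqi_opp (f : R -> R) : sqi f -> sqi (fun x => f (- x)) /\
  \int[mu]_x f (- x) ^+ 2 = \int[mu]_x f x ^+ 2.
Proof.
move=> [mf fi].
have mo : measurable_fun setT (fun x : R => f (- x)) by exact: measurableT_comp.
have [] := @Rintegral_opp setT (fun x => f (- x) ^+ 2) measurableT (measurable_funX 2 mo).
  by rewrite preimage_setT; under eq_fun do rewrite opprK.
move=> i; rewrite preimage_setT; under eq_Rintegral do rewrite opprK.
by move=> ->; split.
Qed.

Lemma ac_opp (v g : R -> R) : measurable_fun setT g -> ac setT v g ->
  ac setT (fun x => v (- x)) (fun x => - g (- x)).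
Proof.
move=> mg av a b _ _ ab; have ba : - b <= - a by rewrite lerN2.
have [gi e] := av _ _ Logic.I Logic.I ba.
have mo : measurable_fun setT (fun x : R => g (- x)) by exact: measurableT_comp.
have pre : (-%R : R -> R) @^-1` `[a, b]%classic = `[- b, - a]%classic.
  by apply/seteqP; split => x /=; rewrite !in_itv/= => /andP[? ?]; apply/andP; split; lra.
have mI : measurable (`[a, b]%classic : set R) by exact: measurable_itv.
have [] := Rintegral_opp mI mo.
  have -> : (fun x : R => g (- - x)) = g by apply/funext => x; rewrite opprK.
  by rewrite pre.
rewrite pre; under eq_Rintegral do rewrite opprK.
move=> i e2; split; first exact: integN.
have -> : \int[mu]_(x in `[a, b]) - g (- x) = - \int[mu]_(x in `[a, b]) g (- x).
  under eq_Rintegral do rewrite -mulN1r.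
  by rewrite RintegralZl// mulN1r.
by rewrite -e2 -e; ring.
Qed.

(** The condition v 0 = 0 is what lets the extension by zero remain absolutely continuous, with no
    jump at the origin. *)
Lemma halfline_restrict (v g : R -> R) : sqi v -> sqi g -> ac setT v g -> v 0 = 0 ->
  halfline (fun x => if 0 <= x then v x else 0) (fun x => if 0 <= x then g x else 0).
Proof.
move=> sv sg ag v0; have [mv _] := sv; have [mg _] := sg.
have cut (f : R -> R) : sqi f -> sqi (fun x => if 0 <= x then f x else 0).
  move=> sf; have [mf _] := sf; apply: (sqi_le _ _ sf).
    exact: (@measurable_ge0_if f (fun=> 0)).
  by move=> x; case: ifP => // _; rewrite normr0.
split; [|exact: cut|exact: cut| |].
- apply: (@ac_glue 0).
    have a0 : ac [set x : R | x <= 0] (fun=> 0) (fun=> 0) by exact: ac_cst.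
    apply: (ac_ae le0_interval measurable_le0 _ _ _ a0) => [x /= x0||].
    + by have [x1|//] := leP 0 x; rewrite (_ : x = 0) ?v0//; lra.
    + by apply: measurable_funTS; exact: (cut _ sg).1.
    + by apply: (@ae_eq_pt 0) => x /= x0 xn; rewrite leNgt lt_neqAle xn x0.
  apply: (ac_ae ge0_interval measurable_ge0 _ _ _ (ac_sub _ ag)) => [x /= ->//||//|//].
  + by apply: measurable_funTS; exact: (cut _ sg).1.
  + by apply: aeW => x /= ->.
- by move=> x x0; have [x1|//] := leP 0 x; rewrite (_ : x = 0)//; lra.
- by move=> x; rewrite leNgt => ->.
Qed.

(** Dropping finitely many terms of a sequence allows increments bounded by 1, as the dominated
    convergence lemmas require. *)
Lemma cvg_dnbhs_seq (F : R -> R) (a l : R) :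
  (forall h : nat -> R, (forall n, h n != 0) -> (forall n, `|h n| <= 1) ->
    h n @[n --> \oo] --> (0 : R) -> F (a + h n) @[n --> \oo] --> l) ->
  F s @[s --> a^'] --> l.
Proof.
move=> hF; apply/cvgr_dnbhsP => u [un ua].
have h0 : u n - a @[n --> \oo] --> (0 : R) by exact/subr_cvg0.
have /cvgrPdist_le/(_ 1 ltr01)[N _ hN] := h0.
have hN0 : u (n + N)%N - a @[n --> \oo] --> (0 : R).
  by have := h0; rewrite -(cvg_shiftn N).
rewrite -(cvg_shiftn N).
have := hF (fun n => u (n + N)%N - a) _ _ hN0.
under eq_fun do rewrite addrC subrK; apply => n; first by rewrite subr_eq0.
by have := hN (n + N)%N (leq_addl _ _); rewrite /= sub0r normrN.
Qed.

Lemma cvg_sqrt0 (a : nat -> R) : a n @[n --> \oo] --> (0 : R) ->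
  Num.sqrt (a n) @[n --> \oo] --> (0 : R).
Proof. by move=> a0; rewrite -(sqrtr0 R); apply: continuous_cvg => //; exact: sqrt_continuous. Qed.

(** * Existence and norm identities *)

Section two_sided.
Context (u1 g1 u2 g2 : R -> R) (ug1 : halfline u1 g1) (ug2 : halfline u2 g2).

Definition glue (u v : R -> R) (x : R) : R := u x + v (- x).
(** The companion of [glue] for derivatives, since reflection changes their sign. *)
Definition glueB (u v : R -> R) (x : R) : R := u x - v (- x).

Lemma glue_sqi u v : sqi u -> sqi v -> sqi (glue u v).
Proof. by move=> su /sqi_opp[sv _]; exact: sqiD. Qed.

Lemma glueB_sqi u v : sqi u -> sqi v -> sqi (glueB u v).
Proof. by move=> su /sqi_opp[sv _]; exact: sqiB. Qed.

Lemma glue_ac u v g k : measurable_fun setT k -> ac setT u g -> ac setT v k ->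
  ac setT (glue u v) (glueB g k).
Proof. by move=> mk au /(ac_opp mk); exact: acD. Qed.

Lemma glue_int u v : sqi u -> sqi v ->
  \int[mu]_x glue u v x ^+ 2 <= 2 * (\int[mu]_x u x ^+ 2 + \int[mu]_x v x ^+ 2).
Proof. by move=> su /sqi_opp[sv <-]; exact: Rintegral_sqrD. Qed.

Lemma glueB_int u v : sqi u -> sqi v ->
  \int[mu]_x glueB u v x ^+ 2 <= 2 * (\int[mu]_x u x ^+ 2 + \int[mu]_x v x ^+ 2).
Proof.
move=> su sv; have := glue_int su (sqiN sv).
by under [X in _ + X]eq_Rintegral do rewrite sqrrN.
Qed.

Lemma glue_H1 : [/\ ac setT (glue u1 u2) (glueB g1 g2), sqi (glue u1 u2),
  sqi (glueB g1 g2) & H1 (glue u1 u2)].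
Proof.
have [a1 s1 t1 _ _] := ug1; have [a2 s2 t2 _ _] := ug2.
have ag := glue_ac t2.1 a1 a2; have sg := glue_sqi s1 s2; have sh := glueB_sqi t1 t2.
by split => //; apply/H1P; split => //; exists (glueB g1 g2).
Qed.

(* Reflecting the negative half-line reverses time. *)
Definition flowsol t : R -> R := glue (hsol u1 t) (hsol u2 (- t)).

Lemma flowsol0 x : flowsol 0 x = glue u1 u2 x.
Proof. by rewrite /flowsol /glue oppr0 !hsol_0. Qed.

Lemma flowsol_cvg (h : nat -> R) : (forall n, h n != 0) -> (forall n, `|h n| <= 1) ->
  h n @[n --> \oo] --> (0 : R) ->
  normH1 setT (fun x => flowsol (h n) x - glue u1 u2 x) @[n --> \oo] --> 0%E.
Proof.
move=> hn h1 h0.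
have nhn n : - h n != 0 by rewrite oppr_eq0.
have nh1 n : `|- h n| <= 1 by rewrite normrN.
have nh0 : - h n @[n --> \oo] --> (0 : R) by rewrite -oppr0; exact: cvgN_seq.
have [a1 s1 t1 _ _] := ug1; have [a2 s2 t2 _ _] := ug2.
pose d1 n x := hsol u1 (h n) x - u1 x; pose d2 n x := hsol u2 (- h n) x - u2 x.
pose e1 n x := hdsol u1 g1 (h n) x - g1 x; pose e2 n x := hdsol u2 g2 (- h n) x - g2 x.
have hl1 n := halfline_hsol ug1 (h n); have hl2 n := halfline_hsol ug2 (- h n).
have sd1 n : sqi (d1 n) by have [_ ? _ _ _] := hl1 n; exact: sqiB.
have sd2 n : sqi (d2 n) by have [_ ? _ _ _] := hl2 n; exact: sqiB.
have se1 n : sqi (e1 n) by have [_ _ ? _ _] := hl1 n; exact: sqiB.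
have se2 n : sqi (e2 n) by have [_ _ ? _ _] := hl2 n; exact: sqiB.
have dE n : (fun x => flowsol (h n) x - glue u1 u2 x) = glue (d1 n) (d2 n).
  by apply/funext => x; rewrite /flowsol /glue /d1 /d2; ring.
have ad n : ac setT (glue (d1 n) (d2 n)) (glueB (e1 n) (e2 n)).
  have [b1 _ _ _ _] := hl1 n; have [b2 _ _ _ _] := hl2 n.
  by apply: glue_ac; [exact: (se2 n).1|exact: acB|exact: acB].
have E n : normH1 setT (fun x => flowsol (h n) x - glue u1 u2 x) =
    (Num.sqrt (\int[mu]_x (glue (d1 n) (d2 n) x ^+ 2 + glueB (e1 n) (e2 n) x ^+ 2)))%:E.
  rewrite dE; apply: normH1E => //; [exact: glue_sqi|exact: glueB_sqi].
rewrite (eq_cvg _ _ E); apply: cvg_EFin; first exact: nearW.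
apply: (@cvg_sqrt0 (fun n => \int[mu]_x (glue (d1 n) (d2 n) x ^+ 2 + glueB (e1 n) (e2 n) x ^+ 2))).
have L := @cvg_scale 2 _ _ (cvgD_seq (cvgD_seq (hsol_cvg hn h1 h0 ug1) (hsol_cvg nhn nh1 nh0 ug2))
  (cvgD_seq (hdsol_cvg h1 h0 ug1) (hdsol_cvg nh1 nh0 ug2))).
rewrite !addr0 mulr0 in L; apply: (cvg0_bound _ L) => n.
rewrite subr0 ger0_norm; last first.
  by apply: Rintegral_ge0 => x _; rewrite addr_ge0 ?sqr_ge0.
have [_ i1] := glue_sqi (sd1 n) (sd2 n); have [_ i2] := glueB_sqi (se1 n) (se2 n).
rewrite RintegralD// mulrDr; apply: lerD; [exact: glue_int|exact: glueB_int].
Qed.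

(** The glued function vanishes at 0, which removes the [dphi] term of [linopE]. The generator of
    the reflected half enters with a minus sign, matching the reversal of time in [flowsol]. *)
Lemma linop_glue : ae_eq mu setT (linop (glue u1 u2))
  (glueB (fun x => bfac x * g1 x + expR (- x) * prim u1 x)
         (fun x => bfac x * g2 x + expR (- x) * prim u2 x)).
Proof.
have [ag sg sh Hg] := glue_H1.
have [a1 s1 t1 u10 g10] := ug1; have [a2 s2 t2 u20 g20] := ug2.
have glue0 : glue u1 u2 0 = 0 by rewrite /glue oppr0 u10 ?u20 ?addr0.
have l1 := sqi_locint s1; have l2 := sqi_locint s2.
have primE x : prim (glue u1 u2) x = prim u1 x - prim u2 (- x).
  have aP := acB (ac_prim l1) (ac_opp s2.1 (ac_prim l2)).
  have := acP0 x aP; rewrite oppr0 !prim0 subrr add0r => ->.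
  by rewrite /glue; congr (prim _ x); apply/funext => y; rewrite opprK.
have W := wderiv_ae sg sh ag.
pose K x := (1 - phi x) * wderiv (glue u1 u2) x + phi x * prim (glue u1 u2) x.
have KE : ae_eq mu setT (linop (glue u1 u2)) K.
  by apply: (@ae_eq_pt 0) => x _ xn; rewrite linopE// glue0 mul0r subr0.
apply: (ae_eq_trans KE); apply: filterS W => x /(_ Logic.I) Wx _.
rewrite /K Wx primE /glueB /bfac; have [x0|x0|->] := ltgtP x 0.
- rewrite (phi_le0 (ltW x0)) (g10 _ x0) (halfline_prim0 ug1 (ltW x0)) oppr_ge0 (ltW x0) opprK.
  by ring.
- have nx : - x < 0 by rewrite oppr_lt0.
  rewrite (phi_ge0 (ltW x0)) (g20 _ nx) (halfline_prim0 ug2 (ltW nx)) oppr_ge0 (lt_geF x0).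
  by ring.
- by rewrite phi_ge0// !oppr0 lexx expR0 !prim0; ring.
Qed.

Lemma flowsol_derive (h : nat -> R) : (forall n, h n != 0) -> (forall n, `|h n| <= 1) ->
  h n @[n --> \oo] --> (0 : R) ->
  normL2 (fun x => (flowsol (h n) x - glue u1 u2 x) / h n - linop (glue u1 u2) x)
    @[n --> \oo] --> 0%E.
Proof.
move=> hn h1 h0.
have nhn n : - h n != 0 by rewrite oppr_eq0.
have nh1 n : `|- h n| <= 1 by rewrite normrN.
have nh0 : - h n @[n --> \oo] --> (0 : R) by rewrite -oppr0; exact: cvgN_seq.
have [ag sg sh Hg] := glue_H1; have sl := sqi_linop Hg.
have [a1 s1 t1 _ _] := ug1; have [a2 s2 t2 _ _] := ug2.
pose A1 x := bfac x * g1 x + expR (- x) * prim u1 x.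
pose A2 x := bfac x * g2 x + expR (- x) * prim u2 x.
have sA1 : sqi A1 by exact: sqi_gen ug1.
have sA2 : sqi A2 by exact: sqi_gen ug2.
pose d1 n x := (hsol u1 (h n) x - u1 x) / h n - A1 x.
pose d2 n x := (hsol u2 (- h n) x - u2 x) / (- h n) - A2 x.
have quot (k : R) (f q A : R -> R) : sqi f -> sqi q -> sqi A -> sqi (fun x => (f x - q x) / k - A x).
  move=> sf sq sA; apply: sqiB => //.
  by have := sqiZ k^-1 (sqiB sf sq); under eq_fun do rewrite mulrC.
have sV n : sqi (flowsol (h n)).
  have [_ b1 _ _ _] := halfline_hsol ug1 (h n); have [_ b2 _ _ _] := halfline_hsol ug2 (- h n).
  exact: glue_sqi.
have sd1 n : sqi (d1 n) by have [_ b1 _ _ _] := halfline_hsol ug1 (h n); exact: quot.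
have sd2 n : sqi (d2 n) by have [_ b2 _ _ _] := halfline_hsol ug2 (- h n); exact: quot.
have sD n : sqi (fun x => (flowsol (h n) x - glue u1 u2 x) / h n - linop (glue u1 u2) x) by exact: quot.
have E n : normL2 (fun x => (flowsol (h n) x - glue u1 u2 x) / h n - linop (glue u1 u2) x) =
    (Num.sqrt (\int[mu]_x (glueB (d1 n) (d2 n) x ^+ 2)))%:E.
  rewrite normL2E//; congr (Num.sqrt _)%:E; apply: ae_eq_Rintegral => //.
  - by apply: measurable_funX; exact: (sD n).1.
  - by apply: measurable_funX; exact: (glueB_sqi (sd1 n) (sd2 n)).1.
  apply: filterS linop_glue => x /(_ Logic.I) -> _; congr (_ ^+ 2).
  rewrite /flowsol /glue /glueB /d1 /d2 /A1 /A2 invrN; ring.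
rewrite (eq_cvg _ _ E); apply: cvg_EFin; first exact: nearW.
apply: (@cvg_sqrt0 (fun n => \int[mu]_x (glueB (d1 n) (d2 n) x ^+ 2))).
have L := @cvg_scale 2 _ _ (cvgD_seq (hsol_quotient_cvg hn h1 h0 ug1) (hsol_quotient_cvg nhn nh1 nh0 ug2)).
rewrite !addr0 mulr0 in L; apply: (cvg0_bound _ L) => n.
rewrite subr0 ger0_norm ?sqr_int_ge0//; exact: glueB_int.
Qed.
End two_sided.

(** Any time t becomes time 0 for the evolved half-line data. *)
Lemma flowsol_group u1 g1 u2 g2 (ug1 : halfline u1 g1) (ug2 : halfline u2 g2) t s x :
  flowsol u1 u2 (t + s) x = flowsol (hsol u1 t) (hsol u2 (- t)) s x.
Proof. by rewrite /flowsol /glue opprD (hsol_group ug1) (hsol_group ug2). Qed.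

Section existence.
Context (u1 g1 u2 g2 : R -> R) (ug1 : halfline u1 g1) (ug2 : halfline u2 g2).
Local Notation V := (flowsol u1 u2).

Lemma flowsol_H1 t : H1 (V t).
Proof. by have [] := glue_H1 (halfline_hsol ug1 t) (halfline_hsol ug2 (- t)). Qed.

Lemma flowsol_continuous : continuous_H1 V.
Proof.
split=> [t _|t _]; first exact: flowsol_H1.
(* The norms are finite; passing to reals allows the sequential criterion [cvg_dnbhs_seq]. *)
pose N s : R := fine (normH1 setT (fun x => V s x - V t x)).
have H s : H1 (fun x => V s x - V t x).
  have [sa [ga sga aga]] := (H1P _).1 (flowsol_H1 s).
  have [sb [gb sgb agb]] := (H1P _).1 (flowsol_H1 t).
  apply/H1P; split; first exact: sqiB.
  by exists (fun x => ga x - gb x); [exact: sqiB|exact: acB].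
have NE s : normH1 setT (fun x => V s x - V t x) = (N s)%:E.
  have [sa [ga sga aga]] := (H1P _).1 (H s).
  by rewrite /N (normH1E measurableT sa sga aga).
(* The sequences avoid t, so the value at t is supplied separately to pass from the punctured to the
   full neighbourhood. *)
have Nt : N t = 0.
  rewrite /N; have -> : (fun x => V t x - V t x) = fun=> 0 by apply/funext => x; rewrite subrr.
  have s0 : sqi (fun=> 0) by split => //; under eq_fun do rewrite expr0n; exact: integrable0.
  have a0 : ac [set: R] (fun=> 0) (fun=> 0) by exact: ac_cst.
  rewrite (normH1E measurableT s0 s0 a0) /= expr0n/= addr0.
  by rewrite Rintegral_cst// mul0r sqrtr0.
have L : N s @[s --> t^'] --> (0 : R).
  apply: cvg_dnbhs_seq => h hn h1 h0.
  have := flowsol_cvg (halfline_hsol ug1 t) (halfline_hsol ug2 (- t)) hn h1 h0.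
  move=> /fine_cvg; apply: cvg_seq_eq => n.
  by rewrite /N; congr (fine (normH1 _ _)); apply/funext => x; rewrite (flowsol_group ug1 ug2).
(* The formula makes sense for all real times, so the limit is proved two-sided and then restricted
   to s >= 0. *)
rewrite (eq_cvg _ _ NE); apply: cvg_within_filter.
have cN : {for t, continuous N} by apply/continuous_withinNx; rewrite Nt.
by apply: cvg_EFin; [exact: nearW|rewrite -Nt; exact: cN].
Qed.

Lemma flowsol_evolution : evolution_eq V.
Proof.
move=> t _.
pose N s : R := fine (normL2 (fun x => (V s x - V t x) / (s - t) - linop (V t) x)).
have sl := sqi_linop (flowsol_H1 t).
have S s : sqi (fun x => (V s x - V t x) / (s - t) - linop (V t) x).
  have [sa _] := (H1P _).1 (flowsol_H1 s); have [sb _] := (H1P _).1 (flowsol_H1 t).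
  apply: sqiB => //; have := sqiZ (s - t)^-1 (sqiB sa sb).
  by under eq_fun do rewrite mulrC.
have NE s : normL2 (fun x => (V s x - V t x) / (s - t) - linop (V t) x) = (N s)%:E.
  by rewrite /N normL2E.
have L : N s @[s --> t^'] --> (0 : R).
  apply: cvg_dnbhs_seq => h hn h1 h0.
  have := flowsol_derive (halfline_hsol ug1 t) (halfline_hsol ug2 (- t)) hn h1 h0.
  move=> /fine_cvg; apply: cvg_seq_eq => n.
  rewrite /N; congr (fine (normL2 _)); apply/funext => x.
  by rewrite (flowsol_group ug1 ug2) [t + h n - t]addrC addKr.
rewrite (eq_cvg _ _ NE); apply: cvg_within_filter.
by apply: cvg_EFin; [exact: nearW|exact: L].
Qed.
End existence.

Lemma Rintegral_gt0 (f : R -> R) : integ setT f -> (forall x, x < 0 -> f x = 0) ->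
  \int[mu]_(x in `]0, +oo[) f x = \int[mu]_x f x.
Proof.
move=> fi f0; rewrite Rintegral_itv_obnd_cbnd; last by apply: integrableS fi.
rewrite Rintegral_mkcond; apply: eq_Rintegral => x _; rewrite patchE.
by case: ifPn => //; rewrite notin_setE/= in_itv/= andbT => /negP; rewrite -ltNge => /f0.
Qed.

Lemma Rintegral_lt0 (f : R -> R) : integ setT f -> (forall x, x < 0 -> f x = 0) ->
  \int[mu]_(x in `]-oo, 0[) f (- x) = \int[mu]_x f x.
Proof.
move=> fi f0; rewrite -(Rintegral_gt0 fi f0).
have mf : measurable_fun setT f by have /integrableP[/measurable_EFinP] := fi.
have mo : measurable_fun setT (fun x : R => f (- x)) by exact: measurableT_comp.
have pre : (-%R : R -> R) @^-1` `]-oo, 0[%classic = `]0, +oo[%classic.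
  by apply/seteqP; split => x /=; rewrite !in_itv/= ?andbT oppr_lt0.
have mI : measurable (`]-oo, 0[%classic : set R) by exact: measurable_itv.
have oo : (fun x : R => f (- - x)) = f by apply/funext => x; rewrite opprK.
have [] := Rintegral_opp mI mo; first by rewrite pre oo; apply: integrableS fi.
by move=> _ <-; rewrite pre; apply: eq_Rintegral => x _; rewrite opprK.
Qed.

Lemma integral_EFin (D : set R) (f : R -> R) : measurable D -> integ D f ->
  (\int[mu]_(x in D) (f x)%:E = (\int[mu]_(x in D) f x)%:E)%E.
Proof. by move=> mD fi; rewrite /Rintegral fineK//; exact: integrable_fin_num. Qed.

(** * Norms and weighted integrals on each half-line *)

Section norms.
Context (u1 g1 u2 g2 : R -> R) (ug1 : halfline u1 g1) (ug2 : halfline u2 g2).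

Let normE (D : set R) : measurable D -> ((normH1 D (glue u1 u2)) ^+ 2 =
  (\int[mu]_(x in D) (glue u1 u2 x ^+ 2 + glueB g1 g2 x ^+ 2))%:E)%E.
Proof.
move=> mD; have [ag sg sh _] := glue_H1 ug1 ug2.
rewrite (normH1E mD sg sh ag) -EFin_expe sqr_sqrtr//.
by apply: Rintegral_ge0 => x _; rewrite addr_ge0 ?sqr_ge0.
Qed.

Lemma normH1_right : ((normH1 `]0%R, +oo[ (glue u1 u2)) ^+ 2 =
  (\int[mu]_x (u1 x ^+ 2 + g1 x ^+ 2))%:E)%E.
Proof.
have [_ s1 t1 u10 g10] := ug1; have [_ _ _ u20 g20] := ug2.
rewrite normE//; congr EFin; rewrite -Rintegral_gt0; last 2 first.
- exact: sqr_sum_integ.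
- by move=> x x0; rewrite u10 ?ltW// g10// expr0n/= addr0.
apply: eq_Rintegral => x; rewrite inE/= in_itv/= andbT => x0.
have nx : - x < 0 by rewrite oppr_lt0.
by rewrite /glue /glueB (u20 _ (ltW nx)) (g20 _ nx) addr0 subr0.
Qed.

Lemma normH1_left : ((normH1 `]-oo, 0%R[ (glue u1 u2)) ^+ 2 =
  (\int[mu]_x (u2 x ^+ 2 + g2 x ^+ 2))%:E)%E.
Proof.
have [_ _ _ u10 g10] := ug1; have [_ s2 t2 u20 g20] := ug2.
rewrite normE//; congr EFin; rewrite -(@Rintegral_lt0 (fun x => u2 x ^+ 2 + g2 x ^+ 2)); last 2 first.
- exact: sqr_sum_integ.
- by move=> x x0; rewrite u20 ?ltW// g20// expr0n/= addr0.
apply: eq_Rintegral => x; rewrite inE/= in_itv/= => x0.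
by rewrite /glue /glueB (u10 _ (ltW x0)) (g10 _ x0) add0r sub0r sqrrN.
Qed.

Let weighted_integ (u g : R -> R) : halfline u g ->
  integ setT (fun x => expw x * (u x ^+ 2 + 2^-1 * g x ^+ 2)).
Proof.
move=> [_ su sg _ _]; have [meas_u _] := su; have [mg _] := sg.
have mw : measurable_fun setT expw by have /integrableP[/measurable_EFinP] := expw_integ.
apply: (@le_integrableR _ _ (fun x => u x ^+ 2 + g x ^+ 2)) => //.
- apply: measurable_funM => //; apply: measurable_funD; first exact: measurable_funX.
  by apply: measurable_funM => //; exact: measurable_funX.
- move=> x _; have := sqr_ge0 (u x); have := sqr_ge0 (g x).
  have /andP[w0 w1] : 0 <= expw x <= 1.
    by rewrite /expw; case: ifP => x0; rewrite ?lexx ?ler01// expR_ge0 expNle1.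
  move=> gg uu; rewrite ger0_norm; last by apply: mulr_ge0 => //; lra.
  by nra.
- exact: sqr_sum_integ.
Qed.

(** Stated for functions matching the data on x > 0, so that it applies to [v0] with its chosen weak
    derivative. *)
Lemma weighted_right (v g : R -> R) : (forall x, 0 < x -> v x = u1 x /\ g x = g1 x) ->
  (\int[mu]_(x in `]0%R, +oo[) (phi x * (v x ^+ 2 + 2^-1 * g x ^+ 2))%:E =
   (\int[mu]_x (expw x * (u1 x ^+ 2 + 2^-1 * g1 x ^+ 2)))%:E)%E.
Proof.
move=> vg; have wi := weighted_integ ug1.
rewrite -Rintegral_gt0//; last first.
  by move=> x x0; rewrite /expw leNgt x0/= mul0r.
rewrite -integral_EFin//; last by apply: integrableS wi.
apply: eq_integral => x; rewrite inE/= in_itv/= andbT => x0.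
by have [-> ->] := vg _ x0; rewrite phi_ge0 ?ltW// /expw (ltW x0).
Qed.

Lemma weighted_left (v g : R -> R) : (forall x, x < 0 -> v x = u2 (- x) /\ g x = - g2 (- x)) ->
  (\int[mu]_(x in `]-oo, 0%R[) (phi x * (v x ^+ 2 + 2^-1 * g x ^+ 2))%:E =
   (\int[mu]_x (expw x * (u2 x ^+ 2 + 2^-1 * g2 x ^+ 2)))%:E)%E.
Proof.
move=> vg; have wi := weighted_integ ug2.
rewrite -Rintegral_lt0//; last first.
  by move=> x x0; rewrite /expw leNgt x0/= mul0r.
have E x : x < 0 -> phi x * (v x ^+ 2 + 2^-1 * g x ^+ 2) =
    expw (- x) * (u2 (- x) ^+ 2 + 2^-1 * g2 (- x) ^+ 2).
  by move=> x0; have [-> ->] := vg _ x0; rewrite sqrrN (phi_le0 (ltW x0)) /expw oppr_ge0 (ltW x0) opprK.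
rewrite -integral_EFin//; last first.
  have mw : measurable_fun setT (fun x => expw x * (u2 x ^+ 2 + 2^-1 * g2 x ^+ 2)).
    by have /integrableP[/measurable_EFinP] := wi.
  have mo : measurable_fun setT (fun x : R => expw (- x) * (u2 (- x) ^+ 2 + 2^-1 * g2 (- x) ^+ 2)).
    exact: (measurableT_comp mw).
  have [] := Rintegral_opp measurableT mo.
    by rewrite preimage_setT; under eq_fun do rewrite opprK.
  by move=> i _; apply: integrableS i.
by apply: eq_integral => x; rewrite inE/= in_itv/= => x0; rewrite E.
Qed.
End norms.
End AC.

Unset Implicit Arguments.

Theorem theorem2 (R : realType) (v0 : R -> R) (v0_H1 : H1 v0)
    (v0_0 : v0 0 = 0) :
  exists v : R -> R -> R,
    [/\ global_solution v0 v,
        (forall w : R -> R -> R, global_solution v0 w ->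
           forall t x : R, 0 <= t -> w t x = v t x) &
        forall t : R, 0 < t ->
          [/\ v t 0 = 0,
              (normH1 `]0%R, +oo[ (v t) ^+ 2 =
               normH1 `]0%R, +oo[ v0 ^+ 2 +
               (2 * (expR t - 1))%:E *
               \int[lebesgue_measure]_(s in `]0%R, +oo[)
                  (phi s * (v0 s ^+ 2 + 2^-1 * wderiv v0 s ^+ 2))%:E)%E &
              (normH1 `]-oo, 0%R[ (v t) ^+ 2 =
               normH1 `]-oo, 0%R[ v0 ^+ 2 +
               (2 * (expR (- t) - 1))%:E *
               \int[lebesgue_measure]_(s in `]-oo, 0%R[)
                  (phi s * (v0 s ^+ 2 + 2^-1 * wderiv v0 s ^+ 2))%:E)%E]].
Proof.
pose mu := @lebesgue_measure R.
have [sv _] := (H1P v0).1 v0_H1; have [sg ag] := wderivP v0_H1.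
set g := wderiv v0 in sg ag *.
pose u1 x := if 0 <= x then v0 x else 0; pose g1 x := if 0 <= x then g x else 0.
(* The left half, reflected; the sign in [g2] is the chain rule. *)
pose u2 x := if 0 <= x then v0 (- x) else 0; pose g2 x := if 0 <= x then - g (- x) else 0.
have ug1 : halfline u1 g1 by exact: halfline_restrict.
have ug2 : halfline u2 g2.
  apply: halfline_restrict; [exact: (sqi_opp sv).1|exact: sqiN (sqi_opp sg).1| |by rewrite oppr0].
  by apply: ac_opp => //; case: sg.
have v0E : v0 = glue u1 u2.
  apply/funext => x; rewrite /glue /u1 /u2 oppr_ge0 opprK.
  by have [x0|x0|->] := ltgtP x 0; rewrite ?addr0 ?add0r// v0_0 addr0.
have sol0 x : flowsol u1 u2 0 x = v0 x by rewrite flowsol0 -v0E.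
exists (flowsol u1 u2); split.
- split=> //; [exact: flowsol_continuous ug1 ug2|exact: flowsol_evolution ug1 ug2].
- move=> w [[Hw _] ew w0] t x t0.
  have HV s : 0 <= s -> H1 (flowsol u1 u2 s) by move=> _; exact: flowsol_H1 ug1 ug2 s.
  have eV : evolution_eq (flowsol u1 u2) by exact: flowsol_evolution ug1 ug2.
  have e0 y : w 0 y = flowsol u1 u2 0 y by rewrite w0 sol0.
  exact: (solution_unique Hw HV ew eV e0).
move=> t t0.
have hl1 := halfline_hsol ug1 t; have hl2 := halfline_hsol ug2 (- t).
split.
- have [_ _ _ h1 _] := hl1; have [_ _ _ h2 _] := hl2.
  by rewrite /flowsol /glue oppr0 h1// h2// addr0.
- have N0 : ((normH1 `]0%R, +oo[ v0) ^+ 2 = (\int[mu]_x (u1 x ^+ 2 + g1 x ^+ 2))%:E)%E.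
    by rewrite [in LHS]v0E; exact: normH1_right ug1 ug2.
  have W : (\int[mu]_(s in `]0%R, +oo[) (phi s * (v0 s ^+ 2 + 2^-1 * g s ^+ 2))%:E =
      (\int[mu]_x (expw x * (u1 x ^+ 2 + 2^-1 * g1 x ^+ 2)))%:E)%E.
    by apply: (weighted_right ug1) => x x0; rewrite /u1 /g1 (ltW x0).
  apply: (etrans (normH1_right hl1 hl2)); apply: esym.
  apply: (etrans (f_equal2 (fun a b => a + (2 * (expR t - 1))%:E * b)%E N0 W)).
  by rewrite (hsol_norm ug1) -EFinM -EFinD.
- have N0 : ((normH1 `]-oo, 0%R[ v0) ^+ 2 = (\int[mu]_x (u2 x ^+ 2 + g2 x ^+ 2))%:E)%E.
    by rewrite [in LHS]v0E; exact: normH1_left ug1 ug2.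
  have W : (\int[mu]_(s in `]-oo, 0%R[) (phi s * (v0 s ^+ 2 + 2^-1 * g s ^+ 2))%:E =
      (\int[mu]_x (expw x * (u2 x ^+ 2 + 2^-1 * g2 x ^+ 2)))%:E)%E.
    by apply: (weighted_left ug2) => x x0; rewrite /u2 /g2 oppr_ge0 (ltW x0) !opprK.
  apply: (etrans (normH1_left hl1 hl2)); apply: esym.
  apply: (etrans (f_equal2 (fun a b => a + (2 * (expR (- t) - 1))%:E * b)%E N0 W)).
  (* The reflected half evolves for time -t, which is where the factor e^(-t) - 1 comes from. *)
  by rewrite (hsol_norm ug2) -EFinM -EFinD.
Qed.
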